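(* The assignment $$F^{(s)}_{ji}\mapsto -\,G^{(s+1)}_{ij}\cdot(-1)^{\bar\jmath}\qquad(s\ge0)$$ determines an isomorphism of $\mathbb Z_2$-graded algebras $\mathrm U(\mathfrak g)\to\mathrm{gr}'\,\mathrm Y(\mathfrak q_N)$.
   Context: Work over $\mathbb C$; fix $N\ge1$. Indices $i,j,k,l$ run over $\pm1,\dots,\pm N$; $\bar\imath=0$ if $i>0$ and $\bar\imath=1$ if $i<0$. Square brackets denote the supercommutator. $\mathbb C^{N|N}$ has basis $e_i$ with $\deg e_i=\bar\imath$; $E_{ij}$ are the matrix units, $\deg E_{ij}=\bar\imath+\bar\jmath$, also viewed as generators of the Lie superalgebra $\mathfrak{gl}_{N|N}$. Let $\eta$ be the automorphism $\eta(E_{ij})=E_{-i,-j}$. Yangian: $\mathrm Y(\mathfrak q_N)$ is the complex associative unital $\mathbb Z_2$-graded algebra with generators $T_{ij}^{(s)}$ ($s\ge1$), $\deg T^{(s)}_{ij}=\bar\imath+\bar\jmath$, and relations, where $T_{ij}(u)=\delta_{ij}+T^{(1)}_{ij}u^{-1}+T^{(2)}_{ij}u^{-2}+\cdots$, $$(u^2-v^2)[T_{ij}(u),T_{kl}(v)](-1)^{\bar\imath\bar k+\bar\imath\bar l+\bar k\bar l}=(u+v)\bigl(T_{kj}(u)T_{il}(v)-T_{kj}(v)T_{il}(u)\bigr)-(u-v)\bigl(T_{-k,j}(u)T_{-i,l}(v)-T_{k,-j}(v)T_{i,-l}(u)\bigr)(-1)^{\bar k+\bar l},$$ $$T_{ij}(-u)=T_{-i,-j}(u).$$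 $\mathrm{gr}'\,\mathrm Y(\mathfrak q_N)$ is the $\mathbb Z$-graded algebra associated with the ascending $\mathbb Z$-filtration on $\mathrm Y(\mathfrak q_N)$ in which $T^{(s)}_{ij}$ has degree $s-1$; $G^{(s)}_{ij}$ is the element of its degree $s-1$ component corresponding to $T^{(s)}_{ij}$; it has $\mathbb Z_2$-degree $\bar\imath+\bar\jmath$. Twisted polynomial current Lie superalgebra: $\mathfrak g=\{X(u)\in\mathfrak{gl}_{N|N}[u]:\eta(X(u))=X(-u)\}$ with pointwise bracket, spanned by $F^{(s)}_{ij}=E_{ij}u^s+E_{-i,-j}(-u)^s$, $s\ge0$. $\mathrm U(\mathfrak g)$ is its universal enveloping algebra with its natural $\mathbb Z_2$-gradation. *)

(* Defs.v *)
From HB Require Import structures.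
From mathcomp Require Import all_boot all_order all_algebra.
From mathcomp Require Import boolp reals complex monalg.

Set Implicit Arguments.
Unset Strict Implicit.
Unset Printing Implicit Defensive.

Import GRing.Theory.
Local Open Scope ring_scope.
Local Open Scope quotient_scope.

Section SpanIdeal.
Variables (K : fieldType) (A : algType K).
Implicit Types (S : A -> Prop) (x y : A).

Definition lin_span S x : Prop :=
  exists s : seq (K * A),
    (forall t, t \in s -> S t.2) /\ x = \sum_(t <- s) t.1 *: t.2.

(* Two-sided ideal generated by S: all finite sums of a * r * b with r in S. *)
Definition ideal_gen S : {pred A} := fun x =>
  `[< exists s : seq (A * A * A),
      (forall t, t \in s -> S t.1.2) /\
      x = \sum_(t <- s) t.1.1 * t.1.2 * t.2 >].

Lemma lin_span0 S : lin_span S 0.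
Proof. by exists [::]; rewrite big_nil. Qed.

Lemma lin_spanD S x y : lin_span S x -> lin_span S y -> lin_span S (x + y).
Proof.
move=> [s [hs ->]] [t [ht ->]]; exists (s ++ t); split; last by rewrite big_cat.
by move=> u; rewrite mem_cat => /orP[/hs|/ht].
Qed.

Lemma lin_spanZ S (c : K) x : lin_span S x -> lin_span S (c *: x).
Proof.
move=> [s [hs ->]]; exists [seq (c * t.1, t.2) | t <- s]; split.
  by move=> _ /mapP[t /hs ht ->].
by rewrite big_map scaler_sumr; apply: eq_bigr => t _; rewrite scalerA.
Qed.

Lemma lin_span_gen S x : S x -> lin_span S x.
Proof.
move=> Sx; exists [:: (1, x)]; split; last by rewrite big_seq1 scale1r.
by move=> t; rewrite inE => /eqP ->.
Qed.

Lemma lin_span_sub S S' x :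
  (forall y, S y -> S' y) -> lin_span S x -> lin_span S' x.
Proof. by move=> sSS' [s [hs ->]]; exists s; split=> // t /hs /sSS'. Qed.

Lemma lin_span_sum S (I : eqType) (s : seq I) (F : I -> A) :
  (forall i, i \in s -> lin_span S (F i)) -> lin_span S (\sum_(i <- s) F i).
Proof.
move=> h; rewrite big_seq; elim/big_rec: _ => [|i x /h hi hx].
  exact: lin_span0.
exact: lin_spanD.
Qed.

Lemma ideal_gen_zmod S : zmod_closed (ideal_gen S).
Proof.
split; first by apply/asboolP; exists [::]; rewrite big_nil.
move=> x y /asboolP[s [hs ->]] /asboolP[t [ht ->]]; apply/asboolP.
exists (s ++ [seq (- u.1.1, u.1.2, u.2) | u <- t]); split.
  by move=> u; rewrite mem_cat => /orP[/hs|/mapP[v /ht hv ->]].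
rewrite big_cat big_map -sumrN; congr (_ + _).
by apply: eq_bigr => u _; rewrite /= !mulNr.
Qed.

Lemma ideal_gen_mull S a x : x \in ideal_gen S -> a * x \in ideal_gen S.
Proof.
move=> /asboolP[s [hs ->]]; apply/asboolP.
exists [seq (a * u.1.1, u.1.2, u.2) | u <- s]; split.
  by move=> _ /mapP[v /hs hv ->].
by rewrite big_map mulr_sumr; apply: eq_bigr => u _; rewrite /= !mulrA.
Qed.

Lemma ideal_gen_mulr S a x : x \in ideal_gen S -> x * a \in ideal_gen S.
Proof.
move=> /asboolP[s [hs ->]]; apply/asboolP.
exists [seq (u.1.1, u.1.2, u.2 * a) | u <- s]; split.
  by move=> _ /mapP[v /hs hv ->].
by rewrite big_map mulr_suml; apply: eq_bigr => u _; rewrite /= !mulrA.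
Qed.

Lemma ideal_gen_mem S x : S x -> x \in ideal_gen S.
Proof.
move=> Sx; apply/asboolP; exists [:: (1, x, 1)]; split.
  by move=> t; rewrite inE => /eqP ->.
by rewrite big_seq1 mul1r mulr1.
Qed.

Lemma ideal_gen_proper S (e : {rmorphism A -> K}) :
  (forall x, S x -> e x = 0) -> 1 \notin ideal_gen S.
Proof.
move=> h; apply/negP => /asboolP[s [hs /(congr1 e)]].
rewrite rmorph1 rmorph_sum big_seq big1 => [/eqP|t /hs /h ht].
  by rewrite oner_eq0.
by rewrite !rmorphM ht mulr0 mul0r.
Qed.

Lemma ideal_gen_idealr S :
  1 \notin ideal_gen S -> idealr_closed (ideal_gen S).
Proof.
move=> h1; have [h0 hB] := ideal_gen_zmod S; split=> //.
move=> a x y hx hy; rewrite -[y]opprK; apply: (hB) => //.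
  exact: ideal_gen_mull.
by rewrite -[- y]add0r; apply: hB.
Qed.

End SpanIdeal.

(* The library's idealr is stable by multiplication on the left only. *)
HB.mixin Record isMulrStable (A : nzRingType) (S : A -> bool) := {
  mulr_stable_subproof : forall a, {in S, forall u, u * a \in S}
}.

#[short(type="biideal")]
HB.structure Definition Biideal (A : nzRingType) :=
  {S of Idealr A S & isMulrStable A S}.

Section AlgQuotient.
Variables (K : fieldType) (A : algType K) (I : biideal A).

Definition aquot := Quotient.quot I.

HB.instance Definition _ := GRing.Zmodule.on aquot.
HB.instance Definition _ := EqQuotient.on aquot.

Definition api : A -> aquot := \pi_aquot.

Lemma apiE x y : (api x == api y) = (x - y \in I).
Proof. by rewrite -(Quotient.idealrBE I). Qed.

Lemma apiP x y : reflect (api x = api y) (x - y \in I).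
Proof. by rewrite -apiE; apply: eqP. Qed.

Lemma api_repr (x : aquot) : api (repr x) = x.
Proof. exact: reprK. Qed.

Lemma api_additive : zmod_morphism api.
Proof. by move=> x y; rewrite /api !piE. Qed.

HB.instance Definition _ := GRing.isZmodMorphism.Build A aquot api api_additive.

Definition aq_mul (x y : aquot) : aquot := api (repr x * repr y).
Definition aq_scale (c : K) (x : aquot) : aquot := api (c *: repr x).

Lemma ideal_repr x : repr (api x) - x \in I.
Proof. by apply/apiP; rewrite api_repr. Qed.

Lemma aq_mulE x y : aq_mul (api x) (api y) = api (x * y).
Proof.
apply/apiP; set x' := repr _; set y' := repr _.
have -> : x' * y' - x * y = (x' - x) * y' + x * (y' - y).
  by rewrite mulrBl mulrBr addrA subrK.
apply: rpredD; first exact/mulr_stable_subproof/ideal_repr.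
exact/idealMr/ideal_repr.
Qed.

Lemma aq_scaleE c x : aq_scale c (api x) = api (c *: x).
Proof.
apply/apiP; rewrite -scalerBr -mulr_algl; exact/idealMr/ideal_repr.
Qed.

Let aqind (P : aquot -> Prop) : (forall x, P (api x)) -> forall x, P x.
Proof. by move=> h x; rewrite -(api_repr x). Qed.

Lemma aq_mulA : associative aq_mul.
Proof.
by elim/aqind=> x; elim/aqind=> y; elim/aqind=> z; rewrite !aq_mulE mulrA.
Qed.

Lemma aq_mul1 : left_id (api 1) aq_mul.
Proof. by elim/aqind=> x; rewrite !aq_mulE mul1r. Qed.

Lemma aq_mulr1 : right_id (api 1) aq_mul.
Proof. by elim/aqind=> x; rewrite !aq_mulE mulr1. Qed.

Lemma aq_mulDl : left_distributive aq_mul +%R.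
Proof.
elim/aqind=> x; elim/aqind=> y; elim/aqind=> z.
by rewrite -raddfD !aq_mulE mulrDl raddfD.
Qed.

Lemma aq_mulDr : right_distributive aq_mul +%R.
Proof.
elim/aqind=> x; elim/aqind=> y; elim/aqind=> z.
by rewrite -raddfD !aq_mulE mulrDr raddfD.
Qed.

Lemma aq_1neq0 : api 1 != 0.
Proof. by rewrite -(raddf0 api) apiE subr0 idealr1. Qed.

HB.instance Definition _ := GRing.Zmodule_isNzRing.Build aquot
  aq_mulA aq_mul1 aq_mulr1 aq_mulDl aq_mulDr aq_1neq0.

Lemma aq_scaleA a b x : aq_scale a (aq_scale b x) = aq_scale (a * b) x.
Proof. by elim/aqind: x => x; rewrite !aq_scaleE scalerA. Qed.

Lemma aq_scale1 : left_id 1 aq_scale.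
Proof. by elim/aqind=> x; rewrite aq_scaleE scale1r. Qed.

Lemma aq_scaleDr : right_distributive aq_scale +%R.
Proof.
move=> c; elim/aqind=> x; elim/aqind=> y.
by rewrite -raddfD !aq_scaleE scalerDr raddfD.
Qed.

Lemma aq_scaleDl x : {morph aq_scale^~ x : a b / a + b}.
Proof.
by elim/aqind: x => x a b; rewrite !aq_scaleE scalerDl raddfD.
Qed.

HB.instance Definition _ := GRing.Zmodule_isLmodule.Build K aquot
  aq_scaleA aq_scale1 aq_scaleDr aq_scaleDl.

Lemma aq_scaleAl c (x y : aquot) : c *: (x * y) = (c *: x) * y.
Proof.
elim/aqind: x => x; elim/aqind: y => y; rewrite /GRing.scale /GRing.mul /=.
by rewrite !(aq_mulE, aq_scaleE) scalerAl.
Qed.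

HB.instance Definition _ := GRing.Lmodule_isLalgebra.Build K aquot aq_scaleAl.

Lemma aq_scaleAr c (x y : aquot) : c *: (x * y) = x * (c *: y).
Proof.
elim/aqind: x => x; elim/aqind: y => y; rewrite /GRing.scale /GRing.mul /=.
by rewrite !(aq_mulE, aq_scaleE) scalerAr.
Qed.

HB.instance Definition _ := GRing.Lalgebra_isAlgebra.Build K aquot aq_scaleAr.

Lemma api_monoid_morphism : monoid_morphism api.
Proof. by split=> // x y; rewrite /GRing.mul /= aq_mulE. Qed.

HB.instance Definition _ :=
  GRing.isMonoidMorphism.Build A aquot api api_monoid_morphism.

Lemma api_scalable : scalable api.
Proof. by move=> c x; rewrite /GRing.scale /= aq_scaleE. Qed.

HB.instance Definition _ :=
  GRing.isScalable.Build K A aquot *:%R api api_scalable.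

End AlgQuotient.

(* Locked so that unification does not unfold the library's definitions. *)
HB.lock Definition free_mul (K : fieldType) (X : choiceType)
  (x y : {malg K[{fmonom X}]}) : {malg K[{fmonom X}]} := x * y.
HB.lock Definition free_scale (K : fieldType) (X : choiceType)
  (c : K) (x : {malg K[{fmonom X}]}) : {malg K[{fmonom X}]} := c *: x.

Section FreeAlgebra.
Variables (K : fieldType) (X : choiceType).

Definition freealg : Type := {malg K[{fmonom X}]}.

HB.instance Definition _ := GRing.Zmodule.on freealg.

Let free_mulE (x y : {malg K[{fmonom X}]}) : free_mul x y = x * y.
Proof. by rewrite free_mul.unlock. Qed.
Let free_scaleE c (x : {malg K[{fmonom X}]}) : free_scale c x = c *: x.
Proof. by rewrite free_scale.unlock. Qed.

Fact free_mulA : associative (@free_mul K X : freealg -> freealg -> freealg).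
Proof. by move=> x y z; rewrite !free_mulE mulrA. Qed.

Fact free_mul1r : left_id (1 : {malg K[{fmonom X}]}) (@free_mul K X).
Proof. by move=> x; rewrite free_mulE mul1r. Qed.

Fact free_mulr1 : right_id (1 : {malg K[{fmonom X}]}) (@free_mul K X).
Proof. by move=> x; rewrite free_mulE mulr1. Qed.

Fact free_mulDl :
  left_distributive (@free_mul K X : freealg -> freealg -> freealg) +%R.
Proof. by move=> x y z; rewrite !free_mulE; apply: mulrDl. Qed.

Fact free_mulDr :
  right_distributive (@free_mul K X : freealg -> freealg -> freealg) +%R.
Proof. by move=> x y z; rewrite !free_mulE; apply: mulrDr. Qed.

Fact free_1neq0 : (1 : {malg K[{fmonom X}]}) != 0 :> freealg.
Proof. exact: oner_neq0. Qed.

HB.instance Definition _ := GRing.Zmodule_isNzRing.Build freealg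
  free_mulA free_mul1r free_mulr1 free_mulDl free_mulDr free_1neq0.

Fact free_scaleA a b (x : freealg) :
  free_scale a (free_scale b x) = free_scale (a * b) x.
Proof. by rewrite !free_scaleE scalerA. Qed.

Fact free_scale1 : left_id 1 (@free_scale K X : K -> freealg -> freealg).
Proof. by move=> x; rewrite free_scaleE scale1r. Qed.

Fact free_scaleDr :
  right_distributive (@free_scale K X : K -> freealg -> freealg) +%R.
Proof. by move=> c x y; rewrite !free_scaleE; apply: scalerDr. Qed.

Fact free_scaleDl (x : freealg) :
  {morph (fun c => free_scale c x : freealg) : a b / a + b}.
Proof. by move=> a b; rewrite !free_scaleE; apply: scalerDl. Qed.

HB.instance Definition _ := GRing.Zmodule_isLmodule.Build K freealg
  free_scaleA free_scale1 free_scaleDr free_scaleDl.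

Fact free_scaleAl c (x y : freealg) : c *: (x * y) = (c *: x) * y.
Proof.
rewrite /GRing.scale /GRing.mul /= !free_scaleE !free_mulE; exact: scalerAl.
Qed.

HB.instance Definition _ :=
  GRing.Lmodule_isLalgebra.Build K freealg free_scaleAl.

Fact free_scaleAr c (x y : freealg) : c *: (x * y) = x * (c *: y).
Proof.
rewrite /GRing.scale /GRing.mul /= !free_scaleE !free_mulE.
have cC (g : {malg K[{fmonom X}]}) :
    g * (@malgC {fmonom X} K c) = @malgC {fmonom X} K c * g.
  rewrite !malgM_def fgmulgU fgmulUg; apply: eq_bigr => k _.
  by rewrite mulrC mulm1 mul1m.
by rewrite -!mul_malgC mulrA -cC mulrA.
Qed.

HB.instance Definition _ :=
  GRing.Lalgebra_isAlgebra.Build K freealg free_scaleAr.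

Definition fgen (x : X) : freealg := << fmu x >>.

(* The constant term is an augmentation; it is used to see that the ideals of
   relations below are proper. *)
Definition faug : freealg -> K := @mcoeff {fmonom X} K (@mone {fmonom X}).

Fact faug_zmod : zmod_morphism faug.
Proof. by move=> x y; rewrite /faug; apply: raddfB. Qed.

HB.instance Definition _ := GRing.isZmodMorphism.Build freealg K faug faug_zmod.

Fact faug_monoid : monoid_morphism faug.
Proof.
have [hM h1] := @mcoeff1g_is_multiplicative {fmonom X} K.
split=> [|x y]; first exact: h1.
rewrite /faug /GRing.mul /= free_mulE; exact: hM.
Qed.

HB.instance Definition _ :=
  GRing.isMonoidMorphism.Build freealg K faug faug_monoid.

Lemma faug_gen x : faug (fgen x) = 0.
Proof.
rewrite /faug /fgen mcoeffU1.
by case: eqP => // /(congr1 (@fmonom_val X)); rewrite fmU fm1.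
Qed.

Lemma faugZ c x : faug (c *: x) = c * faug x.
Proof. by rewrite /faug /GRing.scale /= free_scaleE; apply: mcoeffZ. Qed.

Lemma faugD x y : faug (x + y) = faug x + faug y. Proof. exact: rmorphD. Qed.
Lemma faugN x : faug (- x) = - faug x. Proof. exact: rmorphN. Qed.
Lemma faugB x y : faug (x - y) = faug x - faug y. Proof. exact: rmorphB. Qed.
Lemma faugM x y : faug (x * y) = faug x * faug y. Proof. exact: rmorphM. Qed.

End FreeAlgebra.

(* A Z-filtration with F_d = 0 for d < 0, given by its terms of degree d >= 0. *)
Record filtration (K : fieldType) (A : algType K) := Filtration {
  fil :> nat -> A -> Prop;
  filD : forall d x y, fil d x -> fil d y -> fil d (x + y);
  filZ : forall d (c : K) x, fil d x -> fil d (c *: x);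
  fil_le : forall d e x, (d <= e)%N -> fil d x -> fil e x;
  fil1 : fil 0%N 1;
  filM : forall d e x y, fil d x -> fil e y -> fil (d + e)%N (x * y);
}.

Section AssociatedGraded.
Variables (K : fieldType) (A : algType K) (F : filtration A).

(* Membership in F_(d-1). *)
Definition fil_pred (d : nat) (x : A) : Prop :=
  if d is d'.+1 then F d' x else x = 0.

Lemma fil0 d : F d 0.
Proof.
by rewrite -(scale0r 1); apply: filZ; apply: fil_le (leq0n d) (fil1 F).
Qed.

Lemma filN d x : F d x -> F d (- x).
Proof. by rewrite -scaleN1r; apply: filZ. Qed.

Lemma fil_sum d (I : eqType) (s : seq I) (f : I -> A) :
  (forall i, i \in s -> F d (f i)) -> F d (\sum_(i <- s) f i).
Proof.
move=> h; rewrite big_seq; elim/big_rec: _ => [|i x /h hi hx].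
  exact: fil0.
exact: filD.
Qed.

Lemma fil_pred0 d : fil_pred d 0.
Proof. by case: d => //= d; apply: fil0. Qed.

Lemma fil_predD d x y : fil_pred d x -> fil_pred d y -> fil_pred d (x + y).
Proof. by case: d => [|d] /= => [-> ->|]; [rewrite addr0|apply: filD]. Qed.

Lemma fil_predN d x : fil_pred d x -> fil_pred d (- x).
Proof. by case: d => [|d] /= => [->|]; [rewrite oppr0|apply: filN]. Qed.

Lemma fil_predMl d e x y : F d x -> fil_pred e y -> fil_pred (d + e) (x * y).
Proof.
case: e => [|e] Fx /= => [->|Fy]; first by rewrite mulr0; apply: fil_pred0.
by rewrite addnS; apply: filM.
Qed.

Lemma fil_predMr d e x y : fil_pred d x -> F e y -> fil_pred (d + e) (x * y).
Proof.
case: d => [|d] /= => [-> _|Fx Fy]; first by rewrite mul0r; apply: fil_pred0.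
exact: filM.
Qed.

Lemma fil_pred_sum d (I : finType) (f : I -> A) :
  (forall i, fil_pred d (f i)) -> fil_pred d (\sum_i f i).
Proof.
move=> h; elim/big_rec: _ => [|i x _]; first exact: fil_pred0.
exact: fil_predD.
Qed.

(* The direct sum of the F_d, as the polynomials whose coefficient of 'X^d is
   in F_d; multiplication is convolution. *)
Definition fsum_pred : {pred {poly A}} := fun p => `[< forall d, F d p`_d >].

Lemma fsum_subring : subring_closed fsum_pred.
Proof.
split.
- apply/asboolP => -[|d]; rewrite coef1 /=; first exact: fil1.
  exact: fil0.
- move=> p q /asboolP hp /asboolP hq; apply/asboolP => d.
  by rewrite coefB; apply: filD => //; apply: filN.
- move=> p q /asboolP hp /asboolP hq; apply/asboolP => d.
  rewrite coefM; apply: fil_sum => i _.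
  by rewrite -[d in F d](subnKC (leq_ord i)); apply: filM.
Qed.

HB.instance Definition _ :=
  GRing.isSubringClosed.Build {poly A} fsum_pred fsum_subring.

Record fsum := FSum { fsum_val : {poly A}; fsum_valP : fsum_val \in fsum_pred }.

HB.instance Definition _ := [isSub for fsum_val].
HB.instance Definition _ := [Choice of fsum by <:].
HB.instance Definition _ := [SubChoice_isSubNzRing of fsum by <:].

Lemma fsum_coefP (p : fsum) d : F d (val p)`_d.
Proof. by have /asboolP := fsum_valP p; apply. Qed.

Fact fsum_scale_subproof (c : K) (p : fsum) :
  (c%:A : A) *: val p \in fsum_pred.
Proof.
apply/asboolP => d; rewrite coefZ mulr_algl; apply: filZ; exact: fsum_coefP.
Qed.

Definition fsum_scale c p := FSum (fsum_scale_subproof c p).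

Fact fsum_scaleA a b p : fsum_scale a (fsum_scale b p) = fsum_scale (a * b) p.
Proof. by apply: val_inj; rewrite /= scalerA mulr_algl scalerA. Qed.

Fact fsum_scale1 : left_id 1 fsum_scale.
Proof. by move=> p; apply: val_inj; rewrite /= !scale1r. Qed.

Fact fsum_scaleDr : right_distributive fsum_scale +%R.
Proof. by move=> c p q; apply: val_inj; rewrite /= scalerDr. Qed.

Fact fsum_scaleDl p : {morph fsum_scale^~ p : a b / a + b}.
Proof. by move=> a b; apply: val_inj; rewrite /= !scalerDl. Qed.

HB.instance Definition _ := GRing.Zmodule_isLmodule.Build K fsum
  fsum_scaleA fsum_scale1 fsum_scaleDr fsum_scaleDl.

Fact fsum_scaleAl c (p q : fsum) : c *: (p * q) = (c *: p) * q.
Proof. by apply: val_inj; rewrite /= scalerAl. Qed.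

HB.instance Definition _ := GRing.Lmodule_isLalgebra.Build K fsum fsum_scaleAl.

Fact fsum_scaleAr c (p q : fsum) : c *: (p * q) = p * (c *: q).
Proof.
apply: val_inj; apply/polyP => d; rewrite /= coefZ !coefM mulr_sumr.
by apply: eq_bigr => i _; rewrite coefZ !mulr_algl scalerAr.
Qed.

HB.instance Definition _ := GRing.Lalgebra_isAlgebra.Build K fsum fsum_scaleAr.

(* The direct sum of the F_(d-1), a two-sided ideal of the previous algebra. *)
Definition fsum_ideal : {pred fsum} :=
  fun p => `[< forall d, fil_pred d (val p)`_d >].

Lemma fsum_idealr : idealr_closed fsum_ideal.
Proof.
split.
- by apply/asboolP => d; rewrite coef0; apply: fil_pred0.
- apply/negP => /asboolP/(_ 0%N); rewrite coef1 /= => /eqP.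
  by rewrite oner_eq0.
- move=> a p q /asboolP hp /asboolP hq; apply/asboolP => d.
  rewrite coefD; apply: fil_predD => //; rewrite coefM.
  apply: fil_pred_sum => i; rewrite -[d in fil_pred d](subnKC (leq_ord i)).
  by apply: fil_predMl => //; apply: fsum_coefP.
Qed.

HB.instance Definition _ := isIdealr.Build fsum fsum_ideal fsum_idealr.

Lemma fsum_ideal_mulr a : {in fsum_ideal, forall p, p * a \in fsum_ideal}.
Proof.
move=> p /asboolP hp; apply/asboolP => d; rewrite coefM.
apply: fil_pred_sum => i; rewrite -[d in fil_pred d](subnKC (leq_ord i)).
by apply: fil_predMr => //; apply: fsum_coefP.
Qed.

HB.instance Definition _ :=
  isMulrStable.Build fsum fsum_ideal fsum_ideal_mulr.

(* gr F = (direct sum of the F_d) / (direct sum of the F_(d-1)). *)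
Definition gr := aquot fsum_ideal.

HB.instance Definition _ := GRing.Algebra.on gr.

Fact gr_symbol_subproof d x (Fx : F d x) : x *: 'X^d \in fsum_pred.
Proof.
apply/asboolP => e; rewrite coefZ coefXn.
by case: eqP => [->|_]; [rewrite mulr1|rewrite mulr0; apply: fil0].
Qed.

(* The image of x in F_d / F_(d-1), the degree d component of gr F. *)
Definition gr_symbol d x (Fx : F d x) : gr :=
  api fsum_ideal (FSum (gr_symbol_subproof Fx)).

(* The Z_2-grading of gr F induced by one of A: the homogeneous component of
   parity p is the direct sum over d of the images of F_d /\ A_p. *)
Definition gr_parity (Ap : bool -> A -> Prop) (p : bool) (x : gr) : Prop :=
  exists r : fsum, (forall d, Ap p (val r)`_d) /\ x = api fsum_ideal r.

End AssociatedGraded.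

(* (a, false) stands for the index a + 1 and (a, true) for - (a + 1); so the
   parity of i is i.2. *)
Definition sidx (N : nat) : Type := ('I_N * bool)%type.
HB.instance Definition _ N := Finite.on (sidx N).

Definition bar N (i : sidx N) : bool := i.2.
Definition neg N (i : sidx N) : sidx N := (i.1, ~~ i.2).

Lemma negK N : involutive (@neg N).
Proof. by case=> a b; rewrite /neg /= negbK. Qed.

Section Yangian.
Variables (K : fieldType) (N : nat).
Implicit Types (i j k l : sidx N).

(* (i, j, s) indexes the generator T_ij^(s+1). *)
Definition ygen : Type := (sidx N * sidx N * nat)%type.
HB.instance Definition _ := Choice.on ygen.

(* Coefficient of u^(-m) in T_ij(u), as an element of the free algebra. *)
Definition fT i j (m : int) : freealg K ygen :=
  match m with
  | Posz 0 => (i == j)%:R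
  | Posz s.+1 => fgen K (i, j, s)
  | Negz _ => 0
  end.

Definition fT_comm i j m k l n : freealg K ygen :=
  fT i j m * fT k l n
  - (-1) ^+ ((bar i + bar j) * (bar k + bar l))%N *: (fT k l n * fT i j m).

(* Coefficients of u^(-m) v^(-n) in
   T_kj(u) T_il(v) - T_kj(v) T_il(u)  and in
   T_(-k,j)(u) T_(-i,l)(v) - T_(k,-j)(v) T_(i,-l)(u). *)
Definition fT_P i j k l m n : freealg K ygen :=
  fT k j m * fT i l n - fT k j n * fT i l m.
Definition fT_Q i j k l m n : freealg K ygen :=
  fT (neg k) j m * fT (neg i) l n - fT k (neg j) n * fT i (neg l) m.

(* Difference of the coefficients of u^(-m) v^(-n) in the two sides of the
   quadratic relation; multiplying a series by u shifts m to m + 1. *)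
Definition yrel1 i j k l (m n : int) : freealg K ygen :=
  (-1) ^+ (bar i * bar k + bar i * bar l + bar k * bar l)%N *:
    (fT_comm i j (m + 2) k l n - fT_comm i j m k l (n + 2))
  - ((fT_P i j k l (m + 1) n + fT_P i j k l m (n + 1))
     - (-1) ^+ (bar k + bar l)%N *:
         (fT_Q i j k l (m + 1) n - fT_Q i j k l m (n + 1))).

(* The same for the coefficient of u^(-m) in T_ij(-u) = T_(-i,-j)(u). *)
Definition yrel2 i j (m : int) : freealg K ygen :=
  (-1) ^+ `|m|%N *: fT i j m - fT (neg i) (neg j) m.

Inductive yrel : freealg K ygen -> Prop :=
| Yrel1 i j k l m n : yrel (yrel1 i j k l m n)
| Yrel2 i j m : yrel (yrel2 i j m).

Definition yideal : {pred freealg K ygen} := ideal_gen yrel.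

Lemma faug_fT i j m : @faug K ygen (fT i j m) = ((m == 0) && (i == j))%:R.
Proof.
case: m => [[|s]|s]; rewrite /fT ?faug_gen ?raddf0 //.
by rewrite rmorph_nat.
Qed.

Lemma faug_yrel x : yrel x -> @faug K ygen x = 0.
Proof.
have negE i j : (neg i == j) = (i == neg j).
  by apply/eqP/eqP => [<-|->]; rewrite negK.
case=> [i j k l m n|i j m]; last first.
  rewrite /yrel2 faugB faugZ !faug_fT (inj_eq (can_inj (@negK N))).
  by case: m => [[|s]|s]; rewrite /= ?mul1r ?mulr0 ?subrr.
have hP m' n' : @faug K ygen (fT_P i j k l m' n') = 0.
  rewrite /fT_P faugB 2!faugM 4!faug_fT -!natrM !mulnb.
  by do !case: (_ == _); rewrite ?subrr.
have hQ m' n' : @faug K ygen (fT_Q i j k l m' n') = 0.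
  rewrite /fT_Q faugB 2!faugM 4!faug_fT !negE -!natrM !mulnb.
  by do !case: (_ == _); rewrite ?subrr.
have hC m' n' : @faug K ygen (fT_comm i j m' k l n') = 0.
  rewrite /fT_comm faugB faugZ 2!faugM 2!faug_fT.
  have [->|] := eqVneq i j; last by rewrite !andbF !(mulr0, mul0r) subrr.
  have [->|] := eqVneq k l; last by rewrite !andbF !(mulr0, mul0r) subrr.
  rewrite !addnn -muln2 mulnAC exprM sqrr_sign mul1r.
  by rewrite [in X in _ - X]mulrC subrr.
have comb (s t : K) a b c d e f : @faug K ygen a = 0 -> faug b = 0 ->
    faug c = 0 -> faug d = 0 -> faug e = 0 -> faug f = 0 ->
    faug (s *: (a - b) - ((c + d) - t *: (e - f))) = 0.
  move=> ha hb hc hd he hf; rewrite !(faugD, faugN, faugZ).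
  by rewrite ha hb hc hd he hf !(oppr0, addr0, mulr0).
exact: (comb _ _ _ _ _ _ _ _ (hC _ _) (hC _ _) (hP _ _) (hP _ _) (hQ _ _)
  (hQ _ _)).
Qed.

Lemma yideal_idealr : idealr_closed yideal.
Proof. exact/ideal_gen_idealr/ideal_gen_proper/faug_yrel. Qed.

HB.instance Definition _ := isIdealr.Build (freealg K ygen) yideal yideal_idealr.
HB.instance Definition _ := isMulrStable.Build (freealg K ygen) yideal
  (fun a u => @ideal_gen_mulr K (freealg K ygen) yrel a u).

Definition yangian := aquot yideal.
HB.instance Definition _ := GRing.Algebra.on yangian.

(* T_ij^(s) for s >= 1; T_ij^(0) is the Kronecker delta. *)
Definition yT i j (s : nat) : yangian := api yideal (fT i j s).

(* Word in the generators; the letter (i, j, s) is T_ij^(s+1). *)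
Definition yword (w : seq ygen) : yangian :=
  \prod_(g <- w) yT g.1.1 g.1.2 g.2.+1.

Definition yparity (p : bool) : yangian -> Prop :=
  lin_span (fun x => exists2 w,
    \big[addb/false]_(g <- w) (bar g.1.1 (+) bar g.1.2) = p & x = yword w).

(* The filtration with T_ij^(s+1) of degree s. *)
Definition yfil (d : nat) : yangian -> Prop :=
  lin_span (fun x => exists2 w, (\sum_(g <- w) g.2 <= d)%N & x = yword w).

Lemma yfil_le d e x : (d <= e)%N -> yfil d x -> yfil e x.
Proof.
move=> de; apply: lin_span_sub => y [w hw ->]; exists w => //.
exact: leq_trans hw de.
Qed.

Lemma yfil1 : yfil 0 1.
Proof.
apply: lin_span_gen; exists [::]; first by rewrite big_nil.
by rewrite /yword big_nil.
Qed.

Lemma yfilM d e x y : yfil d x -> yfil e y -> yfil (d + e) (x * y).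
Proof.
move=> [s [hs ->]] [t [ht ->]]; rewrite mulr_suml.
apply: lin_span_sum => a /hs [v hv ->]; rewrite mulr_sumr.
apply: lin_span_sum => b /ht [w hw ->].
rewrite -scalerAl -scalerAr scalerA; apply: lin_spanZ.
apply: lin_span_gen; exists (v ++ w); first by rewrite big_cat leq_add.
by rewrite /yword big_cat.
Qed.

Definition yfiltration : filtration yangian :=
  Filtration (fun d x y => @lin_spanD _ _ _ x y)
    (fun d c x => @lin_spanZ _ _ _ c x) yfil_le yfil1 yfilM.

Definition gr_yangian := gr yfiltration.
HB.instance Definition _ := GRing.Algebra.on gr_yangian.

Fact yfil_T i j s : yfil s (yT i j s.+1).
Proof.
apply: lin_span_gen; exists [:: (i, j, s)]; first by rewrite big_seq1.
by rewrite /yword big_seq1.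
Qed.

(* G_ij^(s+1), which has degree s. *)
Definition yG i j (s : nat) : gr_yangian :=
  @gr_symbol K yangian yfiltration s (yT i j s.+1) (yfil_T i j s).

Definition gr_yparity (p : bool) : gr_yangian -> Prop :=
  @gr_parity K yangian yfiltration yparity p.

End Yangian.

Section Enveloping.
Variables (K : fieldType) (L : lmodType K).
Variables (par : bool -> L -> Prop) (br : L -> L -> L).

(* Relations making the generators linear in x : L, and identifying the
   supercommutator of homogeneous generators with the bracket. *)
Inductive urel : freealg K L -> Prop :=
| UrelD x y : urel (fgen K (x + y) - (fgen K x + fgen K y))
| UrelZ c x : urel (fgen K (c *: x) - c *: fgen K x)
| UrelB p q x y : par p x -> par q y ->
    urel (fgen K x * fgen K y - (-1) ^+ (p * q)%N *: (fgen K y * fgen K x)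
          - fgen K (br x y)).

Definition uideal : {pred freealg K L} := ideal_gen urel.

Lemma faug_urel x : urel x -> @faug K L x = 0.
Proof.
case=> [y z|c y|p q y z _ _].
- by rewrite faugB faugD !faug_gen addr0 subrr.
- by rewrite faugB faugZ !faug_gen mulr0 subrr.
- by rewrite !faugB faugZ !faugM !faug_gen !mulr0 !subrr.
Qed.

Lemma uideal_idealr : idealr_closed uideal.
Proof. exact/ideal_gen_idealr/ideal_gen_proper/faug_urel. Qed.

HB.instance Definition _ := isIdealr.Build (freealg K L) uideal uideal_idealr.
HB.instance Definition _ := isMulrStable.Build (freealg K L) uideal
  (fun a u => @ideal_gen_mulr K (freealg K L) urel a u).

Definition envelop := aquot uideal.
HB.instance Definition _ := GRing.Algebra.on envelop.

Definition uinj (x : L) : envelop := api uideal (fgen K x).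

(* Homogeneous component of parity p, spanned by the products of homogeneous
   elements of L with total parity p; a letter is paired with its parity. *)
Definition uparity (p : bool) : envelop -> Prop :=
  lin_span (fun z => exists w : seq (L * bool),
    [/\ forall a, a \in w -> par a.2 a.1,
        \big[addb/false]_(a <- w) a.2 = p &
        z = \prod_(a <- w) uinj a.1]).

End Enveloping.

Section TwistedCurrent.
Variables (K : fieldType) (N : nat).
Implicit Types (i j k l : sidx N).

(* gl_(N|N)[u]: matrices over K[u] with rows and columns indexed by sidx N. *)
Definition glpoly : Type := {ffun sidx N * sidx N -> {poly K}}.
HB.instance Definition _ := GRing.Lmodule.on glpoly.
Implicit Types (X Y : glpoly).

Definition glunit i j (a : {poly K}) : glpoly :=
  [ffun ij => if ij == (i, j) then a else 0].

Definition gl_homog (p : bool) X : Prop :=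
  forall i j, X (i, j) != 0 -> bar i (+) bar j = p.

(* Bilinear extension of [X, Y] = XY - (-1)^(deg X deg Y) YX, where E_ij has
   degree bar i + bar j. *)
Definition gl_bracket X Y : glpoly :=
  [ffun ij => \sum_k (X (ij.1, k) * Y (k, ij.2)
     - (-1) ^+ ((bar ij.1 + bar k) * (bar k + bar ij.2))%N
         * (Y (ij.1, k) * X (k, ij.2)))].

Definition gl_eta X : glpoly := [ffun ij => X (neg ij.1, neg ij.2)].

Definition gl_minus X : glpoly := [ffun ij => X ij \Po (- 'X)].

Definition tw_pred : {pred glpoly} := fun X => gl_eta X == gl_minus X.

Lemma tw_submod : submod_closed tw_pred.
Proof.
split; first by apply/eqP/ffunP => ij; rewrite !ffunE comp_poly0.
move=> c X Y /eqP/ffunP hX /eqP/ffunP hY; apply/eqP/ffunP => ij.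
have := hX ij; have := hY ij; rewrite !ffunE => -> ->.
by rewrite linearP.
Qed.

HB.instance Definition _ := GRing.isSubmodClosed.Build K glpoly tw_pred tw_submod.

Record twcur := TwCur { tw_val : glpoly; tw_valP : tw_val \in tw_pred }.

HB.instance Definition _ := [isSub for tw_val].
HB.instance Definition _ := [Choice of twcur by <:].
HB.instance Definition _ := [SubChoice_isSubLmodule of twcur by <:].

Fact tw_bracket_subproof (X Y : twcur) :
  gl_bracket (val X) (val Y) \in tw_pred.
Proof.
have /eqP/ffunP hX := tw_valP X; have /eqP/ffunP hY := tw_valP Y.
have {}hX i j : tw_val X (neg i, neg j) = tw_val X (i, j) \Po (- 'X).
  by have := hX (i, j); rewrite !ffunE.
have {}hY i j : tw_val Y (neg i, neg j) = tw_val Y (i, j) \Po (- 'X).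
  by have := hY (i, j); rewrite !ffunE.
apply/eqP/ffunP => -[i j]; rewrite !ffunE /= raddf_sum /=.
rewrite (reindex_inj (can_inj (@negK N))); apply: eq_bigr => k _ /=.
rewrite !hX !hY raddfB /= !rmorphM /= rmorphXn rmorphN1; congr (_ - _ * _).
rewrite -signr_odd -[RHS]signr_odd !oddM !oddD /bar /neg /= !oddb.
by case: i.2; case: j.2; case: k.2.
Qed.

Definition tw_bracket (X Y : twcur) : twcur := TwCur (tw_bracket_subproof X Y).

Definition tw_homog (p : bool) (X : twcur) : Prop := gl_homog p (val X).

Fact twF_subproof i j s :
  glunit i j 'X^s + glunit (neg i) (neg j) ((- 'X) ^+ s) \in tw_pred.
Proof.
have negE (k l a b : sidx N) :
    ((neg k, neg l) == (a, b)) = ((k, l) == (neg a, neg b)).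
  by rewrite !xpair_eqE (inv_eq (@negK N) k) (inv_eq (@negK N) l).
apply/eqP/ffunP => -[k l]; rewrite !ffunE !negE !negK comp_polyD addrC.
congr (_ + _); case: ifP => _; rewrite ?comp_poly0 //.
  by rewrite comp_Xn_poly.
rewrite -(comp_Xn_poly (- 'X)) -comp_polyA (raddfN (comp_poly _)) /=.
by rewrite comp_polyX opprK comp_polyXr.
Qed.

Definition twF i j s : twcur := TwCur (twF_subproof i j s).

Definition Utw := envelop tw_homog tw_bracket.
HB.instance Definition _ := GRing.Algebra.on Utw.

Definition Utw_inj (X : twcur) : Utw := uinj tw_homog tw_bracket X.

Definition Utw_parity (p : bool) : Utw -> Prop :=
  @uparity K twcur tw_homog tw_bracket p.

End TwistedCurrent.

(* Main.v *)
(* The defining relations give, modulo lower filtration degree, the brackets of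
   the twisted current algebra g for the symbols G_ij^(s), so U(g) maps onto
   gr' Y; the point is injectivity. The Yangian coacts on gl_(N|N)[z] by
   T(u) |-> T(u) (x) L(u), where L is the image of T(u) in the vector
   representation with spectral parameter z. Counting z with degree 1, the
   leading part of this coaction is X |-> X (x) 1 + 1 (x) X(z), which is also
   defined on U(g); hence the coefficients of the coaction on U(g) preserve the
   kernel of U(g) -> gr' Y. With the term x (x) 1 removed, these coefficients
   lower the length of words, and composing them with the dual basis of g gives
   an Euler operator acting on words of length m as m modulo shorter words. By
   induction on the length, an element of the kernel is annihilated by all these
   derivations, so it is shorter, and finally it is 0. This needs neither the
   Poincare-Birkhoff-Witt theorem for U(g) nor one for Y. *)
Require Import Defs.
From HB Require Import structures.
From mathcomp Require Import all_boot all_order all_algebra.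
From mathcomp Require Import boolp reals complex monalg zify ring.

Set Implicit Arguments.
Unset Strict Implicit.
Unset Printing Implicit Defensive.

Import Order.TTheory GRing.Theory Num.Theory.
Local Open Scope ring_scope.

(** The coaction on Y exists because the quadratic relation, with the products in which u comes
    first on one side and those in which v comes first on the other, reads R T1 T2 = T2 T1 R, the
    same R acting on rows and on columns. A product of two supercommuting solutions is then again a
    solution. In the image of T_ij^(s+1) the mixed terms carry T^(s-c) z^c with 0 <= c < s. Their
    total degree is s - 1, one too low to contribute, which is why the leading part is additive and
    makes sense on U(g). By the twist it suffices to use the rows a > 0. There the parity operator
    acts trivially and F_ab has parity bar b, which is exactly the sign that appears when F_ab is
    moved past a letter. Characteristic 0 enters twice: through division by m in the Euler operator,
    and through division by 2 in separating the parity components of gr' Y. These are images of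
    spans, so that their intersection has to be shown to be 0; this uses the automorphism T_ij ->
    (-1)^(bar i + bar j) T_ij of Y. *)

Section FreeLift.
Variables (K : fieldType) (X : choiceType) (S : algType K) (f : X -> S).

Definition fmonom_eval (w : {fmonom X}) : S := \prod_(x <- fmonom_val w) f x.

Fact fmonom_eval_morph : mmorphism fmonom_eval.
Proof.
split=> [v w|]; rewrite /fmonom_eval; first by rewrite fmM big_cat.
by rewrite fm1 big_nil.
Qed.

HB.instance Definition _ :=
  monalg.isMultiplicative.Build {fmonom X} S fmonom_eval fmonom_eval_morph.

Definition flift (g : freealg K X) : S := mmap (in_alg S) fmonom_eval g.

Fact flift_zmod : zmod_morphism flift.
Proof. by move=> x y; rewrite /flift; apply: raddfB. Qed.

HB.instance Definition _ :=
  GRing.isZmodMorphism.Build (freealg K X) S flift flift_zmod.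

Fact flift_monoid : monoid_morphism flift.
Proof.
have cS (g : {malg K[{fmonom X}]}) m m' :
    GRing.comm (in_alg S (mcoeff m g)) (fmonom_eval m').
  by rewrite /GRing.comm /= mulr_algl mulr_algr.
have [hM h1] := commr_mmap_is_multiplicative cS.
split=> [|x y]; first exact: h1.
rewrite /flift [in LHS]/GRing.mul /= free_mul.unlock; exact: hM.
Qed.

HB.instance Definition _ :=
  GRing.isMonoidMorphism.Build (freealg K X) S flift flift_monoid.

Fact flift_scalable : scalable flift.
Proof.
move=> c x; rewrite /flift [in LHS]/GRing.scale /= free_scale.unlock.
by rewrite mmapZ /= mulr_algl.
Qed.

HB.instance Definition _ :=
  GRing.isScalable.Build K (freealg K X) S *:%R flift flift_scalable.

Lemma flift_gen x : flift (fgen K x) = f x.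
Proof.
by rewrite /flift /fgen mmapU /= scale1r mul1r /fmonom_eval fmU big_seq1.
Qed.

End FreeLift.

Definition fword (K : fieldType) (X : choiceType) (w : seq X) : freealg K X :=
  \prod_(x <- w) fgen K x.

Lemma freealg_span (K : fieldType) (X : choiceType) (g : freealg K X) :
  exists s : seq (K * seq X), g = \sum_(t <- s) t.1 *: fword K t.2.
Proof.
have mE (m : {fmonom X}) (c : K) :
    << c *g m >> = c *: fword K (fmonom_val m) :> freealg K X.
  have -> : fword K (fmonom_val m) = << m >>.
    rewrite /fword; have -> : m = FMonom (fmonom_val m) by rewrite fmK.
    elim: (fmonom_val m) => [|x w IH]; first by rewrite /= big_nil -fmoneE.
    rewrite /= big_cons; have /= -> := IH.
    rewrite [LHS]/GRing.mul /= free_mul.unlock malgM_def /fgen fgmulUU mulr1.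
    congr << _ *g _ >>; apply/eqP; rewrite fmP fmM.
    by rewrite fmU.
  rewrite [RHS]/GRing.scale /= free_scale.unlock.
  by apply/malgP => k; rewrite mcoeffZ !mcoeffU mulrnAr mulr1.
exists [seq (mcoeff m g, fmonom_val m) | m <- finmap.enum_fset (msupp g)].
rewrite big_map {1}(monalgE g).
by apply: eq_bigr => m _; rewrite mE.
Qed.

(** * Morphisms out of quotients by two-sided ideals *)

Section QuotientLift.
Variables (K : fieldType) (A : algType K) (I : biideal A) (S : algType K).
Variables (g : {lrmorphism A -> S}) (g0 : {in I, forall x, g x = 0}).

Definition qlift of {in I, forall x, g x = 0} := fun x : aquot I => g (repr x) : S.
Local Notation ql := (qlift g0).

Lemma qlift_api x : ql (api I x) = g x.
Proof.
by apply/eqP; rewrite -subr_eq0 -raddfB; apply/eqP/g0/ideal_repr.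
Qed.

Let aqind (P : aquot I -> Prop) : (forall x, P (api I x)) -> forall x, P x.
Proof. by move=> h x; rewrite -(api_repr x). Qed.

Fact qlift_zmod : zmod_morphism ql.
Proof.
elim/aqind=> x; elim/aqind=> y.
by rewrite -(raddfB (api I)) !qlift_api raddfB.
Qed.

HB.instance Definition _ :=
  GRing.isZmodMorphism.Build (aquot I) S ql qlift_zmod.

Fact qlift_monoid : monoid_morphism ql.
Proof.
split; first by rewrite -(rmorph1 (api I)) qlift_api rmorph1.
elim/aqind=> x; elim/aqind=> y.
by rewrite -(rmorphM (api I)) !qlift_api rmorphM.
Qed.

HB.instance Definition _ :=
  GRing.isMonoidMorphism.Build (aquot I) S ql qlift_monoid.

Fact qlift_scalable : scalable ql.
Proof.
move=> c; elim/aqind=> x; have -> : c *: api I x = api I (c *: x) by rewrite linearZ.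
by rewrite !qlift_api linearZ.
Qed.

HB.instance Definition _ :=
  GRing.isScalable.Build K (aquot I) S *:%R ql qlift_scalable.

End QuotientLift.

Lemma ideal_gen_ker (K : fieldType) (A : algType K) (S : algType K)
    (g : {lrmorphism A -> S}) (R : A -> Prop) :
  (forall x, R x -> g x = 0) -> {in ideal_gen R, forall x, g x = 0}.
Proof.
move=> h x /asboolP[s [hs ->]]; rewrite rmorph_sum big_seq big1 // => t /hs /h ht.
by rewrite !rmorphM /= ht mulr0 mul0r.
Qed.

(** * Matrices over A[z] as a super tensor product *)

Definition tmx (K : fieldType) (A : algType K) (n : nat) : Type :=
  {ffun sidx n.+1 * sidx n.+1 -> {poly A}}.

Section TwistedMatrices.
Variables (K : fieldType) (A : algType K) (n : nat).
Local Notation I := (sidx n.+1).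
Local Notation tmx := (tmx A n).

HB.instance Definition _ := GRing.Zmodule.on tmx.

Implicit Types (M : tmx) (a b c : I).

Definition tmx_one : tmx := [ffun ab => (ab.1 == ab.2)%:R].
Definition tmx_mul M1 M2 : tmx :=
  [ffun ab => \sum_c M1 (ab.1, c) * M2 (c, ab.2)].

Fact tmx_mulA : associative tmx_mul.
Proof.
move=> M1 M2 M3; apply/ffunP => -[a b]; rewrite !ffunE /=.
under eq_bigr do rewrite ffunE mulr_sumr /=.
rewrite exchange_big; apply: eq_bigr => c _.
by rewrite ffunE mulr_suml; apply: eq_bigr => d _ /=; rewrite mulrA.
Qed.

Fact tmx_mul1 : left_id tmx_one tmx_mul.
Proof.
move=> M; apply/ffunP => -[a b]; rewrite !ffunE (bigD1 a) //= ffunE eqxx mul1r.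
by rewrite big1 ?addr0 // => c; rewrite ffunE eq_sym => /negPf ->; rewrite mul0r.
Qed.

Fact tmx_mulr1 : right_id tmx_one tmx_mul.
Proof.
move=> M; apply/ffunP => -[a b]; rewrite !ffunE (bigD1 b) //= ffunE eqxx mulr1.
by rewrite big1 ?addr0 // => c; rewrite ffunE => /negPf /= ->; rewrite mulr0.
Qed.

Fact tmx_mulDl : left_distributive tmx_mul +%R.
Proof.
move=> M1 M2 M3; apply/ffunP => ab; rewrite !ffunE -big_split.
by apply: eq_bigr => c _; rewrite ffunE mulrDl.
Qed.

Fact tmx_mulDr : right_distributive tmx_mul +%R.
Proof.
move=> M1 M2 M3; apply/ffunP => ab; rewrite !ffunE -big_split.
by apply: eq_bigr => c _; rewrite ffunE mulrDr.
Qed.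

(** The size [n.+1] provides an index at which the unit matrix has the entry 1; this is where N >= 1
    is used. *)
Fact tmx_1neq0 : tmx_one != 0.
Proof.
apply/eqP => /ffunP/(_ ((ord0, false), (ord0, false))); rewrite !ffunE eqxx.
by apply/eqP/oner_neq0.
Qed.

HB.instance Definition _ := GRing.Zmodule_isNzRing.Build tmx
  tmx_mulA tmx_mul1 tmx_mulr1 tmx_mulDl tmx_mulDr tmx_1neq0.

(** The entries lie in [{poly A}], whose scalars are the elements of [A]; hence [c] acts through
    [c%:A]. *)
Definition tmx_scale (c : K) M : tmx := [ffun ab => c%:A *: M ab].

Fact tmx_scaleA (x y : K) M : tmx_scale x (tmx_scale y M) = tmx_scale (x * y) M.
Proof. by apply/ffunP => ab; rewrite !ffunE scalerA mulr_algl scalerA. Qed.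

Fact tmx_scale1 : left_id 1 tmx_scale.
Proof. by move=> M; apply/ffunP => ab; rewrite !ffunE !scale1r. Qed.

Fact tmx_scaleDr : right_distributive tmx_scale +%R.
Proof. by move=> c M1 M2; apply/ffunP => ab; rewrite !ffunE scalerDr. Qed.

Fact tmx_scaleDl M : {morph tmx_scale^~ M : x y / x + y}.
Proof. by move=> x y; apply/ffunP => ab; rewrite !ffunE !scalerDl. Qed.

HB.instance Definition _ := GRing.Zmodule_isLmodule.Build K tmx
  tmx_scaleA tmx_scale1 tmx_scaleDr tmx_scaleDl.

Fact tmx_scaleAl (c : K) M1 M2 : c *: (M1 * M2) = (c *: M1) * M2.
Proof.
apply/ffunP => ab; rewrite !ffunE scaler_sumr; apply: eq_bigr => d _.
by rewrite !ffunE scalerAl.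
Qed.

HB.instance Definition _ := GRing.Lmodule_isLalgebra.Build K tmx tmx_scaleAl.

Fact alg_scaleAr (c : K) (p q : {poly A}) : c%:A *: (p * q) = p * (c%:A *: q).
Proof.
apply/polyP => d; rewrite coefZ !coefM mulr_sumr; apply: eq_bigr => i _.
by rewrite coefZ !mulr_algl scalerAr.
Qed.

Fact tmx_scaleAr (c : K) M1 M2 : c *: (M1 * M2) = M1 * (c *: M2).
Proof.
apply/ffunP => ab; rewrite !ffunE scaler_sumr; apply: eq_bigr => d _.
by rewrite !ffunE alg_scaleAr.
Qed.

HB.instance Definition _ := GRing.Lalgebra_isAlgebra.Build K tmx tmx_scaleAr.

Lemma tmxM M1 M2 a b : (M1 * M2) (a, b) = \sum_c M1 (a, c) * M2 (c, b).
Proof. by rewrite ffunE. Qed.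
Lemma tmx1 a b : (1 : tmx) (a, b) = (a == b)%:R.
Proof. by rewrite ffunE. Qed.
Lemma tmxD M1 M2 ab : (M1 + M2) ab = M1 ab + M2 ab.
Proof. by rewrite ffunE. Qed.
Lemma tmx0 ab : (0 : tmx) ab = 0.
Proof. by rewrite ffunE. Qed.
Lemma tmxZ (c : K) M ab : (c *: M) ab = c%:A *: M ab.
Proof. by rewrite ffunE. Qed.
Lemma tmx_sum J (s : seq J) (P : pred J) (F : J -> tmx) ab :
  (\sum_(j <- s | P j) F j) ab = \sum_(j <- s | P j) F j ab.
Proof. by elim/big_rec2: _ => [|j x y _ <-]; rewrite (tmx0, tmxD). Qed.

(* [dmx p y] stands for y (x) Pi^p, where Pi is the parity operator of
   C^(N|N), and [kmx X] for 1 (x) X; for y of parity p these multiply as in the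
   super tensor product of A with gl_(N|N)[z]. *)
Definition dmx (p : bool) (y : A) : tmx :=
  [ffun ab => if ab.1 == ab.2 then ((-1) ^+ (p && bar ab.1) *: y)%:P else 0].
Definition kmx (X : glpoly K n.+1) : tmx :=
  [ffun ab => map_poly (in_alg A) (X ab)].

Lemma dmxE p y a b :
  dmx p y (a, b) = if a == b then ((-1) ^+ (p && bar a) *: y)%:P else 0.
Proof. by rewrite ffunE. Qed.
Lemma kmxE X ab : kmx X ab = map_poly (in_alg A) (X ab).
Proof. by rewrite ffunE. Qed.

Lemma dmxD p x y : dmx p (x + y) = dmx p x + dmx p y.
Proof.
apply/ffunP => -[a b]; rewrite tmxD !dmxE; case: eqP => _; last by rewrite addr0.
by rewrite scalerDr polyCD.
Qed.

Lemma dmxZ p (c : K) y : dmx p (c *: y) = c *: dmx p y.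
Proof.
apply/ffunP => -[a b]; rewrite tmxZ !dmxE; case: eqP => _; last by rewrite scaler0.
by rewrite -mul_polyC -polyCM mulr_algl !scalerA mulrC.
Qed.

Lemma dmx0 p : dmx p 0 = 0.
Proof. by rewrite -(scale0r 0) dmxZ scale0r. Qed.

Lemma dmxN p y : dmx p (- y) = - dmx p y.
Proof. by rewrite -scaleN1r dmxZ scaleN1r. Qed.

Lemma dmxB p x y : dmx p (x - y) = dmx p x - dmx p y.
Proof. by rewrite dmxD dmxN. Qed.

Lemma dmx1 : dmx false 1 = 1.
Proof.
by apply/ffunP => -[a b]; rewrite dmxE tmx1; case: eqP; rewrite ?scale1r.
Qed.

Lemma dmxM p q x y : dmx p x * dmx q y = dmx (p (+) q) (x * y).
Proof.
apply/ffunP => -[a b]; rewrite tmxM dmxE (bigD1 a) //= dmxE eqxx dmxE.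
rewrite big1 ?addr0; last first.
  by move=> c; rewrite dmxE eq_sym => /negPf ->; rewrite mul0r.
case: eqP => _; last by rewrite mulr0.
rewrite -polyCM -scalerAl -scalerAr scalerA andb_addl signr_addb.
by rewrite [(-1) ^+ _ * _]mulrC.
Qed.

Lemma dmx_bar_kmxE p y X a b :
  (dmx p y * kmx X) (a, b) = ((-1) ^+ (p && bar a) *: y)%:P * kmx X (a, b).
Proof.
rewrite tmxM (bigD1 a) //= dmxE eqxx big1 ?addr0 // => c.
by rewrite dmxE eq_sym => /negPf ->; rewrite mul0r.
Qed.

Lemma kmx_dmxE p y X a b :
  (kmx X * dmx p y) (a, b) = kmx X (a, b) * ((-1) ^+ (p && bar b) *: y)%:P.
Proof.
rewrite tmxM (bigD1 b) //= dmxE eqxx big1 ?addr0 // => c.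
by rewrite dmxE => /negPf ->; rewrite mulr0.
Qed.

Lemma kmx_coefC X ab y : kmx X ab * y%:P = y%:P * kmx X ab.
Proof.
apply/polyP => d; rewrite coefMC coefCM kmxE coef_map /=.
by rewrite mulr_algl mulr_algr.
Qed.

(** Conjugation by the parity operator multiplies the entry at (a, b) by (-1)^(bar a + bar b), which
    is constant on a homogeneous [X]. This is the sign rule of the super tensor product. *)
Lemma kmx_dmx p q y X : gl_homog q X ->
  kmx X * dmx p y = (-1) ^+ (p && q) *: (dmx p y * kmx X).
Proof.
move=> hX; apply/ffunP => -[a b]; rewrite tmxZ dmx_bar_kmxE kmx_dmxE kmx_coefC.
have [X0|/hX <-] := eqVneq (X (a, b)) 0.
  by rewrite kmxE X0 rmorph0 !mulr0 scaler0.
rewrite -mul_polyC mulrA -polyCM mulr_algl scalerA -signr_addb.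
suff -> : p && (bar a (+) bar b) (+) p && bar a = p && bar b by [].
by case: p (bar a) (bar b) => [] [] [].
Qed.

Lemma kmxD X Y : kmx (X + Y) = kmx X + kmx Y.
Proof. by apply/ffunP => ab; rewrite tmxD !kmxE ffunE rmorphD. Qed.

Lemma kmxZ (e : K) X : kmx (e *: X) = e *: kmx X.
Proof.
apply/ffunP => ab; rewrite tmxZ !kmxE ffunE; apply/polyP => d.
by rewrite coefZ !coef_map coefZ mulr_algl /= scalerA.
Qed.

Lemma kmxM X Y :
  kmx X * kmx Y = kmx [ffun ab => \sum_c X (ab.1, c) * Y (c, ab.2)].
Proof.
apply/ffunP => -[a b]; rewrite tmxM kmxE ffunE rmorph_sum.
by apply: eq_bigr => c _; rewrite !kmxE rmorphM.
Qed.

End TwistedMatrices.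

(** * Products of solutions of the RTT relation *)

Section RTT.
Variables (K : fieldType) (N : nat).
Implicit Types (i j k l p q : sidx N).

Definition rtt_sign i j k : bool :=
  (bar i && bar j) (+) (bar i && bar k) (+) (bar j && bar k).

(** The coefficient of u^(-m) v^(-n) in (u^2 - v^2) R(u, v) applied to a pair of indices, where R is
    the R-matrix of the Yangian. The pair (i, k) may consist of two row indices or of two column
    indices; [l] belongs to the other side and enters only through the signs. *)
Definition row_op (V : lmodType K) (X : sidx N -> sidx N -> int -> int -> V)
    l i k (m n : int) : V :=
  (-1) ^+ rtt_sign i k l *: (X i k (m + 2) n - X i k m (n + 2))
  - (X k i (m + 1) n + X k i m (n + 1))
  + (-1) ^+ (bar k (+) bar l) *:
      (X (neg k) (neg i) (m + 1) n - X (neg k) (neg i) m (n + 1)).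

Lemma eq_row_op (V : lmodType K) (X Y : sidx N -> sidx N -> int -> int -> V) l i k m n :
  (forall i' k' m' n', X i' k' m' n' = Y i' k' m' n') ->
  row_op X l i k m n = row_op Y l i k m n.
Proof. by move=> XY; rewrite /row_op !XY. Qed.

Variable S : algType K.
Implicit Types (t : sidx N -> sidx N -> int -> S).

(* The relation with the products in which the argument u comes first on one
   side, and those in which v comes first on the other. *)
Definition rtt t := forall i j k l m n,
  row_op (fun i' k' m' n' => t i' j m' * t k' l n') l i k m n =
  row_op (fun j' l' m' n' => t k l' n' * t i j' m') k j l m n.

Section IndexSums.
Variables (V : lmodType K) (B : nat).
Implicit Types (F G : sidx N -> sidx N -> int -> int -> V).

(* Lower bounds of the ranges are shifted to -2 because a relation of degree
   (m, n) involves the coefficients up to degree m + 2 and n + 2. *)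
Definition qsum F : V :=
  \sum_(x : (sidx N * sidx N) * ('I_B * 'I_B))
     F x.1.1 x.1.2 (Posz x.2.1 - 2) (Posz x.2.2 - 2).

Lemma eq_qsum F G : (forall p q r s, F p q r s = G p q r s) -> qsum F = qsum G.
Proof. by move=> FG; apply: eq_bigr. Qed.

Lemma qsumD F G : qsum F + qsum G = qsum (fun p q r s => F p q r s + G p q r s).
Proof. by rewrite /qsum -big_split. Qed.

Lemma qsumB F G : qsum F - qsum G = qsum (fun p q r s => F p q r s - G p q r s).
Proof. by rewrite /qsum sumrB. Qed.

Lemma qsumZ c F : c *: qsum F = qsum (fun p q r s => c *: F p q r s).
Proof. by rewrite /qsum scaler_sumr. Qed.

Lemma qsum_swap F : qsum F = qsum (fun p q => F q p).
Proof.
rewrite /qsum (reindex_inj (h := fun x : (sidx N * sidx N) * ('I_B * 'I_B) =>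
  ((x.1.2, x.1.1), x.2))) //.
by move=> [[p q] x] [[p' q'] y] [-> -> ->].
Qed.

Lemma qsum_neg F : qsum F = qsum (fun p q => F (neg q) (neg p)).
Proof.
rewrite qsum_swap /qsum (reindex_inj (h := fun x : (sidx N * sidx N) * ('I_B * 'I_B) =>
  ((neg x.1.1, neg x.1.2), x.2))) //.
move=> [[p q] x] [[p' q'] y] [/= h1 h2 h3 h4 ->].
by congr (_, _, _); rewrite -[LHS]negK -[RHS]negK /neg /= ?h1 ?h2 ?h3 ?h4.
Qed.

Lemma qsumE F : qsum F = \sum_x \sum_(r < B) \sum_(s < B)
  F x.1 x.2 (Posz r - 2) (Posz s - 2).
Proof. by under [RHS]eq_bigr do rewrite pair_bigA; rewrite pair_bigA. Qed.

Lemma sum_shift (G : nat -> V) c :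
  (forall r, (r < c)%N -> G r = 0) -> (forall r, (B <= r)%N -> G r = 0) ->
  \sum_(r < B) G r = \sum_(r < B) G (r + c)%N.
Proof.
elim: c => [|c IH] G0 GB; first by apply: eq_bigr => r _; rewrite addn0.
rewrite IH => [|r rc|//]; last by apply: G0; apply: ltnW.
case: B GB => [|b] GB; first by rewrite !big_ord0.
rewrite big_ord_recl [RHS]big_ord_recr /= (GB (b + c.+1)%N); last first.
  by rewrite addnS ltnS leq_addr.
rewrite addr0 add0n (G0 c) // add0r.
by apply: eq_bigr => r _; congr G; rewrite /= /bump; lia.
Qed.

(** The window begins at -2, so for c <= 2 the terms lost at its lower end have a negative second
    argument; for B > m + c + 2 those beyond its upper end have a negative first argument. *)
Lemma sum_shift_int (H : int -> int -> V) (m : int) (c : nat) :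
  (c <= 2)%N -> (m + c + 2 < B)%R ->
  (forall x y, x < 0 -> H x y = 0) -> (forall x y, y < 0 -> H x y = 0) ->
  \sum_(r < B) H (m + c - (Posz r - 2)) (Posz r - 2) =
  \sum_(r < B) H (m - (Posz r - 2)) (Posz r - 2 + c).
Proof.
move=> c2 mB Hx Hy.
rewrite (sum_shift (G := fun r => H (m + c - (Posz r - 2)) (Posz r - 2)) (c := c)).
- by apply: eq_bigr => r _; congr H; lia.
- by move=> r rc; apply: Hy; lia.
- by move=> r rB; apply: Hx; lia.
Qed.

Lemma qsum_shift (H : sidx N -> sidx N -> int -> int -> int -> int -> V)
    (m n : int) (c d : nat) :
  (c <= 2)%N -> (d <= 2)%N -> (m + c + 2 < B)%R -> (n + d + 2 < B)%R ->
  (forall p q x y x' y', x < 0 -> H p q x y x' y' = 0) ->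
  (forall p q x y x' y', y < 0 -> H p q x y x' y' = 0) ->
  (forall p q x y x' y', x' < 0 -> H p q x y x' y' = 0) ->
  (forall p q x y x' y', y' < 0 -> H p q x y x' y' = 0) ->
  qsum (fun p q r s => H p q (m + c - r) r (n + d - s) s) =
  qsum (fun p q r s => H p q (m - r) (r + c) (n - s) (s + d)).
Proof.
move=> c2 d2 mB nB Hx Hy Hx' Hy'; rewrite !qsumE.
apply: eq_bigr => -[p q] _ /=.
under eq_bigr => r _.
  rewrite (sum_shift_int (H := H p q (m + c - (Posz r - 2)) (Posz r - 2))) //;
    [over|exact: Hx'|exact: Hy'].
rewrite (sum_shift_int (H := fun x y => \sum_(s < B)
  H p q x y (n - (Posz s - 2)) (Posz s - 2 + d))) //.
- by move=> x y x0; rewrite big1 // => s _; apply: Hx.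
- by move=> x y y0; rewrite big1 // => s _; apply: Hy.
Qed.

End IndexSums.
End RTT.

Lemma bar_neg N (i : sidx N) : bar (neg i) = ~~ bar i.
Proof. by []. Qed.

Ltac sign_cases :=
  rewrite ?bar_neg; try congr (- _);
  congr ((-1) ^+ nat_of_bool _ *: _);
  repeat match goal with |- context [@bar ?N ?i] => case: (@bar N i) => //= end.

Section RTTProduct.
Variables (K : fieldType) (N : nat) (S : algType K).
Implicit Types (i j k l p q : sidx N).

(** The Cauchy product, summed over a range from -2 to |m| that exceeds the support; it can then be
    enlarged to a bound common to all the terms of a relation. *)
Definition conv (f g : int -> S) (m : int) : S :=
  \sum_(r < `|m|.+3) f (m - (Posz r - 2)) * g (Posz r - 2).

Lemma conv_widen (f g : int -> S) m B : (forall x, x < 0 -> f x = 0) ->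
  (`|m|.+3 <= B)%N ->
  conv f g m = \sum_(r < B) f (m - (Posz r - 2)) * g (Posz r - 2).
Proof.
move=> f0 mB; rewrite /conv (big_ord_widen _
  (fun r => f (m - (Posz r - 2)) * g (Posz r - 2)) mB) big_mkcond /=.
by apply: eq_bigr => r _; case: ltnP => // mr; rewrite f0 ?mul0r //; lia.
Qed.

Lemma conv_shift (f g : int -> S) m (c B : nat) : (forall x, x < 0 -> f x = 0) ->
  (forall x, x < 0 -> g x = 0) -> (c <= 2)%N -> (`|m| + 10 <= B)%N ->
  conv f g (m + c) = \sum_(r < B) f (m - (Posz r - 2)) * g (Posz r - 2 + c).
Proof.
move=> f0 g0 c2 mB; rewrite (@conv_widen _ _ _ B) //; last by lia.
rewrite (sum_shift_int (V := S) (H := fun x y => f x * g y)) //; first by lia.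
- by move=> x y /f0 ->; rewrite mul0r.
- by move=> x y /g0 ->; rewrite mulr0.
Qed.

Lemma qsum_mul B (X Y : sidx N -> int -> S) :
  (\sum_p \sum_(r < B) X p (Posz r - 2)) * (\sum_q \sum_(s < B) Y q (Posz s - 2))
  = qsum B (fun p q r s => X p r * Y q s).
Proof.
rewrite qsumE big_distrlr pair_bigA; apply: eq_bigr => -[p q] _ /=.
by rewrite big_distrlr.
Qed.

Lemma qsum_mulC B (X Y : sidx N -> int -> S) :
  (\sum_q \sum_(s < B) Y q (Posz s - 2)) * (\sum_p \sum_(r < B) X p (Posz r - 2))
  = qsum B (fun p q r s => Y q s * X p r).
Proof.
rewrite qsumE big_distrlr exchange_big pair_bigA; apply: eq_bigr => -[p q] _ /=.
by rewrite big_distrlr exchange_big.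
Qed.

Variables (a b : sidx N -> sidx N -> int -> S).
Hypothesis a0 : forall i j m, m < 0 -> a i j m = 0.
Hypothesis b0 : forall i j m, m < 0 -> b i j m = 0.
Hypothesis ab_comm : forall i j k l m n,
  b i j m * a k l n =
  (-1) ^+ ((bar i (+) bar j) && (bar k (+) bar l)) *: (a k l n * b i j m).

(** A product of matrices over a superalgebra: the sign comes from moving [b p j] past the matrix
    unit in position (i, p). *)
Definition rtt_mul i j m : S :=
  \sum_p (-1) ^+ ((bar i (+) bar p) && (bar p (+) bar j)) *: conv (a i p) (b p j) m.

Lemma rtt_mulE i j m B : (`|m|.+3 <= B)%N -> rtt_mul i j m =
  \sum_p \sum_(r < B) (-1) ^+ ((bar i (+) bar p) && (bar p (+) bar j)) *:
    (a i p (m - (Posz r - 2)) * b p j (Posz r - 2)).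
Proof.
by move=> mB; apply: eq_bigr => p _; rewrite (conv_widen _ (@a0 i p) mB) scaler_sumr.
Qed.

Lemma rtt_mulE_shift i j (m : int) (c B : nat) : (c <= 2)%N -> (`|m| + 10 <= B)%N ->
  rtt_mul i j (m + c) =
  \sum_p \sum_(r < B) (-1) ^+ ((bar i (+) bar p) && (bar p (+) bar j)) *:
    (a i p (m - (Posz r - 2)) * b p j (Posz r - 2 + c)).
Proof.
move=> c2 mB; apply: eq_bigr => p _.
by rewrite (conv_shift (@a0 i p) (@b0 p j) c2 mB) scaler_sumr.
Qed.

(** Moving [a k q] past [b p j] collects both factors [a] on the left. The shifts stay on [a] here,
    because its relation is applied first; in [rtt_mul_v] they sit on [b]. *)
Lemma rtt_mul_u i j k l (m n : int) (c d B : nat) :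
  (c <= 2)%N -> (d <= 2)%N -> (`|m| + 10 <= B)%N -> (`|n| + 10 <= B)%N ->
  rtt_mul i j (m + c) * rtt_mul k l (n + d) =
  qsum B (fun p q r s =>
    (-1) ^+ ((bar i (+) bar p) && (bar p (+) bar j) (+)
             (bar k (+) bar q) && (bar q (+) bar l) (+)
             (bar p (+) bar j) && (bar k (+) bar q)) *:
    (a i p (m + c - r) * a k q (n + d - s) * (b p j r * b q l s))).
Proof.
move=> c2 d2 mB nB; rewrite (@rtt_mulE i j _ B) 1?(@rtt_mulE k l _ B); try lia.
rewrite (qsum_mul B (fun p r => _ *: (a i p (m + c - r) * b p j r))
  (fun q s => _ *: (a k q (n + d - s) * b q l s))).
apply: eq_qsum => p q r s.
rewrite -scalerAl -scalerAr scalerA -signr_addb -!mulrA.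
rewrite [X in _ *: (_ * X)]mulrA ab_comm -!scalerAl -!scalerAr scalerA -signr_addb.
by rewrite !mulrA.
Qed.

Lemma rtt_mul_v i j k l (m n : int) (c d B : nat) :
  (c <= 2)%N -> (d <= 2)%N -> (`|m| + 10 <= B)%N -> (`|n| + 10 <= B)%N ->
  rtt_mul k l (n + d) * rtt_mul i j (m + c) =
  qsum B (fun p q r s =>
    (-1) ^+ ((bar i (+) bar p) && (bar p (+) bar j) (+)
             (bar k (+) bar q) && (bar q (+) bar l) (+)
             (bar q (+) bar l) && (bar i (+) bar p)) *:
    (a k q (n - s) * a i p (m - r) * (b q l (s + d) * b p j (r + c)))).
Proof.
move=> c2 d2 mB nB; rewrite (@rtt_mulE_shift i j _ _ B) 1?(@rtt_mulE_shift k l _ _ B) //.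
rewrite (qsum_mulC B (fun p r => _ *: (a i p (m - r) * b p j (r + c)))
  (fun q s => _ *: (a k q (n - s) * b q l (s + d)))).
apply: eq_qsum => p q r s.
rewrite -scalerAl -scalerAr scalerA -signr_addb -!mulrA.
rewrite [X in _ *: (_ * X)]mulrA ab_comm -!scalerAl -!scalerAr scalerA -signr_addb.
rewrite !mulrA; congr (_ ^+ nat_of_bool _ *: _).
by case: (bar i) (bar j) (bar k) (bar l) (bar p) (bar q) => [] [] [] [] [] [].
Qed.

(** Powers of u and v may be absorbed into either factor of a product of series. *)
Lemma rtt_mul_shift i k (m n : int) (c d B : nat) (e : sidx N -> sidx N -> K)
    (X : sidx N -> sidx N -> int -> int -> S) :
  (c <= 2)%N -> (d <= 2)%N -> (`|m| + 10 <= B)%N -> (`|n| + 10 <= B)%N ->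
  (forall p q x y, x < 0 -> X p q x y = 0) ->
  (forall p q x y, y < 0 -> X p q x y = 0) ->
  qsum B (fun p q r s =>
    e p q *: (a k q (n - s + d) * a i p (m - r + c) * X p q r s)) =
  qsum B (fun p q r s =>
    e p q *: (a k q (n - s) * a i p (m - r) * X p q (r + c) (s + d))).
Proof.
move=> c2 d2 mB nB X0 Y0.
rewrite -(@qsum_shift K N S B (fun p q x y x' y' =>
  e p q *: (a k q x' * a i p x * X p q y y')) m n c d) //; try lia.
- by apply: eq_qsum => p q r s; rewrite !(addrAC _ (Posz _)).
- by move=> p q x y x' y' x_lt0; rewrite (a0 i p) // mulr0 mul0r scaler0.
- by move=> p q x y x' y' y_lt0; rewrite X0 // mulr0 scaler0.
- by move=> p q x y x' y' x_lt0; rewrite (a0 k q) // !mul0r scaler0.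
- by move=> p q x y x' y' y_lt0; rewrite Y0 // mulr0 scaler0.
Qed.

Hypotheses (ha : rtt a) (hb : rtt b).

Let sgn3 i j k l p q : bool :=
  (bar k (+) bar p) && (bar p (+) bar j) (+)
  (bar i (+) bar q) && (bar q (+) bar l) (+)
  (bar p (+) bar j) && (bar i (+) bar q).

Let rtt_mul_rowE i j k l (m n : int) B :
  (`|m| + 10 <= B)%N -> (`|n| + 10 <= B)%N ->
  row_op (fun i' k' m' n' => rtt_mul i' j m' * rtt_mul k' l n') l i k m n =
  qsum B (fun p q r s => (-1) ^+ sgn3 i j k l p q *:
    (row_op (fun i' k' m' n' => a i' p m' * a k' q n') q i k (m - r) (n - s) *
     (b p j r * b q l s))).
Proof.
move=> mB nB.
have U i' k' (c d : nat) c2 d2 := @rtt_mul_u i' j k' l m n c d B c2 d2 mB nB.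
have := U i k 2 0 isT isT; have := U i k 0 2 isT isT.
have := U k i 1 0 isT isT; have := U k i 0 1 isT isT.
have := U (neg k) (neg i) 1 0 isT isT; have := U (neg k) (neg i) 0 1 isT isT.
rewrite !addr0 /row_op => -> -> -> -> -> ->.
rewrite qsumD !qsumB !qsumZ qsumB qsumD; apply: eq_qsum => p q r s.
rewrite !(addrAC m 2) !(addrAC n 2) !(addrAC m 1) !(addrAC n 1) ?addr0.
rewrite [in RHS]mulrDl [in RHS]mulrBl [in RHS]mulrDl -!scalerAl ![in RHS]mulrBl.
rewrite !(scalerDr, scalerN, scalerA, opprD, opprK, addrA) -!signr_addb.
rewrite /sgn3 /rtt_sign.
by do !congr (_ + _); sign_cases.
Qed.

Let sgn1 i j k l p q : bool := sgn3 i j k l q p.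

(** R between the two pairs of factors: acting on the columns of [a] is the same as acting on the
    rows of [b]. The terms of R that exchange the summation indices, or exchange and negate them,
    are matched by [qsum_swap] and [qsum_neg], and the powers of u and v by [rtt_mul_shift]. *)
Let rtt_mul_midE i j k l (m n : int) B :
  (`|m| + 10 <= B)%N -> (`|n| + 10 <= B)%N ->
  qsum B (fun p q r s => (-1) ^+ sgn3 i j k l p q *:
    (row_op (fun p' q' m' n' => a k q' n' * a i p' m') k p q (m - r) (n - s) *
     (b p j r * b q l s))) =
  qsum B (fun p q r s => (-1) ^+ sgn1 i j k l p q *:
    (a k q (n - s) * a i p (m - r) *
     row_op (fun p' q' r' s' => b p' j r' * b q' l s') l p q r s)).
Proof.
move=> mB nB.
pose X1 p q x y := b p j x * b q l y.
pose X2 p q x y := b q j x * b p l y.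
pose X3 p q x y := b (neg q) j x * b (neg p) l y.
pose W (e : sidx N -> sidx N -> bool) (X : sidx N -> sidx N -> int -> int -> S)
    (c d : nat) :=
  qsum B (fun p q r s => (-1) ^+ e p q *:
    (a k q (n - s) * a i p (m - r) * X p q (r + c) (s + d))).
pose e1 p q := sgn1 i j k l p q (+) rtt_sign p q l.
pose e2 p q := sgn1 i j k l p q.
pose e3 p q := sgn1 i j k l p q (+) (bar q (+) bar l).
transitivity (W e1 X1 2 0 - W e1 X1 0 2 - (W e2 X2 1 0 + W e2 X2 0 1)
              + (W e3 X3 1 0 - W e3 X3 0 1)); last first.
  rewrite /W qsumD !qsumB qsumD; apply: eq_qsum => p q r s.
  rewrite /X1 /X2 /X3 /e1 /e2 /e3 !addr0 /row_op.
  rewrite [in RHS]mulrDr [in RHS]mulrBr [in RHS]mulrDr -!scalerAr ![in RHS]mulrBr.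
  rewrite !(scalerDr, scalerN, scalerA, opprD, opprK, addrA) -!signr_addb.
  by do !congr (_ + _).
have WE e X c d : (c <= 2)%N -> (d <= 2)%N ->
    (forall p q x y, x < 0 -> X p q x y = 0) ->
    (forall p q x y, y < 0 -> X p q x y = 0) ->
    W e X c d = qsum B (fun p q r s => (-1) ^+ e p q *:
      (a k q (n - s + d) * a i p (m - r + c) * X p q r s)).
  by move=> c2 d2 X0 Y0; rewrite /W -(@rtt_mul_shift i k m n c d B (fun p q => (-1) ^+ e p q)).
rewrite !WE //; try (by move=> p q x y xy0;
  rewrite /X1 /X2 /X3 (b0 _ _ xy0) ?mul0r ?mulr0).
rewrite ![qsum B (fun p q r s => (-1) ^+ e2 p q *: _)]qsum_swap.
rewrite ![qsum B (fun p q r s => (-1) ^+ e3 p q *: _)]qsum_neg.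
rewrite qsumD !qsumB qsumD; apply: eq_qsum => p q r s.
rewrite /X1 /X2 /X3 /e1 /e2 /e3 !addr0 !negK /row_op.
rewrite [in LHS]mulrDl [in LHS]mulrBl [in LHS]mulrDl -!scalerAl ![in LHS]mulrBl.
rewrite !(scalerDr, scalerN, scalerA, opprD, opprK, addrA) -!signr_addb.
rewrite /sgn1 /sgn3 /rtt_sign.
by do !congr (_ + _); sign_cases.
Qed.

(** As [a] and [b] supercommute, this is the chain R A1 A2 B1 B2 = A2 A1 R B1 B2 = A2 A1 B2 B1 R. *)
Theorem rtt_mul_rtt : rtt rtt_mul.
Proof.
move=> i j k l m n; pose B := (`|m| + `|n| + 10)%N.
have mB : (`|m| + 10 <= B)%N by lia.
have nB : (`|n| + 10 <= B)%N by lia.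
rewrite (rtt_mul_rowE i j k l mB nB).
under eq_qsum => p q r s do rewrite (ha i p k q).
rewrite rtt_mul_midE //; under eq_qsum => p q r s do rewrite (hb p j q l).
have V j' l' (c d : nat) c2 d2 := @rtt_mul_v i j' k l' m n c d B c2 d2 mB nB.
have := V j l 2 0 isT isT; have := V j l 0 2 isT isT.
have := V l j 1 0 isT isT; have := V l j 0 1 isT isT.
have := V (neg l) (neg j) 1 0 isT isT; have := V (neg l) (neg j) 0 1 isT isT.
rewrite !addr0 /row_op => -> -> -> -> -> ->.
rewrite qsumD !qsumB !qsumZ qsumB qsumD; apply: eq_qsum => p q r s.
rewrite ?addr0.
rewrite [in LHS]mulrDr [in LHS]mulrBr [in LHS]mulrDr -!scalerAr ![in LHS]mulrBr.
rewrite !(scalerDr, scalerN, scalerA, opprD, opprK, addrA) -!signr_addb.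
rewrite /sgn1 /sgn3 /rtt_sign.
by do !congr (_ + _); sign_cases.
Qed.

End RTTProduct.

(** * The vector representation with a spectral parameter *)

Section LaxMatrix.
Variables (K : fieldType) (N : nat).
Implicit Types (i j k l a b c : sidx N).

(* Coefficient of u^(-m) in the image of T_ij(u) in gl_(N|N)[z], namely in
   delta_ij - (-1)^j (E_ji / (u - z) + E_(-j,-i) / (u + z)). *)
Definition lax i j (m : int) : glpoly K N :=
  match m with
  | Posz 0 => [ffun ab => ((i == j) && (ab.1 == ab.2))%:R]
  | Posz s.+1 => - ((-1) ^+ bar j *: val (twF K j i s))
  | Negz _ => 0
  end.

Let dl (m : int) : {poly K} := (m == 0)%:R.
(* The coefficients of 1 / (u - z) are those of [geo 'X]. *)
Let geo (x : {poly K}) (m : int) : {poly K} :=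
  if m is Posz s.+1 then x ^+ s else 0.
Let dt a b : {poly K} := (a == b)%:R.

Let geo_succ x m : geo x (m + 1) = x * geo x m + dl m.
Proof.
case: m => [[|s]|[|s]]; rewrite /dl /geo ?mulr0 ?add0r ?addr0 //.
by rewrite (_ : Posz s.+1 + 1 = Posz s.+2) ?exprS ?addr0 //; lia.
Qed.

Let lax_entry i j m a b : lax i j m (a, b) = dt i j * dl m * dt a b
  - (-1) ^+ bar j * (dt j a * (dt i b * geo 'X m)
                     + dt (neg j) a * (dt (neg i) b * geo (- 'X) m)).
Proof.
have dtE x y (p : {poly K}) : (if (a, b) == (x, y) then p else 0) = dt x a * (dt y b * p).
  rewrite xpair_eqE /dt ![_ == a]eq_sym ![_ == b]eq_sym.
  by do 2!case: eqP => _; rewrite ?mul0r ?mul1r.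
case: m => [[|s]|s].
- by rewrite ffunE /dl /geo !mulr0 addr0 mulr0 subr0 mulr1 /dt -natrM mulnb.
- rewrite /lax /= !ffunE !dtE /geo /dl mulr0 mul0r sub0r.
  by congr (- _); case: (bar j); rewrite ?scaleN1r ?mulN1r ?scale1r ?mul1r.
- by rewrite /lax ffunE /geo /dl !(mulr0, mul0r, addr0) subrr.
Qed.

Let sum_dt x (F : sidx N -> {poly K}) : \sum_c dt x c * F c = F x.
Proof.
rewrite (bigD1 x) //= /dt eqxx mul1r big1 ?addr0 // => c.
by rewrite eq_sym => /negPf ->; rewrite mul0r.
Qed.

Let lax_mul_entry i j m k l n a b :
  \sum_c lax i j m (a, c) * lax k l n (c, b) =
  dt i j * dl m * lax k l n (a, b)
  - (-1) ^+ bar j * (dt j a * geo 'X m * lax k l n (i, b)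
                     + dt (neg j) a * geo (- 'X) m * lax k l n (neg i, b)).
Proof.
rewrite (eq_bigr (fun c =>
  dt a c * (dt i j * dl m * lax k l n (c, b))
  - (-1) ^+ bar j * (dt i c * (dt j a * geo 'X m * lax k l n (c, b)))
  - (-1) ^+ bar j *
      (dt (neg i) c * (dt (neg j) a * geo (- 'X) m * lax k l n (c, b)))));
  last by move=> c _; rewrite (lax_entry i); ring.
rewrite !sumrB -!mulr_sumr !sum_dt; ring.
Qed.

Let glm (X Y : glpoly K N) : glpoly K N :=
  [ffun ab => \sum_c X (ab.1, c) * Y (c, ab.2)].

Let row_op_entry (X : sidx N -> sidx N -> int -> int -> glpoly K N) l i k m n ab :
  row_op X l i k m n ab = row_op (fun i' k' m' n' => X i' k' m' n' ab) l i k m n.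
Proof. by rewrite /row_op !ffunE. Qed.

Let laxE i j m a b : {poly K} := dt i j * dl m * dt a b
  - (-1) ^+ bar j * (dt j a * (dt i b * geo 'X m)
                     + dt (neg j) a * (dt (neg i) b * geo (- 'X) m)).

Let lax2E i j m k l n a b : {poly K} :=
  dt i j * dl m * laxE k l n a b
  - (-1) ^+ bar j * (dt j a * geo 'X m * laxE k l n i b
                     + dt (neg j) a * geo (- 'X) m * laxE k l n (neg i) b).

Let glmE i j m k l n a b :
  glm (lax i j m) (lax k l n) (a, b) = lax2E i j m k l n a b.
Proof. by rewrite ffunE lax_mul_entry 3!(lax_entry k). Qed.

(** [geo_succ] expresses the shifted coefficients of 1 / (u - z) and 1 / (u + z) through the
    unshifted ones; entry by entry, a polynomial identity remains. *)
Lemma lax_rtt_gl i j k l m n :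
  row_op (fun i' k' m' n' => glm (lax i' j m') (lax k' l n')) l i k m n =
  row_op (fun j' l' m' n' => glm (lax k l' n') (lax i j' m')) k j l m n.
Proof.
apply/ffunP => -[a b].
have g2 x y : geo x (y + 2) = x * (x * geo x y + dl y) + dl (y + 1).
  by rewrite (_ : y + 2 = y + 1 + 1) ?geo_succ //; lia.
rewrite !row_op_entry.
transitivity (row_op (fun i' k' m' n' => lax2E i' j m' k' l n' a b) l i k m n).
  by apply: eq_row_op => i' k' m' n'; apply: glmE.
transitivity (row_op (fun j' l' m' n' => lax2E k l' n' i j' m' a b) k j l m n);
  last by apply/esym/eq_row_op => j' l' m' n'; apply: glmE.
rewrite /row_op /lax2E /laxE !negK.
rewrite !(g2 _ m) !(g2 _ n) !(geo_succ _ m) !(geo_succ _ n).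
move: (geo 'X m) (geo 'X n) (geo (- 'X) m) (geo (- 'X) n) => f g f' g'.
move: (dl m) (dl n) (dl (m + 1)) (dl (n + 1)) (dl (m + 2)) (dl (n + 2)).
move=> dm dn dm1 dn1 dm2 dn2 {g2}.
move: i j k l => [i bi] [j bj] [k bk] [l bl].
rewrite /neg /dt !xpair_eqE /=.
rewrite ?(eq_sym l i) ?(eq_sym l k) ?(eq_sym j i) ?(eq_sym j k).
(* The Kronecker deltas of the absolute values become ring variables, and those involving [a] or [b]
   become functions of a parity; only the sixteen choices of the parities of i, j, k, l are then
   left to split. *)
have at_ (x y : 'I_N) : exists e : {poly K}, forall h, (((x == y) && h)%:R : {poly K}) = e * h%:R.
  by exists (x == y)%:R => h; rewrite -mulnb natrM.
have ata (x : 'I_N) (y : sidx N) : exists e : bool -> {poly K}, forall h, ((x, h) == y)%:R = e h.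
  by exists (fun h => ((x, h) == y)%:R).
have [dij Eij] := at_ i j; have [dkl Ekl] := at_ k l.
have [dil Eil] := at_ i l; have [dkj Ekj] := at_ k j.
have [Aj EAj] := ata j a; have [Al EAl] := ata l a.
have [Bi EBi] := ata i b; have [Bk EBk] := ata k b.
rewrite !(Eij, Ekl, Eil, Ekj, EAj, EAl, EBi, EBk).
move: (a == b)%:R => ab; move: 'X => X.
clear.
by case: bi bj bk bl => [] [] [] []; rewrite /rtt_sign /bar /= ?expr0 ?expr1 ?scale1r ?scaleN1r; ring.
Qed.

Lemma lax_neg i j m : m < 0 -> lax i j m = 0.
Proof. by case: m. Qed.

Lemma lax_homog i j m : gl_homog (bar i (+) bar j) (lax i j m).
Proof.
move=> a b; rewrite lax_entry /dt => h; apply/eqP; apply: contraNT h => /negPf hab.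
have d0 x y (p : {poly K}) : bar x (+) bar y = bar i (+) bar j ->
    (x == a)%:R * ((y == b)%:R * p) = 0.
  move=> hxy; case: eqP => [xa|]; last by rewrite mul0r.
  case: eqP => [yb|]; last by rewrite mul0r mulr0.
  by rewrite -xa -yb hxy eqxx in hab.
rewrite !d0 ?bar_neg; try by case: (bar i) (bar j) => [] [].
rewrite addr0 mulr0 subr0; apply/eqP.
case: (i =P j) => [ij|]; last by rewrite !mul0r.
case: (a =P b) => [eab|]; last by rewrite mulr0.
by rewrite ij eab !addbb eqxx in hab.
Qed.

Lemma lax_sym i j m : (-1) ^+ `|m|%N *: lax i j m = lax (neg i) (neg j) m.
Proof.
case: m => [[|s]|s]; first by rewrite expr0 scale1r /= (inj_eq (can_inj (@negK N))).
  rewrite absz_nat /lax scalerN scalerA; congr (- _).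
  apply/ffunP => ab; rewrite !ffunE !negK.
  have fE x (p : {poly K}) : (if ab == x then p else 0) = (ab == x)%:R * p.
    by case: eqP => _; rewrite ?mul1r ?mul0r.
  rewrite !fE bar_neg signrN exprS (exprNn 'X) -!mul_polyC rmorphM rmorphN rmorphM.
  rewrite !rmorphXn !rmorphN1 /=.
  have : (-1) ^+ s * (-1) ^+ s = 1 :> {poly K} by rewrite -exprMn mulrNN mulr1 expr1n.
  by move: ((-1) ^+ s) ((-1) ^+ bar j) => e f ee; ring: ee.
by rewrite scaler0.
Qed.

End LaxMatrix.

Section Coproduct.
Variables (K : fieldType) (n : nat) (A : algType K).
Implicit Types (i j k l : sidx n.+1).

Definition laxm i j m : tmx A n := kmx A (lax K i j m).

Lemma laxm_neg i j m : m < 0 -> laxm i j m = 0.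
Proof. by move=> m0; rewrite /laxm lax_neg // -(scale0r 0) kmxZ scale0r. Qed.

Lemma laxm_rtt : rtt laxm.
Proof.
move=> i j k l x y; rewrite /laxm.
have kmx_row (X : sidx n.+1 -> sidx n.+1 -> int -> int -> glpoly K n.+1) l' i' k' x' y' :
    kmx A (row_op X l' i' k' x' y') =
    row_op (fun i k m n => kmx A (X i k m n)) l' i' k' x' y'.
  have kmxN X1 : kmx A (- X1) = - kmx A X1 by rewrite -!scaleN1r kmxZ.
  by rewrite /row_op !(kmxD, kmxZ, kmxN).
rewrite [LHS](eq_row_op _ _ _ _ _ (fun i' k' m' n' => kmxM A (lax K i' j m') (lax K k' l n'))).
rewrite [RHS](eq_row_op _ _ _ _ _ (fun j' l' m' n' => kmxM A (lax K k l' n') (lax K i j' m'))).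
by rewrite -!kmx_row (lax_rtt_gl K i j k l x y).
Qed.

Variable t : sidx n.+1 -> sidx n.+1 -> int -> A.
Hypothesis (t_rtt : rtt t) (t0 : forall i j m, m < 0 -> t i j m = 0).
Hypothesis t_sym : forall i j m, (-1) ^+ `|m|%N *: t i j m = t (neg i) (neg j) m.

Definition diag_fam i j m : tmx A n := dmx n (bar i (+) bar j) (t i j m).

(** All products in one instance of the relation have the same total parity, so the whole instance
    can be mapped by [dmx] with that parity. *)
Lemma diag_fam_rtt : rtt diag_fam.
Proof.
move=> i j k l x y; rewrite /diag_fam.
have := congr1 (dmx n (bar i (+) bar j (+) (bar k (+) bar l))) (t_rtt i j k l x y).
rewrite /row_op !(dmxD, dmxB, dmxZ, dmxN) !dmxM !bar_neg.
have e1 : bar k (+) bar j (+) (bar i (+) bar l) = bar i (+) bar j (+) (bar k (+) bar l).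
  by case: (bar i) (bar j) (bar k) (bar l) => [] [] [] [].
have e2 : ~~ bar k (+) bar j (+) (~~ bar i (+) bar l) = bar i (+) bar j (+) (bar k (+) bar l).
  by case: (bar i) (bar j) (bar k) (bar l) => [] [] [] [].
have e3 : bar k (+) bar l (+) (bar i (+) bar j) = bar i (+) bar j (+) (bar k (+) bar l).
  by rewrite addbC.
have e4 : bar k (+) ~~ bar j (+) (bar i (+) ~~ bar l) = bar i (+) bar j (+) (bar k (+) bar l).
  by case: (bar i) (bar j) (bar k) (bar l) => [] [] [] [].
by rewrite e1 e2 e3 e4 => ->; do !congr (_ + _).
Qed.

Definition coact_fam : sidx n.+1 -> sidx n.+1 -> int -> tmx A n := rtt_mul diag_fam laxm.

Lemma coact_fam_rtt : rtt coact_fam.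
Proof.
apply: rtt_mul_rtt; [|exact: laxm_neg| |exact: diag_fam_rtt|exact: laxm_rtt].
  by move=> i j m m0; rewrite /diag_fam t0 // dmx0.
move=> i j k l x y; rewrite /laxm /diag_fam (kmx_dmx _ _ (@lax_homog _ _ i j x)).
by rewrite andbC.
Qed.

Lemma laxm_sym i j m : (-1) ^+ `|m|%N *: laxm i j m = laxm (neg i) (neg j) m.
Proof. by rewrite /laxm -lax_sym kmxZ. Qed.

Lemma diag_fam_sym i j m :
  (-1) ^+ `|m|%N *: diag_fam i j m = diag_fam (neg i) (neg j) m.
Proof. by rewrite /diag_fam -t_sym dmxZ !bar_neg addbN addNb negbK. Qed.

Lemma coact_fam_sym i j m :
  (-1) ^+ `|m|%N *: coact_fam i j m = coact_fam (neg i) (neg j) m.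
Proof.
rewrite /coact_fam /rtt_mul [RHS](reindex_inj (can_inj (@negK _))) scaler_sumr.
apply: eq_bigr => p _; rewrite scalerA mulrC -scalerA !bar_neg !addbN !addNb !negbK.
congr (_ *: _); rewrite /conv scaler_sumr; apply: eq_bigr => r _.
rewrite -diag_fam_sym -laxm_sym -scalerAl -scalerAr scalerA -exprD.
(* The absolute values of the two degrees add up to [|m|] only if both are nonnegative; otherwise
   one of the factors vanishes. *)
have [r2|r2] := ltnP r 2; first by rewrite laxm_neg ?(mulr0, scaler0) //; lia.
have [m0|m0] := ltP m 0.
  by rewrite {1 2}/diag_fam t0 ?dmx0 ?(mul0r, scaler0) //; lia.
by congr ((-1) ^+ _ *: _); case: r r2 => r /= rm r2; lia.
Qed.

End Coproduct.

(** * Morphisms from the Yangian *)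

Section YangianMorphisms.
Variables (K : fieldType) (N : nat).
Implicit Types (i j k l : sidx N).

(** Translates the supercommutator form of the relation into the form of [rtt]. It serves both for
    morphisms out of the Yangian and, with [h] the projection, for the relation inside it. *)
Lemma yrel1_eval (S : algType K) (h : {lrmorphism freealg K (ygen N) -> S})
    (t : sidx N -> sidx N -> int -> S) i j k l m n :
  (forall i j m, h (fT K i j m) = t i j m) ->
  h (yrel1 K i j k l m n) =
  row_op (fun i' k' m' n' => t i' j m' * t k' l n') l i k m n -
  row_op (fun j' l' m' n' => t k l' n' * t i j' m') k j l m n.
Proof.
move=> ht.
have hZ c x : h (c *: x) = c *: h x by exact: linearZ.
have hB x y : h (x - y) = h x - h y by exact: rmorphB.
have hD x y : h (x + y) = h x + h y by exact: rmorphD.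
have hM x y : h (x * y) = h x * h y by exact: rmorphM.
have hC i1 j1 m1 k1 l1 n1 : h (fT_comm K i1 j1 m1 k1 l1 n1) =
    t i1 j1 m1 * t k1 l1 n1 - (-1) ^+ ((bar i1 (+) bar j1) && (bar k1 (+) bar l1))
      *: (t k1 l1 n1 * t i1 j1 m1).
  by rewrite /fT_comm -signr_odd oddM !oddD !oddb hB hZ !hM !ht.
have hP i1 j1 k1 l1 m1 n1 : h (fT_P K i1 j1 k1 l1 m1 n1) =
    t k1 j1 m1 * t i1 l1 n1 - t k1 j1 n1 * t i1 l1 m1.
  by rewrite /fT_P hB !hM !ht.
have hQ i1 j1 k1 l1 m1 n1 : h (fT_Q K i1 j1 k1 l1 m1 n1) =
    t (neg k1) j1 m1 * t (neg i1) l1 n1 - t k1 (neg j1) n1 * t i1 (neg l1) m1.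
  by rewrite /fT_Q hB !hM !ht.
have hE c d C1 C2 P1 P2 Q1 Q2 c1 c2 p1 p2 q1 q2 : h C1 = c1 -> h C2 = c2 ->
    h P1 = p1 -> h P2 = p2 -> h Q1 = q1 -> h Q2 = q2 ->
    h (c *: (C1 - C2) - ((P1 + P2) - d *: (Q1 - Q2))) =
    c *: (c1 - c2) - ((p1 + p2) - d *: (q1 - q2)).
  move=> <- <- <- <- <- <-.
  by rewrite hB hZ hB [h (P1 + P2 - _)]hB hD hZ [h (Q1 - Q2)]hB.
apply: etrans (hE _ _ _ _ _ _ _ _ _ _ _ _ _ _ (hC _ _ _ _ _ _) (hC _ _ _ _ _ _)
  (hP _ _ _ _ _ _) (hP _ _ _ _ _ _) (hQ _ _ _ _ _ _) (hQ _ _ _ _ _ _)) _ => {hE hC hP hQ hZ hB hD hM ht h}.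
rewrite -signr_odd -[X in _ - (_ - X *: _)]signr_odd !oddD !oddM !oddb.
rewrite /row_op.
rewrite !(scalerDr, scalerN, opprD, opprK, scalerA) -!signr_addb.
(* The sign of the column operator absorbs the sign of the supercommutator. *)
have -> : rtt_sign j l k = bar i && bar k (+) bar i && bar l (+) bar k && bar l
    (+) (bar i (+) bar j) && (bar k (+) bar l).
  by rewrite /rtt_sign; case: (bar i) (bar j) (bar k) (bar l) => [] [] [] [].
rewrite (addbC (bar l)).
rewrite -/(rtt_sign i k l) !addrA.
by rewrite [LHS](ACl (1*3*5*7*9*11*2*4*6*8*10*12)).
Qed.

Lemma yrel2_eval (S : algType K) (h : {lrmorphism freealg K (ygen N) -> S})
    (t : sidx N -> sidx N -> int -> S) i j m :
  (forall i j m, h (fT K i j m) = t i j m) ->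
  h (yrel2 K i j m) = (-1) ^+ `|m|%N *: t i j m - t (neg i) (neg j) m.
Proof.
move=> ht.
have hZ c x : h (c *: x) = c *: h x by exact: linearZ.
have hB x y : h (x - y) = h x - h y by exact: rmorphB.
by rewrite /yrel2 hB hZ !ht.
Qed.

Section FromFamily.
Variables (S : algType K) (t : sidx N -> sidx N -> int -> S).
Hypothesis t0 : forall i j m, m < 0 -> t i j m = 0.
Hypothesis t1 : forall i j, t i j 0 = (i == j)%:R.
Hypothesis t_rtt : rtt t.
Hypothesis t_sym : forall i j m, (-1) ^+ `|m|%N *: t i j m = t (neg i) (neg j) m.

Let h : {lrmorphism freealg K (ygen N) -> S} :=
  flift (fun g : ygen N => t g.1.1 g.1.2 (Posz g.2.+1)).

Let h_fT i j m : h (fT K i j m) = t i j m.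
Proof.
case: m => [[|s]|s]; rewrite /h /=.
- by rewrite t1 rmorph_nat.
- by rewrite flift_gen.
- by rewrite rmorph0 t0.
Qed.

Let h_yideal : {in @yideal K N, forall x, h x = 0}.
Proof.
apply: ideal_gen_ker => _ [i j k l m n|i j m].
  by rewrite (yrel1_eval _ _ _ _ _ _ h_fT); apply/eqP; rewrite subr_eq0 t_rtt.
by rewrite (yrel2_eval _ _ _ h_fT) t_sym subrr.
Qed.

Definition ylift : {lrmorphism yangian K N -> S} := qlift h_yideal.

Lemma ylift_T i j s : ylift (yT K i j s) = t i j (Posz s).
Proof. exact: etrans (qlift_api h_yideal _) (h_fT i j s). Qed.
End FromFamily.

Definition yTz i j (m : int) : yangian K N := api (@yideal K N) (fT K i j m).

Lemma yTz_neg i j m : m < 0 -> yTz i j m = 0.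
Proof. by case: m => // s _; rewrite /yTz raddf0. Qed.

Lemma yTz0 i j : yTz i j 0 = (i == j)%:R.
Proof. by rewrite /yTz /= rmorph_nat. Qed.

Lemma yTz_rtt : rtt yTz.
Proof.
move=> i j k l m n; apply/eqP; rewrite -subr_eq0; apply/eqP.
rewrite -(@yrel1_eval _ (api (@yideal K N))) //.
apply/eqP; rewrite -(raddf0 (api (@yideal K N))); apply/eqP/apiP.
by rewrite subr0; apply: ideal_gen_mem; apply: Yrel1.
Qed.

Lemma yTz_sym i j m : (-1) ^+ `|m|%N *: yTz i j m = yTz (neg i) (neg j) m.
Proof.
apply/eqP; rewrite -subr_eq0; apply/eqP.
rewrite -(@yrel2_eval _ (api (@yideal K N))) //.
apply/eqP; rewrite -(raddf0 (api (@yideal K N))); apply/eqP/apiP.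
by rewrite subr0; apply: ideal_gen_mem; apply: Yrel2.
Qed.

End YangianMorphisms.

(** * Symbols in the associated graded algebra *)

Section Symbols.
Variables (K : fieldType) (A : algType K) (F : filtration A).
Implicit Types (d e r : nat) (x y : A) (g h : gr F).

(** A relation instead of the function [gr_symbol], which depends on a proof of membership: degrees
    and elements can then be rewritten freely. *)
Definition sym_rel d y g : Prop := exists Fy : F d y, g = gr_symbol Fy.

Let apif : {lrmorphism fsum F -> gr F} := api (@fsum_ideal K A F).

Let symE d y (Fy : F d y) : gr_symbol Fy = apif (FSum (gr_symbol_subproof Fy)).
Proof. by []. Qed.

Lemma sym_rel_fil d y g : sym_rel d y g -> F d y.
Proof. by case. Qed.

Lemma sym_rel_symbol d y (Fy : F d y) : sym_rel d y (gr_symbol Fy).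
Proof. by exists Fy. Qed.

Lemma sym_relD d x y g h : sym_rel d x g -> sym_rel d y h -> sym_rel d (x + y) (g + h).
Proof.
move=> [Fx ->] [Fy ->]; exists (filD Fx Fy); rewrite !symE -rmorphD.
by congr (apif _); apply: val_inj; rewrite /= scalerDl.
Qed.

Lemma sym_relZ d (c : K) y g : sym_rel d y g -> sym_rel d (c *: y) (c *: g).
Proof.
move=> [Fy ->]; exists (filZ c Fy); rewrite !symE -linearZ.
by congr (apif _); apply: val_inj; rewrite /= scalerA mulr_algl.
Qed.

Lemma sym_rel_lower d y : fil_pred F d y -> sym_rel d y 0.
Proof.
move=> py; have Fy : F d y.
  by case: d py => [->|d] /=; [apply: fil0|apply: fil_le].
exists Fy; rewrite symE -(rmorph0 apif); apply/esym/apiP; rewrite subr0.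
apply/asboolP => e /=; rewrite coefZ coefXn; case: eqP => [->|_]; first by rewrite mulr1.
by rewrite mulr0; apply: fil_pred0.
Qed.

Lemma sym_rel0 d : sym_rel d 0 0.
Proof. by apply/sym_rel_lower/fil_pred0. Qed.

Lemma sym_relN d y g : sym_rel d y g -> sym_rel d (- y) (- g).
Proof. by rewrite -!scaleN1r; apply: sym_relZ. Qed.

Lemma sym_relB d x y g h : sym_rel d x g -> sym_rel d y h -> sym_rel d (x - y) (g - h).
Proof. by move=> xg /sym_relN; apply: sym_relD. Qed.

Lemma sym_rel_sum d (J : Type) (s : seq J) (P : pred J) (y : J -> A) (g : J -> gr F) :
  (forall j, P j -> sym_rel d (y j) (g j)) ->
  sym_rel d (\sum_(j <- s | P j) y j) (\sum_(j <- s | P j) g j).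
Proof.
by move=> h; elim/big_rec2: _ => [|j a b /h hj]; [apply: sym_rel0|apply: sym_relD].
Qed.

Lemma sym_relM d e x y g h :
  sym_rel d x g -> sym_rel e y h -> sym_rel (d + e) (x * y) (g * h).
Proof.
move=> [Fx ->] [Fy ->]; exists (filM Fx Fy); rewrite !symE -rmorphM.
congr (apif _); apply: val_inj => /=.
rewrite -!mul_polyC polyCM exprD -!mulrA; congr (_ * _).
by rewrite !mulrA (commr_polyXn y%:P d).
Qed.

Lemma sym_rel1 : sym_rel 0 1 (1 : gr F).
Proof.
exists (fil1 F); rewrite symE -(rmorph1 apif); congr (apif _).
by apply: val_inj; rewrite /= expr0 scale1r.
Qed.

Lemma sym_rel_uniq d y g h : sym_rel d y g -> sym_rel d y h -> g = h.
Proof.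
by move=> [Fy ->] [Fy' ->]; rewrite !symE; congr (apif _); apply: val_inj.
Qed.

Lemma sum_symbolsE n (y : nat -> A) (h : nat -> gr F) :
  (forall d, (d < n)%N -> sym_rel d (y d) (h d)) ->
  exists2 p : fsum F, \sum_(d < n) h d = apif p
    & forall d, (val p)`_d = if (d < n)%N then y d else 0.
Proof.
elim: n => [|n IH] yh.
  by exists 0; rewrite ?big_ord0 ?rmorph0 // => d; rewrite coef0.
have [p hp py] := IH (fun d dn => yh d (ltnW dn)).
have [Fy hy] := yh n (ltnSn n).
exists (p + FSum (gr_symbol_subproof Fy)).
  by rewrite big_ord_recr /= hp hy symE -rmorphD.
move=> d; rewrite /= coefD py coefZ coefXn [in RHS]ltnS [in RHS]leq_eqVlt.
case: eqP => [->|_]; first by rewrite ltnn /= add0r mulr1.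
by rewrite orFb mulr0 addr0.
Qed.

(** The sum of the graded components is direct, since membership in [fsum_ideal] is tested
    coefficient by coefficient. *)
Lemma sum_symbols_eq0 n (y : nat -> A) (h : nat -> gr F) :
  (forall d, (d < n)%N -> sym_rel d (y d) (h d)) -> \sum_(d < n) h d = 0 ->
  forall d, (d < n)%N -> fil_pred F d (y d).
Proof.
move=> yh; have [p -> py] := sum_symbolsE yh.
move/eqP; rewrite -(rmorph0 apif) => /eqP/apiP; rewrite subr0 => /asboolP hp d dn.
by have := hp d; rewrite py dn.
Qed.

Lemma gr_sum (p : fsum F) : exists h : nat -> gr F,
  (forall d, sym_rel d (val p)`_d (h d)) /\ apif p = \sum_(d < size (val p)) h d.
Proof.
exists (fun d => gr_symbol (fsum_coefP p d)).
split=> [d|]; first exact: sym_rel_symbol.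
have [q -> qp] := @sum_symbolsE (size (val p)) (fun d => (val p)`_d) _
  (fun d _ => sym_rel_symbol (fsum_coefP p d)).
congr (apif _); apply: val_inj; apply/polyP => d; rewrite qp.
by case: ltnP => // h; rewrite nth_default.
Qed.

(* An element of A[z] placed in degree d, where z has degree 1: [y] and [g] are
   its coefficient of z^r and the symbol of the latter. *)
Definition symr d r y g : Prop :=
  if (r <= d)%N then sym_rel (d - r) y g else y = 0 /\ g = 0.

Lemma symr0 d r : symr d r 0 0.
Proof. by rewrite /symr; case: ifP => // _; apply: sym_rel0. Qed.

Lemma symrD d r x y g h : symr d r x g -> symr d r y h -> symr d r (x + y) (g + h).
Proof.
rewrite /symr; case: ifP => _; first exact: sym_relD.
by move=> [-> ->] [-> ->]; rewrite !addr0.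
Qed.

Lemma symrZ d r (c : K) y g : symr d r y g -> symr d r (c *: y) (c *: g).
Proof.
rewrite /symr; case: ifP => _; first exact: sym_relZ.
by move=> [-> ->]; rewrite !scaler0.
Qed.

Lemma symr_sum d r (J : Type) (s : seq J) (P : pred J) (y : J -> A) (g : J -> gr F) :
  (forall j, P j -> symr d r (y j) (g j)) ->
  symr d r (\sum_(j <- s | P j) y j) (\sum_(j <- s | P j) g j).
Proof.
by move=> h; elim/big_rec2: _ => [|j a b /h hj]; [apply: symr0|apply: symrD].
Qed.

Lemma symr_sum_l d r (J : Type) (s : seq J) (P : pred J) (y : J -> A) :
  (forall j, P j -> symr d r (y j) 0) -> symr d r (\sum_(j <- s | P j) y j) 0.
Proof.
move=> h; elim/big_rec: _ => [|j a /h hj ha]; first exact: symr0.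
by rewrite -[0 in X in symr _ _ _ X]addr0; apply: symrD.
Qed.

Lemma symrM d r e s x y g h :
  symr d r x g -> symr e s y h -> symr (d + e) (r + s) (x * y) (g * h).
Proof.
rewrite {1 2}/symr; case: ifP => rd; last first.
  by move=> [-> ->] _; rewrite !mul0r; apply: symr0.
case: ifP => se; last by move=> _ [-> ->]; rewrite !mulr0; apply: symr0.
move=> xg yh; rewrite /symr leq_add // (_ : (d + e - (r + s) = d - r + (e - s))%N).
  exact: sym_relM.
by lia.
Qed.

End Symbols.

(** * The coaction of the Yangian and its leading part *)

Lemma conv_nat (K : fieldType) (S : algType K) (f g : int -> S) (m : nat) :
  (forall x, x < 0 -> g x = 0) ->
  conv f g m = \sum_(c < m.+1) f (Posz (m - c)) * g (Posz c).
Proof.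
move=> g0; rewrite /conv absz_nat 2![in LHS]big_ord_recl !g0 // !mulr0 !add0r.
apply: eq_bigr => c _; rewrite /bump /= /bump /=; congr (f _ * g _); last lia.
by case: c => c /= cm; lia.
Qed.

Lemma laxm0 (K : fieldType) n (A : algType K) (i j : sidx n.+1) :
  laxm A i j 0 = (i == j)%:R.
Proof.
apply/ffunP => -[a b]; rewrite kmxE ffunE /= rmorph_nat.
by case: eqP => _; rewrite ?tmx1 ?tmx0.
Qed.

Section CoactFamily.
Variables (K : fieldType) (n : nat) (A : algType K).
Implicit Types (i j k l p : sidx n.+1).
Variable t : sidx n.+1 -> sidx n.+1 -> int -> A.
Hypothesis t1 : forall i j, t i j 0 = (i == j)%:R.

Let diag_fam0 i j : diag_fam t i j 0 = (i == j)%:R.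
Proof.
rewrite /diag_fam t1; case: eqP => [->|_]; last by rewrite dmx0.
by rewrite addbb dmx1.
Qed.

Let coact_fam_nat i j (m : nat) : coact_fam t i j m =
  \sum_p \sum_(c < m.+1) (-1) ^+ ((bar i (+) bar p) && (bar p (+) bar j)) *:
    (diag_fam t i p (Posz (m - c)) * laxm A p j (Posz c)).
Proof.
rewrite /coact_fam /rtt_mul; apply: eq_bigr => p _.
by rewrite conv_nat ?scaler_sumr // => x; apply: laxm_neg.
Qed.

Lemma coact_fam0 i j : coact_fam t i j 0 = (i == j)%:R.
Proof.
rewrite (coact_fam_nat i j 0) (bigD1 i) //= [X in _ + X]big1 ?addr0.
  by rewrite big_ord1 diag_fam0 laxm0 eqxx mul1r addbb scale1r.
move=> p; rewrite eq_sym => /negPf pi.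
by rewrite big_ord1 diag_fam0 pi mul0r scaler0.
Qed.

Hypothesis t0 : forall i j m, m < 0 -> t i j m = 0.

Lemma coact_fam_neg i j m : m < 0 -> coact_fam t i j m = 0.
Proof.
move=> m0; rewrite /coact_fam /rtt_mul big1 // => p _.
rewrite /conv big1 ?scaler0 // => r _.
have [r2|r2] := ltnP r 2; first by rewrite laxm_neg ?mulr0 //; lia.
by rewrite /diag_fam t0 ?dmx0 ?mul0r //; lia.
Qed.

(** The two extreme terms of the convolution, where one factor is the identity matrix, are split
    off: they form the leading part. *)
Lemma coact_famS i j s : coact_fam t i j s.+1 =
  diag_fam t i j s.+1 + laxm A i j s.+1 +
  \sum_p \sum_(c < s) (-1) ^+ ((bar i (+) bar p) && (bar p (+) bar j)) *:
    (diag_fam t i p (Posz (s - c)) * laxm A p j (Posz c.+1)).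
Proof.
rewrite coact_fam_nat.
under eq_bigr => p _ do rewrite big_ord_recl big_ord_recr /=.
rewrite !big_split /= addrA [LHS]addrAC; congr (_ + _ + _).
- rewrite (bigD1 j) //= big1 ?addr0 => [|p /negPf pj].
    by rewrite laxm0 eqxx mulr1 addbb andbF scale1r subn0.
  by rewrite laxm0 pj mulr0 scaler0.
- rewrite (bigD1 i) //= big1 ?addr0 => [|p].
    by rewrite /bump /= subnn diag_fam0 eqxx mul1r addbb scale1r.
  by rewrite eq_sym /bump /= subnn diag_fam0 => /negPf ->; rewrite mul0r scaler0.
Qed.

End CoactFamily.

Lemma dmx_kmx_coef (K : fieldType) n (A : algType K) (e : K) p (y : A)
    (X : glpoly K n.+1) a b r :
  ((e *: (dmx n p y * kmx A X)) (a, b))`_r =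
  e *: ((X (a, b))`_r *: ((-1) ^+ (p && bar a) *: y)).
Proof.
by rewrite tmxZ coefZ mulr_algl dmx_bar_kmxE coefCM kmxE coef_map /= mulr_algr.
Qed.

Lemma yword_cons (K : fieldType) (N : nat) (g : ygen N) w :
  yword K (g :: w) = yT K g.1.1 g.1.2 g.2.+1 * yword K w.
Proof. by rewrite /yword big_cons. Qed.

Section YangianCoaction.
Variables (K : fieldType) (n : nat).
Local Notation N := n.+1.
Local Notation Y := (yangian K N).
Local Notation F := (yfiltration K N).
Implicit Types (i j k l p a b c : sidx N) (g : ygen N).

(* The coaction T_ij(u) |-> sum_k T_ik(u) (x) L_kj(u), where L is the image of T
   in gl_(N|N)[z]. *)
Definition ycoact : {lrmorphism Y -> tmx Y n} :=
  ylift (coact_fam_neg (@yTz_neg K N)) (coact_fam0 (@yTz0 K N))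
    (coact_fam_rtt (@yTz_rtt K N) (@yTz_neg K N))
    (coact_fam_sym (@yTz_neg K N) (@yTz_sym K N)).

Lemma ycoactT i j s : ycoact (yT K i j s) = coact_fam (@yTz K N) i j (Posz s).
Proof. exact: ylift_T. Qed.

(* The leading part of the coaction, with coefficients in gr Y. *)
Definition gr_letter g : tmx (gr_yangian K N) n :=
  dmx n (bar g.1.1 (+) bar g.1.2) (yG K g.1.1 g.1.2 g.2) +
  kmx _ (lax K g.1.1 g.1.2 (Posz g.2.+1)).

Lemma lax_coef i j s a b r : r != s -> (lax K i j (Posz s.+1) (a, b))`_r = 0.
Proof.
move=> rs; have X0 : ('X^s : {poly K})`_r = 0 by rewrite coefXn (negPf rs).
have NX0 : ((- 'X) ^+ s : {poly K})`_r = 0.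
  by rewrite exprNn -signr_odd; case: (odd s); rewrite ?mulN1r ?mul1r ?coefN X0 ?oppr0.
rewrite /lax !ffunE coefN coefZ coefD.
by do 2!case: ifP => _; rewrite ?coef0 ?X0 ?NX0 ?addr0 mulr0 oppr0.
Qed.

Lemma symr_dmx (p : bool) s (y : Y) (h : gr F) a b r : @sym_rel K Y F s y h ->
  @symr K Y F s r (dmx n p y (a, b))`_r (dmx n p h (a, b))`_r.
Proof.
move=> yg; rewrite !dmxE; case: eqP => _; last by rewrite !coef0; apply: symr0.
rewrite !coefC; case: eqP => [->|_]; last exact: symr0.
by rewrite /symr leq0n subn0; apply: sym_relZ.
Qed.

Lemma symr_kmx (X : glpoly K N) s a b r :
  (forall r, r != s -> (X (a, b))`_r = 0) ->
  @symr K Y F s r (kmx Y X (a, b))`_r (kmx (gr_yangian K N) X (a, b))`_r.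
Proof.
move=> hX; rewrite !kmxE !coef_map /=.
have [->|/hX ->] := eqVneq r s; last by rewrite !scale0r; apply: symr0.
by rewrite /symr leqnn subnn; apply/sym_relZ/sym_rel1.
Qed.

Let symr_coact i j s a b r : @symr K Y F s r
  (coact_fam (@yTz K N) i j (Posz s.+1) (a, b))`_r (gr_letter (i, j, s) (a, b))`_r.
Proof.
rewrite (coact_famS (@yTz0 K N)) tmxD coefD -[X in symr _ _ _ X]addr0.
apply: symrD.
  rewrite /gr_letter !tmxD !coefD; apply: symrD.
    by apply: symr_dmx; apply: sym_rel_symbol.
  by apply: symr_kmx => r' rs; apply: lax_coef.
rewrite tmx_sum coef_sum.
apply: symr_sum_l => p _; rewrite tmx_sum coef_sum; apply: symr_sum_l => c _.
rewrite dmx_kmx_coef.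
have [->|rc] := eqVneq r c; last first.
  by rewrite lax_coef // scale0r scaler0; apply: symr0.
rewrite -[X in symr _ _ _ X](scaler0 _ ((-1) ^+ ((bar i (+) bar p) && (bar p (+) bar j)))).
apply: symrZ.
rewrite -[X in symr _ _ _ X](scaler0 _ ((lax K p j c.+1 (a, b))`_c)); apply: symrZ.
rewrite -[X in symr _ _ _ X](scaler0 _ ((-1) ^+ ((bar i (+) bar p) && bar a))); apply: symrZ.
rewrite /symr (ltnW (ltn_ord c)); apply: sym_rel_lower.
(* T^(s-c) has filtration degree s - c - 1, so its symbol in degree s - c is 0. *)
have : (0 < s - c)%N by rewrite subn_gt0.
case: (s - c)%N => // d _; exact: yfil_T.
Qed.

Lemma symr_letter g a b r : @symr K Y F g.2 r
  (ycoact (yT K g.1.1 g.1.2 g.2.+1) (a, b))`_r (gr_letter g (a, b))`_r.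
Proof. by rewrite ycoactT; move: g => [[i j] s]; apply: symr_coact. Qed.

Definition gr_letters (w : seq (ygen N)) : tmx (gr_yangian K N) n :=
  \prod_(g <- w) gr_letter g.

Lemma symr_word w a b r : @symr K Y F (\sum_(g <- w) g.2) r
  (ycoact (yword K w) (a, b))`_r (gr_letters w (a, b))`_r.
Proof.
elim: w a b r => [|g w IH] a b r.
  rewrite /yword /gr_letters !big_nil rmorph1 !tmx1 !coefMn.
  case: (a == b); rewrite ?mulr0n; last exact: symr0.
  rewrite !coef1; case: r => [|r]; last exact: symr0.
  exact: sym_rel1.
rewrite yword_cons /gr_letters !big_cons rmorphM !tmxM !coef_sum.
apply: symr_sum => c _; rewrite !coefM; apply: symr_sum => k _.
rewrite -{1}(subnKC (leq_ord k)); apply: symrM; first exact: symr_letter.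
exact: IH.
Qed.

End YangianCoaction.

(** * Brackets of the symbols *)

Section YangianBracket.
Variables (K : fieldType) (N : nat).
Local Notation Y := (yangian K N).
Local Notation F := (yfiltration K N).
Implicit Types (i j k l : sidx N).
Local Notation T := (@yTz K N).

Lemma yTz_fil i j m : @yfil K N m.-1 (T i j (Posz m)).
Proof.
case: m => [|m]; last exact: yfil_T.
by rewrite yTz0; case: (i == j); [apply: yfil1|apply: (fil0 F)].
Qed.

Let TT_fil i j k l p q m : (0 < p)%N -> (0 < q)%N -> (p + q <= m.+2)%N ->
  @yfil K N m (T i j (Posz p) * T k l (Posz q)).
Proof.
move=> p0 q0 pq; apply: (fil_le (f := F)) (filM (f := F) (yTz_fil i j p) (yTz_fil k l q)).
by lia.
Qed.

Section FixedIndices.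
Variables i j k l : sidx N.

Let e : bool := rtt_sign i k l.
Let sg : bool := (bar i (+) bar j) && (bar k (+) bar l).
Let kl : bool := bar k (+) bar l.
Let C (m n : int) := T i j m * T k l n - (-1) ^+ sg *: (T k l n * T i j m).
Let P (m n : int) := T k j m * T i l n - T k j n * T i l m.
Let Q (m n : int) := T (neg k) j m * T (neg i) l n - T k (neg j) n * T i (neg l) m.

Let zmod_regroup (V : zmodType) (a1 a2 a3 a4 a5 a6 b1 b2 b3 b4 b5 b6 : V) :
  a1 - a2 - (a3 + a4) + (a5 - a6) = b1 - b2 - (b3 + b4) + (b5 - b6) ->
  (a1 - b1) - (a2 - b2) = (a3 - b3) + (a4 - b4) - ((a5 - b5) - (a6 - b6)).
Proof.
move/eqP; rewrite -subr_eq0 => /eqP h; apply/eqP; rewrite -subr_eq0 -[X in _ == X]h.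
rewrite !opprD !opprK !addrA; apply/eqP.
by rewrite [LHS](ACl (1*3*5*7*9*11*2*4*6*8*10*12)).
Qed.

Let lmod_regroup (V : lmodType K) (c c' d d' g : K) (a1 a2 a3 a4 a5 a6 b1 b2 b3 b4 b5 b6 : V) :
  c *: (a1 - a2) - (a3 + a4) + d *: (a5 - a6) =
  c' *: (b1 - b2) - (b3 + b4) + d' *: (b5 - b6) -> c' = c * g -> d' = d ->
  c *: ((a1 - g *: b1) - (a2 - g *: b2)) =
  (a3 - b3) + (a4 - b4) - d *: ((a5 - b5) - (a6 - b6)).
Proof.
by move=> + c'E d'E; rewrite c'E d'E !scalerBr !scalerA => /zmod_regroup <-.
Qed.

Let C_rec m n : (-1) ^+ e *: (C (m + 2) n - C m (n + 2)) =
  P (m + 1) n + P m (n + 1) - (-1) ^+ kl *: (Q (m + 1) n - Q m (n + 1)).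
Proof.
apply: (lmod_regroup (yTz_rtt K i j k l m n)).
  rewrite -signr_addb /e /sg /rtt_sign; congr ((-1) ^+ nat_of_bool _).
  by case: (bar i) (bar j) (bar k) (bar l) => [] [] [] [].
by rewrite /kl addbC.
Qed.

(** The expected leading term: with a first argument of degree 0, each product in [P] and [Q]
    contains a Kronecker delta, so the expression is linear in the generators. *)
Let E (m M : nat) : Y :=
  (-1) ^+ e *: (P 0 (Posz M) + (-1) ^+ m *: ((-1) ^+ kl *: Q 0 (Posz M))).

Let C0 n : C 0 n = 0.
Proof.
rewrite /C yTz0; case: eqP => [ij|_]; last by rewrite mul0r mulr0 scaler0 subrr.
by rewrite mul1r mulr1 /sg ij addbb scale1r subrr.
Qed.

Let signK (b : bool) (x : Y) : (-1) ^+ b *: ((-1) ^+ b *: x) = x.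
Proof. by rewrite scalerA -signr_addb addbb scale1r. Qed.

Let pred_fil d (x : Y) : (0 < d)%N -> @yfil K N d.-1 x -> fil_pred F d x.
Proof. by case: d. Qed.

Let P_fil (p q m : nat) : (0 < p)%N -> (0 < q)%N -> (p + q <= m.+2)%N ->
  @yfil K N m (P (Posz p) (Posz q)).
Proof.
by move=> p0 q0 pq; apply: (filD (f := F)); [|apply: (filN (F := F))]; apply: TT_fil => //; lia.
Qed.

Let Q_fil (p q m : nat) : (0 < p)%N -> (0 < q)%N -> (p + q <= m.+2)%N ->
  @yfil K N m (Q (Posz p) (Posz q)).
Proof.
by move=> p0 q0 pq; apply: (filD (f := F)); [|apply: (filN (F := F))]; apply: TT_fil => //; lia.
Qed.

Let Cneg (m : nat) n : C (Negz m) n = 0.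
Proof. by rewrite /C (yTz_neg K i j (m := Negz m)) // mul0r mulr0 scaler0 subrr. Qed.

Let Pneg (m : nat) n : P (Negz m) n = 0.
Proof. by rewrite /P !(yTz_neg K _ _ (m := Negz m)) // mul0r mulr0 subrr. Qed.

Let Qneg (m : nat) n : Q (Negz m) n = 0.
Proof. by rewrite /Q !(yTz_neg K _ _ (m := Negz m)) // mul0r mulr0 subrr. Qed.

Let C_succ m n : C (m + 2) n =
  (-1) ^+ e *: (P (m + 1) n + P m (n + 1) - (-1) ^+ kl *: (Q (m + 1) n - Q m (n + 1)))
  + C m (n + 2).
Proof. by rewrite -C_rec signK subrK. Qed.

(** The factor u^2 - v^2 lets [C_succ] move two degrees at a time from the first argument to the
    second, down to degree -1 or 0, where [C] vanishes. Products with both degrees positive are of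
    lower filtration degree; a degree 0 is met only in the last step, which produces [E]. *)
Let C_lead (m n : nat) :
  fil_pred F (m + n) (C (Posz m.+1) (Posz n.+1) - E m.+1 (m + n).+1).
Proof.
elim/ltn_ind: m n => -[|[|m]] IH n.
- rewrite add0n (_ : _ - _ = 0); first exact: fil_pred0.
  apply/eqP; rewrite subr_eq0; apply/eqP.
  rewrite [LHS](C_succ (-1) (Posz n.+1)) Cneg Pneg Qneg !addr0 subr0.
  by rewrite /E expr1 scaleN1r.
- rewrite add1n; apply: pred_fil => //=.
  rewrite [X in _ (X - _)](C_succ 0 (Posz n.+1)) C0 addr0 /E.
  rewrite (_ : Posz n.+1 + 1 = Posz n.+2); last lia.
  rewrite -scalerBr sqrrN expr1n scale1r.
  apply: (filZ (f := F)).
  have -> (p1 p2 q1 q2 : Y) : p1 + p2 - (-1) ^+ kl *: (q1 - q2) - (p2 + (-1) ^+ kl *: q2)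
      = p1 - (-1) ^+ kl *: q1.
    rewrite scalerBr opprB opprD !addrA.
    by rewrite [LHS](ACl ((1*4)*(2*5)*(3*6))) /= !subrr !addr0.
  apply: (filD (f := F)); first by apply: P_fil => //; lia.
  by apply/(filN (F := F))/(filZ (f := F))/Q_fil => //; lia.
- have -> : C (Posz m.+3) (Posz n.+1) = C (Posz m.+1 + 2) (Posz n.+1) by congr (C _ _); lia.
  rewrite C_succ.
  rewrite (_ : Posz n.+1 + 2 = Posz n.+3); last lia.
  rewrite (_ : Posz n.+1 + 1 = Posz n.+2); last lia.
  rewrite (_ : Posz m.+1 + 1 = Posz m.+2); last lia.
  rewrite -addrA; apply: fil_predD.
    rewrite !addSn; apply: pred_fil => //; apply: (filZ (f := F)).
    apply: (filD (f := F)); last apply/(filN (F := F))/(filZ (f := F)).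
      by apply: (filD (f := F)); apply: P_fil => //; lia.
    by apply: (filD (f := F)); [|apply: (filN (F := F))]; apply: Q_fil => //; lia.
  have := IH m _ n.+2; rewrite (_ : (m + n.+2)%N = (m.+2 + n)%N); last lia.
  rewrite /E (_ : (-1) ^+ m.+3 = (-1) ^+ m.+1 :> K); first by apply; lia.
  by rewrite !(exprS _ m.+2) (exprS _ m.+1) mulrA mulrNN mulr1 mul1r.
Qed.

Lemma yG_comm s r :
  yG K i j s * yG K k l r - (-1) ^+ sg *: (yG K k l r * yG K i j s) =
  (-1) ^+ e *: ((k == j)%:R *: yG K i l (s + r) - (i == l)%:R *: yG K k j (s + r)
    + (-1) ^+ s.+1 *: ((-1) ^+ kl *: ((neg k == j)%:R *: yG K (neg i) l (s + r)
                                   - (i == neg l)%:R *: yG K k (neg j) (s + r)))).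
Proof.
have yGs i' j' s' : @sym_rel K Y F s' (T i' j' (Posz s'.+1)) (yG K i' j' s').
  exact: sym_rel_symbol.
have b_alg (b : bool) (x : Y) : b%:R * x = (b%:R : K) *: x.
  by rewrite mulr_natl scaler_nat.
have b_algr (b : bool) (x : Y) : x * b%:R = (b%:R : K) *: x.
  by rewrite mulr_natr scaler_nat.
apply/eqP; rewrite -subr_eq0; apply/eqP.
apply: (@sym_rel_uniq K Y F (s + r)); last exact: (sym_rel_lower (C_lead s r)).
rewrite /C /E /P /Q !yTz0 !b_alg !b_algr.
apply: sym_relB.
  apply: sym_relB; first exact: sym_relM.
  by apply: sym_relZ; rewrite addnC; apply: sym_relM.
apply: sym_relZ; apply: sym_relD; first by apply: sym_relB; apply: sym_relZ.
by do 2!apply: sym_relZ; apply: sym_relB; apply: sym_relZ.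
Qed.

End FixedIndices.
End YangianBracket.

(** * The twisted current algebra and its enveloping algebra *)

Section PolyLinear.
Variables (K : fieldType) (V : lmodType K) (f : nat -> V).

Definition plin (p : {poly K}) : V := \sum_(r < size p) p`_r *: f r.

Lemma plin_widen m (p : {poly K}) : (size p <= m)%N -> plin p = \sum_(r < m) p`_r *: f r.
Proof.
move=> pm; rewrite /plin (big_ord_widen _ (fun r => p`_r *: f r) pm) big_mkcond /=.
by apply: eq_bigr => r _; case: ltnP => // pr; rewrite nth_default ?scale0r.
Qed.

Lemma plinD (p q : {poly K}) : plin (p + q) = plin p + plin q.
Proof.
pose m := maxn (size p) (size q).
rewrite !(@plin_widen m) ?leq_maxl ?leq_maxr ?size_polyD //.
by rewrite -big_split; apply: eq_bigr => r _; rewrite coefD scalerDl.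
Qed.

Lemma plinZ (c : K) (p : {poly K}) : plin (c *: p) = c *: plin p.
Proof.
rewrite (@plin_widen (size p) (c *: p)) ?size_scale_leq // scaler_sumr.
by apply: eq_bigr => r _; rewrite coefZ scalerA.
Qed.

Lemma plin0 : plin 0 = 0.
Proof. by rewrite /plin size_poly0 big_ord0. Qed.

Lemma plinXn s : plin 'X^s = f s.
Proof.
rewrite /plin size_polyXn big_ord_recr /= coefXn eqxx scale1r big1 ?add0r // => r _.
by rewrite coefXn ltn_eqF ?scale0r.
Qed.

End PolyLinear.

Local Arguments twF : simpl never.

Section CurrentBasis.
Variables (K : fieldType) (N : nat).
Local Notation G := (twcur K N).
Implicit Types (i j k l a b c : sidx N) (X Z : G).

Lemma twcur_eqP X Z : (forall a b, val X (a, b) = val Z (a, b)) -> X = Z.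
Proof. by move=> XZ; apply: val_inj; apply/ffunP => -[a b]; apply: XZ. Qed.

Lemma tw_val_neg X a b : val X (neg a, neg b) = val X (a, b) \Po (- 'X).
Proof. by have /eqP/ffunP/(_ (a, b)) := tw_valP X; rewrite !ffunE. Qed.

Lemma twF_val i j s a b : val (twF K i j s) (a, b) =
  ((a == i) && (b == j))%:R * 'X^s + ((a == neg i) && (b == neg j))%:R * (- 'X) ^+ s.
Proof.
rewrite /twF /= !ffunE !xpair_eqE.
by do 2!case: ifP => _; rewrite ?mul1r ?mul0r.
Qed.

Lemma twcurD X Z a b : val (X + Z) (a, b) = val X (a, b) + val Z (a, b).
Proof. by rewrite /= ffunE. Qed.
Lemma twcurZ (e : K) X a b : val (e *: X) (a, b) = e *: val X (a, b).
Proof. by rewrite /= ffunE. Qed.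
Lemma twcurN X a b : val (- X) (a, b) = - val X (a, b).
Proof. by rewrite /= ffunE. Qed.

Lemma twF_neg i j s : twF K (neg i) (neg j) s = (-1) ^+ s *: twF K i j s.
Proof.
apply: twcur_eqP => a b; rewrite twcurZ !twF_val !negK addrC (exprNn 'X).
rewrite -mul_polyC rmorphXn rmorphN1 mulrDr.
have : (-1) ^+ s * (-1) ^+ s = 1 :> {poly K} by rewrite -exprMn mulrNN mulr1 expr1n.
by move: ((-1) ^+ s) => e ee; ring: ee.
Qed.

Lemma twF_homog i j s : tw_homog (bar i (+) bar j) (twF K i j s).
Proof.
move=> a b; rewrite [tw_val _ _]twF_val.
case: (a =P i) => [->|_]; last case: (a =P neg i) => [->|_] /=.
- case: (b =P j) => [->|_] //; rewrite !(andbF, andFb).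
  by case: i => x []; rewrite /neg /eq_op /= ?eqxx ?andbF ?andFb !mul0r addr0 eqxx.
- case: (b =P neg j) => [->|_]; first by rewrite !bar_neg addbN addNb negbK.
  by rewrite !mul0r addr0 eqxx.
- by rewrite !mul0r addr0 eqxx.
Qed.

(* The F_ab^(s) with a > 0 form a basis, on which [twlin f] takes the values
   [f a b s]. *)
Definition twlin (V : lmodType K) (f : sidx N -> sidx N -> nat -> V) X : V :=
  \sum_(a | ~~ bar a) \sum_b plin (f a b) (val X (a, b)).

Lemma twlinD (V : lmodType K) (f : sidx N -> sidx N -> nat -> V) X Z :
  twlin f (X + Z) = twlin f X + twlin f Z.
Proof.
rewrite /twlin -big_split; apply: eq_bigr => a _; rewrite -big_split.
by apply: eq_bigr => b _; rewrite twcurD plinD.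
Qed.

Lemma twlinZ (V : lmodType K) (f : sidx N -> sidx N -> nat -> V) e X :
  twlin f (e *: X) = e *: twlin f X.
Proof.
rewrite /twlin scaler_sumr; apply: eq_bigr => a _; rewrite scaler_sumr.
by apply: eq_bigr => b _; rewrite twcurZ plinZ.
Qed.

Lemma twlinF (V : lmodType K) (f : sidx N -> sidx N -> nat -> V) i j s :
  ~~ bar i -> twlin f (twF K i j s) = f i j s.
Proof.
move=> i0; rewrite /twlin (bigD1 i) //= [X in _ + X]big1 ?addr0; last first.
  move=> a /andP[a0 /negPf ai]; rewrite big1 // => b _; rewrite twF_val ai.
  case: (a =P neg i) => [ani|_]; first by rewrite ani bar_neg (negPf i0) in a0.
  by rewrite !mul0r addr0 plin0.
have inn : (i == neg i) = false.
  by apply/eqP => /(congr1 (@bar N)); rewrite bar_neg; case: (bar i).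
rewrite (bigD1 j) //= [X in _ + X]big1 ?addr0; last first.
  by move=> b /negPf bj; rewrite twF_val bj inn andbF !mul0r addr0 plin0.
by rewrite twF_val !eqxx inn mul1r mul0r addr0 plinXn.
Qed.

Lemma twlin_sum (V W : lmodType K) (f : sidx N -> sidx N -> nat -> V) (h : V -> W) X :
  (forall x y, h (x + y) = h x + h y) -> (forall (e : K) x, h (e *: x) = e *: h x) ->
  h (twlin f X) = twlin (fun a b s => h (f a b s)) X.
Proof.
move=> hD hZ; have h0 : h 0 = 0 by rewrite -(scale0r 0) hZ scale0r.
have hS (J : finType) (P : pred J) (g : J -> V) :
    h (\sum_(j | P j) g j) = \sum_(j | P j) h (g j) by apply: big_morph.
rewrite hS; apply: eq_bigr => a _; rewrite hS; apply: eq_bigr => b _.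
by rewrite hS; apply: eq_bigr => r _; rewrite hZ.
Qed.

Lemma plin_coef0 (V : lmodType K) (f : nat -> V) (p : {poly K}) :
  (forall r, f r = 0) -> plin f p = 0.
Proof. by move=> f0; rewrite /plin big1 // => r _; rewrite f0 scaler0. Qed.

Lemma twcur_expand X : twlin (@twF K N) X = X.
Proof.
have even_eq a b : ~~ bar a -> val (twlin (@twF K N) X) (a, b) = val X (a, b).
  move=> a0; rewrite (twlin_sum (@twF K N) X (h := fun Z : G => val Z (a, b))); first last.
  - by move=> e Z; apply: twcurZ.
  - by move=> Z Z'; apply: twcurD.
  have ann i : ~~ bar i -> (a == neg i) = false.
    by move=> i0; apply/eqP => ai; rewrite ai bar_neg (negPf i0) in a0.
  rewrite /twlin (bigD1 a) //= [X in _ + X]big1 ?addr0; last first.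
    move=> i /andP[i0 /negPf ia]; rewrite big1 // => j _; apply: plin_coef0 => r.
    by rewrite twF_val eq_sym ia ann // !mul0r addr0.
  rewrite (bigD1 b) //= [X in _ + X]big1 ?addr0; last first.
    move=> j /negPf jb; apply: plin_coef0 => r.
    by rewrite twF_val eqxx eq_sym jb ann // !mul0r addr0.
  rewrite -[RHS]coefK poly_def; apply: eq_bigr => r _.
  by rewrite twF_val !eqxx ann // mul1r mul0r addr0.
(* The twisting condition recovers the rows with a < 0 from those with a > 0. *)
apply: twcur_eqP => a b; have [a1|a0] := boolP (bar a); last exact: even_eq.
by rewrite -[a]negK -[b]negK !(tw_val_neg _ (neg a)) even_eq // bar_neg a1.
Qed.

Lemma tw_bracket_homog (p q : bool) X Z a b : tw_homog p X -> tw_homog q Z ->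
  val (tw_bracket X Z) (a, b) = \sum_c val X (a, c) * val Z (c, b) -
    (-1) ^+ (p && q) * \sum_c val Z (a, c) * val X (c, b).
Proof.
move=> hX hZ; rewrite [LHS]ffunE /= mulr_sumr -sumrB.
apply: eq_bigr => c _; congr (_ - _).
have [->|/hZ h1] := eqVneq (tw_val Z (a, c)) 0; first by rewrite !(mul0r, mulr0).
have [->|/hX h2] := eqVneq (tw_val X (c, b)) 0; first by rewrite !mulr0.
by rewrite -signr_odd oddM !oddD !oddb h1 h2 andbC.
Qed.

Let twF_mul i j k l s r a b :
  \sum_c val (twF K i j s) (a, c) * val (twF K k l r) (c, b) =
  val ((j == k)%:R *: twF K i l (s + r) +
       (j == neg k)%:R *: ((-1) ^+ r *: twF K i (neg l) (s + r))) (a, b).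
Proof.
have dtE (d : sidx N) (f : sidx N -> {poly K}) : \sum_c (c == d)%:R * f c = f d.
  rewrite (bigD1 d) //= eqxx mul1r big1 ?addr0 // => c /negPf ->; exact: mul0r.
have bE (h : bool) (x : {poly K}) : (h%:R : K) *: x = h%:R * x.
  by rewrite scaler_nat mulr_natl.
pose Z c := val (twF K k l r) (c, b).
transitivity (\sum_c (c == j)%:R * ((a == i)%:R * 'X^s * Z c) +
              \sum_c (c == neg j)%:R * ((a == neg i)%:R * (- 'X) ^+ s * Z c)).
  rewrite -big_split; apply: eq_bigr => c _; rewrite /= -/(Z c) twF_val.
  by rewrite -!mulnb !natrM; ring.
rewrite !dtE /Z {Z} twcurD !twcurZ !twF_val !negK (inj_eq (can_inj (@negK N))).
rewrite (inv_eq (@negK N)) !exprD !(exprNn 'X) !bE.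
rewrite -!mul_polyC -!mulnb !natrM rmorphXn rmorphN1.
have : (-1) ^+ r * (-1) ^+ r = 1 :> {poly K} by rewrite -exprMn mulrNN mulr1 expr1n.
move: ((-1) ^+ s) ((-1) ^+ r) => e d dd. ring: dd.
Qed.

Lemma tw_bracketF i j k l s r :
  tw_bracket (twF K i j s) (twF K k l r) =
  (j == k)%:R *: twF K i l (s + r) + (j == neg k)%:R *: ((-1) ^+ r *: twF K i (neg l) (s + r))
  - (-1) ^+ ((bar i (+) bar j) && (bar k (+) bar l)) *:
    ((l == i)%:R *: twF K k j (s + r) + (l == neg i)%:R *: ((-1) ^+ s *: twF K k (neg j) (s + r))).
Proof.
apply: twcur_eqP => a b; rewrite (tw_bracket_homog _ _ (@twF_homog i j s) (@twF_homog k l r)).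
rewrite !twF_mul (addnC r) [RHS]twcurD twcurN twcurZ.
by case: (_ && _); rewrite ?mulN1r ?scaleN1r ?mul1r ?scale1r.
Qed.

End CurrentBasis.

Section EnvelopLift.
Variables (K : fieldType) (L : lmodType K) (par : bool -> L -> Prop) (br : L -> L -> L).
Variables (S : algType K) (f : L -> S).
Hypothesis fD : forall x y, f (x + y) = f x + f y.
Hypothesis fZ : forall c x, f (c *: x) = c *: f x.
Hypothesis fB : forall p q x y, par p x -> par q y ->
  f x * f y - (-1) ^+ (p && q) *: (f y * f x) = f (br x y).

Let h : {lrmorphism freealg K L -> S} := flift f.
Let h_uideal : {in @uideal K L par br, forall x, h x = 0}.
Proof.
have hZ c x : h (c *: x) = c *: h x by exact: linearZ.
have hB x y : h (x - y) = h x - h y by exact: rmorphB.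
have hD x y : h (x + y) = h x + h y by exact: rmorphD.
have hM x y : h (x * y) = h x * h y by exact: rmorphM.
have hg x : h (fgen K x) = f x by exact: flift_gen.
apply: ideal_gen_ker => _ [x y|c x|p q x y px qy].
- by rewrite hB hD !hg fD subrr.
- by rewrite hB hZ !hg fZ subrr.
- by rewrite hB hB hZ !hM !hg mulnb (fB px qy) subrr.
Qed.

Definition ulift : {lrmorphism envelop par br -> S} := qlift h_uideal.

Lemma ulift_inj x : ulift (uinj par br x) = f x.
Proof. exact: etrans (qlift_api h_uideal _) (flift_gen _ _). Qed.
End EnvelopLift.

Section EnvelopTheory.
Variables (K : fieldType) (L : lmodType K) (par : bool -> L -> Prop) (br : L -> L -> L).
Local Notation inj := (uinj par br).

Let api_eq (x y : freealg K L) : urel par br (x - y) ->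
  api (@uideal K L par br) x = api (@uideal K L par br) y.
Proof. by move=> h; apply/apiP; apply: ideal_gen_mem. Qed.

Lemma uinjD x y : inj (x + y) = inj x + inj y.
Proof. by rewrite /inj -rmorphD; apply/api_eq/UrelD. Qed.

Lemma uinjZ c x : inj (c *: x) = c *: inj x.
Proof.
have <- : api (@uideal K L par br) (c *: fgen K x) = c *: inj x by rewrite linearZ.
exact/api_eq/UrelZ.
Qed.

Lemma uinj_bracket p q x y : par p x -> par q y ->
  inj x * inj y - (-1) ^+ (p && q) *: (inj y * inj x) = inj (br x y).
Proof.
move=> px qy; rewrite -mulnb.
have <- : api (@uideal K L par br) (fgen K x * fgen K y - (-1) ^+ (p * q) *:
    (fgen K y * fgen K x)) = inj x * inj y - (-1) ^+ (p * q) *: (inj y * inj x).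
  rewrite rmorphB; congr (_ - _); first exact: rmorphM.
  by rewrite /uinj -(rmorphM (api (@uideal K L par br))); apply: linearZ.
exact/api_eq/UrelB.
Qed.

End EnvelopTheory.

(** * The morphism to the associated graded algebra *)

Section TwistedBracket.
Variables (K : fieldType) (N : nat).
Local Notation G := (twcur K N).
Implicit Types (X Z : G).

Let brE X Z a b : val (tw_bracket X Z) (a, b) =
  \sum_c (val X (a, c) * val Z (c, b) -
    (-1) ^+ ((bar a + bar c) * (bar c + bar b))%N * (val Z (a, c) * val X (c, b))).
Proof. by rewrite [LHS]ffunE. Qed.

Lemma tw_bracketDl X1 X2 Z :
  tw_bracket (X1 + X2) Z = tw_bracket X1 Z + tw_bracket X2 Z.
Proof.
apply: twcur_eqP => a b; rewrite twcurD !brE -big_split; apply: eq_bigr => c _.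
by rewrite !twcurD /=; ring.
Qed.

Lemma tw_bracketDr X Z1 Z2 :
  tw_bracket X (Z1 + Z2) = tw_bracket X Z1 + tw_bracket X Z2.
Proof.
apply: twcur_eqP => a b; rewrite twcurD !brE -big_split; apply: eq_bigr => c _.
by rewrite !twcurD /=; ring.
Qed.

Lemma tw_bracketZl (e : K) X Z : tw_bracket (e *: X) Z = e *: tw_bracket X Z.
Proof.
apply: twcur_eqP => a b; rewrite twcurZ !brE scaler_sumr; apply: eq_bigr => c _.
by rewrite !twcurZ -!mul_polyC /=; ring.
Qed.

Lemma tw_bracketZr (e : K) X Z : tw_bracket X (e *: Z) = e *: tw_bracket X Z.
Proof.
apply: twcur_eqP => a b; rewrite twcurZ !brE scaler_sumr; apply: eq_bigr => c _.
by rewrite !twcurZ -!mul_polyC /=; ring.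
Qed.

Lemma twlin_homog0 (V : lmodType K) (f : sidx N -> sidx N -> nat -> V) p X :
  tw_homog p X -> (forall a b r, bar a (+) bar b = p -> f a b r = 0) ->
  twlin f X = 0.
Proof.
move=> hX f0; rewrite /twlin big1 // => a _; rewrite big1 // => b _.
have [->|/hX ab] := eqVneq (val X (a, b)) 0; first exact: plin0.
by apply: plin_coef0 => r; apply: f0.
Qed.

End TwistedBracket.

Section GradedMorphism.
Variables (K : fieldType) (N : nat).
Local Notation gY := (gr_yangian K N).
Implicit Types (i j k l a b : sidx N) (X Z : twcur K N).

Lemma yG_neg i j s : yG K (neg i) (neg j) s = (-1) ^+ s.+1 *: yG K i j s.
Proof.
apply: (@sym_rel_uniq K _ (yfiltration K N) s (yT K (neg i) (neg j) s.+1)).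
  exact: sym_rel_symbol.
rewrite -[yT _ _ _ _]/(yTz K (neg i) (neg j) (Posz s.+1)) -yTz_sym absz_nat.
by apply: sym_relZ; apply: sym_rel_symbol.
Qed.

Definition phiF a b s : gY := - ((-1) ^+ bar a *: yG K b a s).

Lemma phiF_neg a b s : phiF (neg a) (neg b) s = (-1) ^+ s *: phiF a b s.
Proof.
rewrite /phiF yG_neg bar_neg signrN !scalerN scaleNr opprK !scalerA exprS.
by rewrite mulN1r mulrN scaleNr mulrC.
Qed.

Definition phi0 X : gY := twlin phiF X.

Lemma phi0D X Z : phi0 (X + Z) = phi0 X + phi0 Z.
Proof. exact: twlinD. Qed.
Lemma phi0Z (e : K) X : phi0 (e *: X) = e *: phi0 X.
Proof. exact: twlinZ. Qed.
Lemma phi0N X : phi0 (- X) = - phi0 X.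
Proof. by rewrite -!scaleN1r phi0Z. Qed.

(** For a < 0 this holds because [phiF] and [twF] acquire the same sign (-1)^s when both indices are
    negated. *)
Lemma phi0F a b s : phi0 (twF K a b s) = phiF a b s.
Proof.
have [a1|a0] := boolP (bar a); last exact: twlinF.
rewrite -[a in LHS]negK -[b in LHS]negK twF_neg phi0Z /phi0 twlinF ?bar_neg ?a1 //.
by rewrite phiF_neg scalerA -expr2 sqrr_sign scale1r.
Qed.

Lemma phiF_bracket i j k l s r :
  phiF i j s * phiF k l r -
    (-1) ^+ ((bar i (+) bar j) && (bar k (+) bar l)) *: (phiF k l r * phiF i j s) =
  phi0 (tw_bracket (twF K i j s) (twF K k l r)).
Proof.
rewrite tw_bracketF phi0D phi0N phi0Z !phi0D !phi0Z !phi0F.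
set sg := (-1) ^+ (_ && _).
have -> : phiF i j s * phiF k l r - sg *: (phiF k l r * phiF i j s) =
    ((-1) ^+ bar i * (-1) ^+ bar k) *:
      (yG K j i s * yG K l k r - sg *: (yG K l k r * yG K j i s)).
  rewrite /phiF !mulrNN -!scalerAl -!scalerAr !scalerA scalerBr !scalerA.
  by congr (_ *: _ - _ *: _); ring.
have -> : sg = (-1) ^+ ((bar j (+) bar i) && (bar l (+) bar k)).
  by rewrite (addbC (bar j)) (addbC (bar l)).
rewrite yG_comm.
have -> : phiF i (neg l) (s + r) = - ((-1) ^+ bar i * (-1) ^+ (s + r).+1) *: yG K l (neg i) (s + r).
  by rewrite /phiF -{2}(negK i) yG_neg scalerA scaleNr.
rewrite (inv_eq (@negK N)) /phiF.
move: (yG K j k _) (yG K l i _) (yG K (neg j) k _) (yG K l (neg i) _) => A B C D.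
rewrite !exprS exprD.
have ss : (-1) ^+ s * (-1) ^+ s = 1 :> K by rewrite -exprMn mulrNN mulr1 expr1n.
have rr : (-1) ^+ r * (-1) ^+ r = 1 :> K by rewrite -exprMn mulrNN mulr1 expr1n.
move: ((-1) ^+ s) ((-1) ^+ r) ss rr => es er ss rr.
rewrite !(scalerDr, scalerN, opprD, opprK, scalerA, addrA) -!scaleNr.
rewrite [RHS](ACl (3*1*4*2)) /=.
(* Each of the four terms carries a Kronecker delta; where it is 1 the indices are identified, and
   an equality of signs remains. *)
congr (_ *: _ + _ *: _ + _ *: _ + _ *: _);
  (case: eqP => [->|_]; last by rewrite !(mulr0, mul0r) ?oppr0);
  rewrite /rtt_sign ?bar_neg;
  repeat match goal with |- context [@bar ?M ?x] => case: (@bar M x) => /= end;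
  rewrite ?expr0 ?expr1; ring: rr.
Qed.

(** With [p] and [q] fixed the defect [def] is bilinear, hence determined by basis elements; by
    homogeneity only those of parity [p] and [q] occur in the expansions. *)
Lemma phi0_bracket p q X Z : tw_homog p X -> tw_homog q Z ->
  phi0 X * phi0 Z - (-1) ^+ (p && q) *: (phi0 Z * phi0 X) = phi0 (tw_bracket X Z).
Proof.
move=> hX hZ; apply/eqP; rewrite -subr_eq0; apply/eqP.
pose def U W := phi0 U * phi0 W - (-1) ^+ (p && q) *: (phi0 W * phi0 U)
  - phi0 (tw_bracket U W).
have defDl U1 U2 W : def (U1 + U2) W = def U1 W + def U2 W.
  rewrite /def tw_bracketDl !phi0D mulrDl mulrDr scalerDr !opprD !addrA.
  by rewrite [LHS](ACl (1*3*5*2*4*6)).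
have defDr U W1 W2 : def U (W1 + W2) = def U W1 + def U W2.
  rewrite /def tw_bracketDr !phi0D mulrDl mulrDr scalerDr !opprD !addrA.
  by rewrite [LHS](ACl (1*3*5*2*4*6)).
have defZl e U W : def (e *: U) W = e *: def U W.
  by rewrite /def tw_bracketZl !phi0Z -scalerAl -scalerAr !scalerBr !scalerA mulrC.
have defZr e U W : def U (e *: W) = e *: def U W.
  by rewrite /def tw_bracketZr !phi0Z -scalerAl -scalerAr !scalerBr !scalerA mulrC.
rewrite -/(def X Z) -[X]twcur_expand.
rewrite (twlin_sum (@twF K N) X (h := fun U => def U Z)) //.
apply: twlin_homog0 hX _ => a b r ab.
rewrite -[Z]twcur_expand (twlin_sum (@twF K N) Z (h := def (twF K a b r))) //.
apply: twlin_homog0 hZ _ => c d s cd.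
by rewrite /def -ab -cd !phi0F phiF_bracket subrr.
Qed.

Definition phi : {lrmorphism Utw K N -> gY} := ulift phi0D phi0Z phi0_bracket.

Lemma phi_inj X : phi (Utw_inj X) = phi0 X.
Proof. exact: ulift_inj. Qed.

Lemma phi_F i j s : phi (Utw_inj (twF K j i s)) = - ((-1) ^+ bar j *: yG K i j s).
Proof. by rewrite phi_inj phi0F. Qed.

End GradedMorphism.

(** * The coaction of the enveloping algebra *)

Section Parts.
Variables (K : fieldType) (N : nat).
Implicit Types (X Z : twcur K N).

Definition tw_part_fun (p : bool) X : glpoly K N :=
  [ffun ab => if bar ab.1 (+) bar ab.2 == p then val X ab else 0].

Let tw_part_funE p X a b :
  tw_part_fun p X (a, b) = if bar a (+) bar b == p then val X (a, b) else 0.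
Proof. by rewrite ffunE. Qed.

Fact tw_part_subproof p X : tw_part_fun p X \in @tw_pred K N.
Proof.
apply/eqP/ffunP => -[a b]; rewrite [LHS]ffunE [RHS]ffunE !tw_part_funE.
rewrite !bar_neg addbN addNb negbK.
by case: ifP => _; rewrite ?comp_poly0 // -tw_val_neg.
Qed.

Definition tw_part p X : twcur K N := TwCur (tw_part_subproof p X).

Lemma tw_partE p X a b :
  val (tw_part p X) (a, b) = if bar a (+) bar b == p then val X (a, b) else 0.
Proof. by rewrite [LHS]ffunE. Qed.

Lemma tw_partD p X Z : tw_part p (X + Z) = tw_part p X + tw_part p Z.
Proof.
apply: twcur_eqP => a b; rewrite twcurD !tw_partE twcurD.
by case: ifP => _; rewrite ?addr0.
Qed.

Lemma tw_partZ p (e : K) X : tw_part p (e *: X) = e *: tw_part p X.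
Proof.
apply: twcur_eqP => a b; rewrite twcurZ !tw_partE twcurZ.
by case: ifP => _; rewrite ?scaler0.
Qed.

Lemma tw_part_homog p q X : tw_homog p X -> tw_part q X = if p == q then X else 0.
Proof.
move=> hX; apply: twcur_eqP => a b; rewrite tw_partE.
have v0 : val (0 : twcur K N) (a, b) = 0 by rewrite /= ffunE.
have [X0|/hX ->] := eqVneq (val X (a, b)) 0; last by case: (p == q).
by rewrite X0 if_same; case: (p == q).
Qed.

Lemma tw_bracket_parity p q X Z :
  tw_homog p X -> tw_homog q Z -> tw_homog (p (+) q) (tw_bracket X Z).
Proof.
move=> hX hZ a b; apply: contraNeq => hab; apply/eqP.
rewrite [LHS](tw_bracket_homog a b hX hZ).
have z0 : forall (U W : twcur K N) u w, tw_homog u U -> tw_homog w W ->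
    u (+) w = p (+) q -> \sum_c val U (a, c) * val W (c, b) = 0.
  move=> U W u w hU hW uw; rewrite big1 // => c _.
  have [->|/hU h1] := eqVneq (val U (a, c)) 0; first by rewrite mul0r.
  have [->|/hW h2] := eqVneq (val W (c, b)) 0; first by rewrite mulr0.
  case/eqP: hab; rewrite -uw -h1 -h2.
  by case: (bar a) (bar b) (bar c) => [] [] [].
by rewrite (z0 X Z p q) // (z0 Z X q p) ?mulr0 ?subrr // addbC.
Qed.

Lemma Utw_injD X Z : Utw_inj (X + Z) = Utw_inj X + Utw_inj Z.
Proof. exact: uinjD. Qed.

Lemma Utw_injZ (e : K) X : Utw_inj (e *: X) = e *: Utw_inj X.
Proof. exact: uinjZ. Qed.

End Parts.

Lemma addrACA6 (V : zmodType) (a a' b b' c c' : V) :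
  a + a' + (b + b') + (c + c') = a + b + c + (a' + b' + c').
Proof. by rewrite !addrA [LHS](ACl (1*3*5*2*4*6)). Qed.

(** The mixed products cancel. This is why X -> X (x) 1 + 1 (x) X(z) respects brackets. *)
Lemma supercomm_split (K : fieldType) (S : algType K) (e : K) (x z k l : S) :
  e * e = 1 -> l * x = e *: (x * l) -> k * z = e *: (z * k) ->
  (x + k) * (z + l) - e *: ((z + l) * (x + k)) =
  (x * z - e *: (z * x)) + (k * l - e *: (l * k)).
Proof.
move=> ee lx kz; rewrite !mulrDl !mulrDr lx kz !scalerDr !scalerA ee scale1r.
rewrite !opprD !addrA [LHS](ACl ((1*5*4*8)*((2*7)*(3*6)))) /=.
by rewrite !subrr !addr0.
Qed.

Section EnvelopCoaction.
Variables (K : fieldType) (n : nat).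
Local Notation N := n.+1.
Local Notation U := (Utw K N).
Local Notation gY := (gr_yangian K N).
Implicit Types (X Z : twcur K N) (a b : sidx N) (g : ygen N).

(** The power of the parity operator in [dmx] depends on the parity of its argument; splitting [X]
    into its even and odd parts makes the map linear on all of g. *)
Definition ucoact0 X : tmx U n :=
  dmx n false (Utw_inj (tw_part false X)) + dmx n true (Utw_inj (tw_part true X))
  + kmx _ (val X).

Lemma ucoact0D X Z : ucoact0 (X + Z) = ucoact0 X + ucoact0 Z.
Proof.
have h p : dmx n p (Utw_inj (tw_part p (X + Z))) =
    dmx n p (Utw_inj (tw_part p X)) + dmx n p (Utw_inj (tw_part p Z)).
  by rewrite tw_partD Utw_injD dmxD.
rewrite /ucoact0 !h.
have -> : kmx U (val (X + Z)) = kmx U (val X) + kmx U (val Z) by exact: kmxD.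
exact: addrACA6.
Qed.

Lemma ucoact0Z (e : K) X : ucoact0 (e *: X) = e *: ucoact0 X.
Proof.
have h p : dmx n p (Utw_inj (tw_part p (e *: X))) = e *: dmx n p (Utw_inj (tw_part p X)).
  by rewrite tw_partZ Utw_injZ dmxZ.
rewrite /ucoact0 !h.
have -> : kmx U (val (e *: X)) = e *: kmx U (val X) by exact: kmxZ.
by rewrite !scalerDr.
Qed.

Lemma Utw_inj0 : Utw_inj (0 : twcur K N) = 0.
Proof. by rewrite -(scale0r 0) Utw_injZ scale0r. Qed.

Lemma ucoact0_homog p X : tw_homog p X ->
  ucoact0 X = dmx n p (Utw_inj X) + kmx _ (val X).
Proof.
move=> hX; rewrite /ucoact0 !(tw_part_homog _ hX).
by case: p {hX}; rewrite /= Utw_inj0 dmx0 ?add0r ?addr0.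
Qed.

Lemma ucoact0_bracket p q X Z : tw_homog p X -> tw_homog q Z ->
  ucoact0 X * ucoact0 Z - (-1) ^+ (p && q) *: (ucoact0 Z * ucoact0 X) =
  ucoact0 (tw_bracket X Z).
Proof.
move=> hX hZ; rewrite (ucoact0_homog (tw_bracket_parity hX hZ)).
rewrite (ucoact0_homog hX) (ucoact0_homog hZ).
have -> : Utw_inj (tw_bracket X Z) =
    Utw_inj X * Utw_inj Z - (-1) ^+ (p && q) *: (Utw_inj Z * Utw_inj X).
  by apply/esym/uinj_bracket.
have -> : kmx U (val (tw_bracket X Z)) = kmx U (val X) * kmx U (val Z)
    - (-1) ^+ (p && q) *: (kmx U (val Z) * kmx U (val X)).
  rewrite !kmxM -kmxZ -scaleN1r -kmxZ -kmxD; congr (kmx _ _); apply/ffunP => -[a b].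
  rewrite [LHS](tw_bracket_homog a b hX hZ) !ffunE /= scaleN1r; congr (_ - _).
  by case: (p && q); rewrite ?expr1 ?mulN1r ?scaleN1r ?expr0 ?mul1r ?scale1r.
rewrite dmxB dmxZ -(dmxM n p q) (addbC p) -(dmxM n q p).
apply: supercomm_split; first by rewrite -expr2 sqrr_sign.
  exact: kmx_dmx.
by rewrite (kmx_dmx _ _ hX) andbC.
Qed.

Definition ucoact : {lrmorphism U -> tmx U n} := ulift ucoact0D ucoact0Z ucoact0_bracket.

Lemma ucoact_inj X : ucoact (Utw_inj X) = ucoact0 X.
Proof. exact: ulift_inj. Qed.

End EnvelopCoaction.

Lemma lin_span_mul (K : fieldType) (A : algType K) (S1 S2 S3 : A -> Prop) x y :
  (forall u v, S1 u -> S2 v -> S3 (u * v)) ->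
  lin_span S1 x -> lin_span S2 y -> lin_span S3 (x * y).
Proof.
move=> h [s [hs ->]] [t [ht ->]]; rewrite mulr_suml.
apply: lin_span_sum => a /hs Sa; rewrite mulr_sumr.
apply: lin_span_sum => b /ht Sb.
rewrite -scalerAl -scalerAr; do 2!apply: lin_spanZ.
exact/lin_span_gen/h.
Qed.

Lemma lin_span_twlin (K : fieldType) (A : algType K) (S : A -> Prop) N
    (f : sidx N -> sidx N -> nat -> A) (X : twcur K N) :
  (forall a b r, lin_span S (f a b r)) -> lin_span S (twlin f X).
Proof.
move=> h; rewrite /twlin big_mkcond; apply: lin_span_sum => a _.
case: ifP => _; last exact: lin_span0.
apply: lin_span_sum => b _; apply: lin_span_sum => r _; exact/lin_spanZ/h.
Qed.

(** * Words in the generators of U(g) *)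

Section Words.
Variables (K : fieldType) (N : nat).
Local Notation U := (Utw K N).
Implicit Types (X Z : twcur K N) (a b : sidx N) (g : ygen N) (w : seq (ygen N)).

(** The preimage of a generator of gr' Y under [phi]. Words in U(g) and in Y thereby share the
    alphabet [ygen], and a word of U(g) can be lifted to Y letter by letter. *)
Definition uletter g : U :=
  - ((-1) ^+ bar g.1.2 *: Utw_inj (twF K g.1.2 g.1.1 g.2)).
Definition uword w : U := \prod_(g <- w) uletter g.

Lemma uword_cat v w : uword (v ++ w) = uword v * uword w.
Proof. exact: big_cat. Qed.

Definition cur_letter g : twcur K N := - ((-1) ^+ bar g.1.2 *: twF K g.1.2 g.1.1 g.2).

Lemma uletterE g : uletter g = Utw_inj (cur_letter g).
Proof. by rewrite /cur_letter -!scaleN1r !Utw_injZ !scaleN1r. Qed.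

Lemma cur_letter_homog g : tw_homog (bar g.1.1 (+) bar g.1.2) (cur_letter g).
Proof.
move=> a b hab; rewrite (addbC (bar g.1.1)).
apply: (@twF_homog K N g.1.2 g.1.1 g.2); apply: contraNneq hab => h; apply/eqP.
have v0 : val (twF K g.1.2 g.1.1 g.2) (a, b) = 0 := h.
by apply: etrans (twcurN _ _ _) _; rewrite twcurZ v0 scaler0 oppr0.
Qed.

Lemma Utw_injF a b s : Utw_inj (twF K a b s) = - ((-1) ^+ bar a *: uletter (b, a, s)).
Proof. by rewrite /uletter scalerN opprK scalerA -expr2 sqrr_sign scale1r. Qed.

Lemma phi_letter g : phi K N (uletter g) = yG K g.1.1 g.1.2 g.2.
Proof.
have phiZ (c : K) x : phi K N (c *: x) = c *: phi K N x by exact: linearZ.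
have phiN x : phi K N (- x) = - phi K N x by exact: rmorphN.
rewrite /uletter phiN phiZ phi_F scalerN opprK scalerA -expr2 sqrr_sign.
exact: scale1r.
Qed.

Lemma phi_word w : phi K N (uword w) = \prod_(g <- w) yG K g.1.1 g.1.2 g.2.
Proof. by rewrite rmorph_prod; apply: eq_bigr => g _; apply: phi_letter. Qed.

Lemma sym_rel_word w : @sym_rel K (yangian K N) (yfiltration K N)
  (\sum_(g <- w) g.2) (yword K w) (phi K N (uword w)).
Proof.
rewrite phi_word /yword; elim: w => [|g w IH].
  by rewrite !big_nil; apply: sym_rel1.
by rewrite !big_cons; apply: sym_relM => //; apply: sym_rel_symbol.
Qed.

Lemma Utw_inj_twlin X : Utw_inj X = twlin (fun a b r => Utw_inj (twF K a b r)) X.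
Proof.
rewrite -{1}[X]twcur_expand (twlin_sum (@twF K N) X (h := @Utw_inj K N)) //.
  exact: uinjD.
exact: uinjZ.
Qed.

Definition ulen m : U -> Prop := lin_span (fun x => exists2 w, (size w <= m)%N & x = uword w).

Lemma ulen_le m m' x : (m <= m')%N -> ulen m x -> ulen m' x.
Proof.
move=> mm; apply: lin_span_sub => y [w hw ->]; exists w => //.
exact: leq_trans hw mm.
Qed.

Lemma ulenM m m' x y : ulen m x -> ulen m' y -> ulen (m + m') (x * y).
Proof.
apply: lin_span_mul => _ _ [v hv ->] [w hw ->]; exists (v ++ w).
  by rewrite size_cat leq_add.
by rewrite uword_cat.
Qed.

Lemma ulen1 : ulen 0 1.
Proof. by apply: lin_span_gen; exists [::] => //; rewrite /uword big_nil. Qed.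

Lemma ulen_letter g : ulen 1 (uletter g).
Proof. by apply: lin_span_gen; exists [:: g] => //; rewrite /uword big_seq1. Qed.

Lemma ulenN m x : ulen m x -> ulen m (- x).
Proof. by rewrite -scaleN1r; apply: lin_spanZ. Qed.

Lemma ulen_inj X : ulen 1 (Utw_inj X).
Proof.
rewrite Utw_inj_twlin; apply: lin_span_twlin => a b r.
rewrite Utw_injF; apply/ulenN/lin_spanZ; exact: ulen_letter.
Qed.

Lemma Utw_span x : exists m, ulen m x.
Proof.
have -> : x = api _ (repr x) by rewrite api_repr.
have [s ->] := freealg_span (repr x); rewrite rmorph_sum.
elim: s => [|t s [m IH]]; first by exists 0%N; rewrite big_nil; apply: lin_span0.
have tE : ulen (size t.2) (api (@uideal K _ (@tw_homog K N) (@tw_bracket K N))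
    (t.1 *: fword K t.2)).
  have -> (e : K) (y : freealg K (twcur K N)) :
     api (@uideal K _ (@tw_homog K N) (@tw_bracket K N)) (e *: y) =
     e *: api (@uideal K _ (@tw_homog K N) (@tw_bracket K N)) y by exact: linearZ.
  apply: lin_spanZ; elim: t.2 => [|X w IHw].
    by rewrite /fword big_nil rmorph1; apply: ulen1.
  rewrite /fword big_cons rmorphM /=; apply: (ulenM (m := 1)); last exact: IHw.
  exact: ulen_inj.
exists (maxn (size t.2) m); rewrite big_cons; apply: lin_spanD.
  by apply: ulen_le tE; apply: leq_maxl.
by apply: ulen_le IH; apply: leq_maxr.
Qed.

End Words.

Lemma lin_span_words (K : fieldType) (A : algType K) (W : Type) (P : W -> Prop)
    (f : W -> A) x :
  lin_span (fun y => exists2 w, P w & y = f w) x ->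
  exists v : seq (K * W), x = \sum_(t <- v) t.1 *: f t.2.
Proof.
move=> [s [hs ->]]; elim: s hs => [|[c y] s IH] hs.
  by exists [::]; rewrite !big_nil.
have [|v hv] := IH; first by move=> t ts; apply: hs; rewrite inE ts orbT.
have [w _ yw] := hs (c, y) (mem_head _ _).
by exists ((c, w) :: v); rewrite !big_cons hv -yw.
Qed.

Section MapTmx.
Variables (K : fieldType) (n : nat) (A B : algType K) (f : {lrmorphism A -> B}).

Definition tmx_map (M : tmx A n) : tmx B n := [ffun ab => map_poly f (M ab)].

Lemma tmx_mapE M ab : tmx_map M ab = map_poly f (M ab).
Proof. by rewrite ffunE. Qed.

Lemma tmx_map1 : tmx_map 1 = 1.
Proof. by apply/ffunP => -[a b]; rewrite tmx_mapE !tmx1 rmorph_nat. Qed.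

Lemma tmx_mapM M1 M2 : tmx_map (M1 * M2) = tmx_map M1 * tmx_map M2.
Proof.
apply/ffunP => -[a b]; rewrite tmx_mapE !tmxM rmorph_sum; apply: eq_bigr => c _.
by rewrite rmorphM !tmx_mapE.
Qed.

Lemma tmx_mapD M1 M2 : tmx_map (M1 + M2) = tmx_map M1 + tmx_map M2.
Proof. by apply/ffunP => ab; rewrite tmxD !tmx_mapE tmxD rmorphD. Qed.

Lemma tmx_map_dmx p y : tmx_map (dmx n p y) = dmx n p (f y).
Proof.
apply/ffunP => -[a b]; rewrite tmx_mapE !dmxE; case: eqP => _; last exact: rmorph0.
by rewrite map_polyC /= linearZ.
Qed.

Lemma tmx_map_kmx X : tmx_map (kmx A X) = kmx B X.
Proof.
apply/ffunP => ab; rewrite tmx_mapE !kmxE -map_poly_comp.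
by apply: eq_map_poly => c /=; rewrite linearZ rmorph1.
Qed.

End MapTmx.

Section SymrMore.
Variables (K : fieldType) (A : algType K) (F : filtration A).

Lemma symr_uniq d r y (g h : gr F) : symr d r y g -> symr d r y h -> g = h.
Proof.
by rewrite /symr; case: ifP => _; [apply: sym_rel_uniq|move=> [_ ->] [_ ->]].
Qed.

Lemma sum_by_degree (T : Type) (V : zmodType) (s : seq T) (deg : T -> nat) (f : T -> V) D :
  all (fun t => deg t < D)%N s ->
  \sum_(t <- s) f t = \sum_(d < D) \sum_(t <- s | deg t == d) f t.
Proof.
elim: s => [|t s IH] /=; first by rewrite big_nil big1 // => d _; rewrite big_nil.
case/andP=> tD /IH; rewrite big_cons => ->.
under [RHS]eq_bigr => d _ do rewrite big_mkcond big_cons -big_mkcond /=.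
rewrite big_split /= -big_mkcond /=; congr (_ + _).
by rewrite (big_pred1 (Ordinal tD)).
Qed.

End SymrMore.

(** * Comparison of the two coactions *)

Section CoactionSymbol.
Variables (K : fieldType) (n : nat).
Local Notation N := n.+1.
Local Notation Y := (yangian K N).
Local Notation F := (yfiltration K N).
Implicit Types (a b : sidx N) (g : ygen N) (w : seq (ygen N)).

Let deg w : nat := \sum_(g <- w) g.2.

Lemma ycoact_coefZ (c : K) (y : Y) a b r :
  (ycoact K n (c *: y) (a, b))`_r = c *: (ycoact K n y (a, b))`_r.
Proof.
have -> : ycoact K n (c *: y) = c *: ycoact K n y by exact: linearZ.
by rewrite tmxZ coefZ mulr_algl.
Qed.

Lemma ycoact_coefD (x y : Y) a b r :
  (ycoact K n (x + y) (a, b))`_r = (ycoact K n x (a, b))`_r + (ycoact K n y (a, b))`_r.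
Proof. by rewrite rmorphD tmxD coefD. Qed.

Lemma ycoact_coef_sum (T : Type) (s : seq T) (P : pred T) (y : T -> Y) a b r :
  (ycoact K n (\sum_(t <- s | P t) y t) (a, b))`_r =
  \sum_(t <- s | P t) (ycoact K n (y t) (a, b))`_r.
Proof. by rewrite rmorph_sum tmx_sum coef_sum. Qed.

(** Needed so that an element of lower filtration degree contributes nothing to the symbol of its
    coaction. By linearity it is read off from [symr_word]. *)
Lemma ycoact_fil d (y : Y) a b r : @yfil K N d y ->
  if (r <= d)%N then @yfil K N (d - r) (ycoact K n y (a, b))`_r
  else (ycoact K n y (a, b))`_r = 0.
Proof.
move=> [s [hs ->]].
pose Q (u : Y) := if (r <= d)%N then @yfil K N (d - r) u else u = 0.
have Q0 : Q 0 by rewrite /Q; case: ifP => _ //; apply: (fil0 F).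
have QD u v : Q u -> Q v -> Q (u + v).
  rewrite /Q; case: ifP => _; first exact: (filD (f := F)).
  by move=> -> ->; rewrite addr0.
have QZ (c : K) u : Q u -> Q (c *: u).
  rewrite /Q; case: ifP => _; first exact: (filZ (f := F)).
  by move=> ->; rewrite scaler0.
rewrite -/(Q _).
elim: s hs => [|t s IH] hs.
  have -> : (ycoact K n (\sum_(t <- [::]) t.1 *: t.2) (a, b))`_r = 0.
    by rewrite ycoact_coef_sum big_nil.
  exact: Q0.
have -> : (ycoact K n (\sum_(t <- t :: s) t.1 *: t.2) (a, b))`_r =
    t.1 *: (ycoact K n t.2 (a, b))`_r + (ycoact K n (\sum_(t <- s) t.1 *: t.2) (a, b))`_r.
  rewrite big_cons; apply: etrans (ycoact_coefD _ _ _ _ _) _.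
  by congr (_ + _); apply: ycoact_coefZ.
apply: QD; last by apply: IH => t' t's; apply: hs; rewrite inE t's orbT.
apply: QZ; have [w wd ->] := hs t (mem_head _ _).
have := symr_word K w a b r; rewrite /symr /Q.
case: ifP => rw; last by move=> [-> _]; case: ifP => _ //; apply: (fil0 F).
move/sym_rel_fil; rewrite (leq_trans rw wd); apply: (fil_le (f := F)).
exact: leq_sub2r.
Qed.

Lemma ycoact_pred d (y : Y) a b r : fil_pred F d y ->
  @symr K Y F d r (ycoact K n y (a, b))`_r 0.
Proof.
case: d => [hy|d hy].
  have {}hy : y = 0 := hy.
  rewrite hy.
  have -> : ycoact K n 0 = 0 := rmorph0 (ycoact K n).
  by rewrite tmx0 coef0; apply: symr0.
have := ycoact_fil a b r hy; rewrite /symr.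
case: (leqP r d) => [rd|rd].
  by rewrite (leqW rd) subSn // => h; apply: sym_rel_lower.
move=> ->; case: ifP => _ //; exact: sym_rel0.
Qed.

Lemma ucoact_letter g : ucoact K n (uletter K g) =
  dmx n (bar g.1.1 (+) bar g.1.2) (uletter K g) +
  kmx _ (lax K g.1.1 g.1.2 (Posz g.2.+1)).
Proof.
by rewrite uletterE ucoact_inj (ucoact0_homog (@cur_letter_homog K N g)).
Qed.

(** Both sides are multiplicative and agree on letters; this links the coaction of U(g) to the
    leading part of that of Y. *)
Lemma tmx_map_word w : tmx_map (phi K N) (ucoact K n (uword K w)) = gr_letters K w.
Proof.
have uM x y : ucoact K n (x * y) = ucoact K n x * ucoact K n y by exact: rmorphM.
have u1 : ucoact K n 1 = 1 by exact: rmorph1.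
elim: w => [|g w IH]; first by rewrite /uword /gr_letters !big_nil u1 tmx_map1.
rewrite /uword /gr_letters !big_cons uM tmx_mapM; congr (_ * _); last exact: IH.
by rewrite ucoact_letter tmx_mapD tmx_map_dmx tmx_map_kmx phi_letter.
Qed.

(** Lift [x] to Y word by word and sort the lift by degree. Since [phi] kills [x], the component
    [y d] lies one step lower in the filtration, and so does its coaction; but the symbols of these
    coactions add up to the image of the coaction of [x]. *)
Lemma phi_coact_ker x a b r : phi K N x = 0 -> phi K N (ucoact K n x (a, b))`_r = 0.
Proof.
move=> x0; have [m xm] := Utw_span x.
have [v hv] : exists v : seq (K * seq (ygen N)), x = \sum_(t <- v) t.1 *: uword K t.2.
  exact: lin_span_words xm.
pose D := (\max_(t <- v) deg t.2).+1.
have hD : all (fun t => deg t.2 < D)%N v.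
  by apply/allP => t tv; rewrite ltnS /D (big_rem t) //= leq_max leqnn.
have phiS (T : Type) (u : seq T) P (f : T -> Utw K N) :
    phi K N (\sum_(t <- u | P t) f t) = \sum_(t <- u | P t) phi K N (f t).
  exact: rmorph_sum.
have phiZ (c : K) y : phi K N (c *: y) = c *: phi K N y by exact: linearZ.
pose y d := \sum_(t <- v | deg t.2 == d) t.1 *: yword K t.2.
pose h d := \sum_(t <- v | deg t.2 == d) t.1 *: phi K N (uword K t.2).
have yh d : (d < D)%N -> @sym_rel K Y F d (y d) (h d).
  by move=> _; apply: sym_rel_sum => t /eqP <-; apply/sym_relZ/sym_rel_word.
have h0 : \sum_(d < D) h d = 0.
  transitivity (phi K N x); last exact: x0.
  rewrite hv phiS [RHS](sum_by_degree _ hD); apply: eq_bigr => d _.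
  by apply: eq_bigr => t _; rewrite phiZ.
have py := sum_symbols_eq0 yh h0.
pose c t := t.1 *: (gr_letters K t.2 (a, b))`_r.
have -> : phi K N (ucoact K n x (a, b))`_r = \sum_(t <- v) c t.
  have -> : (ucoact K n x (a, b))`_r =
      \sum_(t <- v) t.1 *: (ucoact K n (uword K t.2) (a, b))`_r.
    have -> : ucoact K n x = \sum_(t <- v) ucoact K n (t.1 *: uword K t.2).
      by rewrite hv; apply: rmorph_sum.
    rewrite tmx_sum coef_sum; apply: eq_bigr => t _.
    have -> : ucoact K n (t.1 *: uword K t.2) = t.1 *: ucoact K n (uword K t.2).
      exact: linearZ.
    by rewrite tmxZ coefZ mulr_algl.
  rewrite phiS. apply: eq_bigr => t _; rewrite phiZ; congr (_ *: _).
  by rewrite -tmx_map_word tmx_mapE coef_map.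
rewrite (sum_by_degree _ hD) big1 // => -[d dD] _ /=.
(* Two computations of one symbol: it is 0 by the lower degree of [y d], and the required sum by its
   expansion in words. *)
apply: (@symr_uniq K Y F d r (ycoact K n (y d) (a, b))`_r); last exact/ycoact_pred/py.
rewrite /y ycoact_coef_sum; apply: symr_sum => t /eqP <-.
by rewrite ycoact_coefZ; apply/symrZ/symr_word.
Qed.

End CoactionSymbol.

(** * The Euler operator *)

Section HornerLike.
Variables (K : fieldType) (A : algType K) (f : nat -> A).
Implicit Types p q : {poly A}.

Definition hlin p : A := \sum_(r < size p) p`_r * f r.

Lemma hlin_widen m p : (size p <= m)%N -> hlin p = \sum_(r < m) p`_r * f r.
Proof.
move=> pm; rewrite /hlin (big_ord_widen _ (fun r => p`_r * f r) pm) big_mkcond /=.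
by apply: eq_bigr => r _; case: ltnP => // pr; rewrite nth_default ?mul0r.
Qed.

Lemma hlinD p q : hlin (p + q) = hlin p + hlin q.
Proof.
pose m := maxn (size p) (size q).
rewrite !(@hlin_widen m) ?leq_maxl ?leq_maxr ?size_polyD //.
by rewrite -big_split; apply: eq_bigr => r _; rewrite coefD mulrDl.
Qed.

Lemma hlinZ (c : K) p : hlin (c%:A *: p) = c *: hlin p.
Proof.
rewrite (@hlin_widen (size p)); last exact: size_scale_leq.
by rewrite /hlin scaler_sumr; apply: eq_bigr => r _; rewrite coefZ mulr_algl scalerAl.
Qed.

Lemma hlin_eq0 p : (forall r, p`_r = 0) -> hlin p = 0.
Proof. by move=> p0; rewrite /hlin big1 // => r _; rewrite p0 mul0r. Qed.

Lemma hlin_mulC p x : hlin (p * x%:P) = \sum_(r < size p) p`_r * (x * f r).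
Proof.
rewrite (@hlin_widen (size p)).
  by apply: eq_bigr => r _; rewrite coefMC mulrA.
apply: leq_trans (size_polyMleq _ _) _; have := size_polyC_leq1 x.
by case: (size (x%:P)) => [|[]] // _; rewrite ?addn0 ?addn1 // leq_pred.
Qed.

Lemma hlin_plin (y : A) (p : {poly K}) :
  hlin (y%:P * map_poly (in_alg A) p) = y * plin f p.
Proof.
rewrite (@hlin_widen (size p)) /plin ?mulr_sumr.
  apply: eq_bigr => r _; rewrite coefCM coef_map /= mulr_algr.
  by rewrite -scalerAl -scalerAr.
apply/leq_sizeP => r pr; rewrite coefCM coef_map /= nth_default ?scale0r ?mulr0 //.
Qed.

End HornerLike.

Section Euler.
Variables (K : fieldType) (n : nat) (A : algType K).
Local Notation N := n.+1.
Variable coact : {lrmorphism A -> tmx A n}.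
Variables (T : Type) (u : T -> A) (par : T -> bool) (X : T -> twcur K N).
Variable F : sidx N -> sidx N -> nat -> A.
Implicit Types (a b c : sidx N) (g : T) (w : seq T) (x y : A).

Let word w : A := \prod_(g <- w) u g.
Let len m : A -> Prop := lin_span (fun x => exists2 w, (size w <= m)%N & x = word w).

Hypothesis coact_u : forall g, coact (u g) = dmx n (par g) (u g) + kmx A (val (X g)).
Hypothesis uX : forall g, u g = twlin F (X g).
Hypothesis len_F : forall a b r, len 1 (F a b r).
(** For a > 0 the element [F a b r] of g has parity [bar b], so this is a supercommutator up to
    sign; it has length 1 instead of 2. *)
Hypothesis comm_uF : forall g a b r, ~~ bar a ->
  len 1 ((-1) ^+ (par g && bar b) *: (u g * F a b r) - F a b r * u g).

(** Length at most m - 1, with the convention that only 0 has negative length. *)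
Let len_pred m x : Prop := if m is m'.+1 then len m' x else x = 0.

Let lenD m x y : len m x -> len m y -> len m (x + y).
Proof. exact: lin_spanD. Qed.
Let lenZ m (c : K) x : len m x -> len m (c *: x).
Proof. exact: lin_spanZ. Qed.
Let len0 m : len m 0. Proof. exact: lin_span0. Qed.
Let lenN m x : len m x -> len m (- x).
Proof. by rewrite -scaleN1r; apply: lenZ. Qed.
Let len_sum m (J : finType) (P : pred J) (f : J -> A) :
  (forall j, P j -> len m (f j)) -> len m (\sum_(j | P j) f j).
Proof.
by move=> h; elim/big_rec: _ => [|j x /h hj]; [apply: len0|apply: lenD].
Qed.
Let len_le m m' x : (m <= m')%N -> len m x -> len m' x.
Proof.
move=> mm; apply: lin_span_sub => y [w hw ->]; exists w => //.
exact: leq_trans hw mm.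
Qed.
Let lenM m m' x y : len m x -> len m' y -> len (m + m') (x * y).
Proof.
apply: lin_span_mul => _ _ [v hv ->] [w hw ->]; exists (v ++ w).
  by rewrite size_cat leq_add.
by rewrite /word big_cat.
Qed.
Let len_predM m x y : len_pred m x -> len 1 y -> len m (x * y).
Proof.
case: m => [|m] /=; first by move=> -> _; rewrite mul0r; apply: len0.
by move=> xm y1; rewrite -[m.+1]addn1; apply: lenM.
Qed.
Let len_pred_len m x : len_pred m x -> len m x.
Proof. by case: m => [|m] /= => [->|]; [apply: len0|apply: len_le]. Qed.
Let len_pred0 m : len_pred m 0.
Proof. by case: m => //= m; apply: len0. Qed.
Let len_len_pred s m x : (s < m)%N -> len s x -> len_pred m x.
Proof. by case: m => // m sm; apply: len_le. Qed.
Let len_u g : len 1 (u g).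
Proof. by apply: lin_span_gen; exists [:: g] => //; rewrite /word big_seq1. Qed.
Let len_word w : len (size w) (word w).
Proof. by apply: lin_span_gen; exists w. Qed.

(* The coaction with its leading term x (x) 1 removed; the rows with a > 0
   determine all the others. *)
Definition der a b x : {poly A} := coact x (a, b) - (if a == b then x%:P else 0).

Let derE a b x : coact x (a, b) = der a b x + (if a == b then x%:P else 0).
Proof. by rewrite /der subrK. Qed.

Let derD a b x y : der a b (x + y) = der a b x + der a b y.
Proof.
rewrite /der rmorphD tmxD; case: eqP => _; last by rewrite !subr0.
by rewrite polyCD opprD addrACA.
Qed.

Let derZ a b (c : K) x : der a b (c *: x) = c%:A *: der a b x.
Proof.
rewrite /der linearZ /= tmxZ; case: eqP => _; last by rewrite !subr0.
by rewrite scalerBr -[_ *: x%:P]mul_polyC -polyCM mulr_algl.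
Qed.

Let der0 a b : der a b 0 = 0.
Proof. by rewrite -[0 in LHS](scale0r (0 : A)) derZ !scale0r. Qed.

(** A Leibniz rule: the first term differentiates [y], the last one [u g]. The middle term applies
    both and loses a letter on each side, so it will be negligible. *)
Let der_mulu a b y g : ~~ bar a ->
  der a b (y * u g) = der a b y * ((-1) ^+ (par g && bar b) *: u g)%:P
    + \sum_c der a c y * kmx A (val (X g)) (c, b)
    + y%:P * kmx A (val (X g)) (a, b).
Proof.
move=> a0; rewrite {1}/der rmorphM /= coact_u mulrDr tmxD.
have -> : (coact y * dmx n (par g) (u g)) (a, b) =
    coact y (a, b) * ((-1) ^+ (par g && bar b) *: u g)%:P.
  rewrite tmxM (bigD1 b) //= dmxE eqxx big1 ?addr0 // => c.
  by rewrite dmxE => /negPf ->; rewrite mulr0.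
have -> : (coact y * kmx A (val (X g))) (a, b) =
    \sum_c der a c y * kmx A (val (X g)) (c, b) + y%:P * kmx A (val (X g)) (a, b).
  rewrite tmxM; under eq_bigr => c _ do rewrite derE mulrDl.
  rewrite big_split /=; congr (_ + _); rewrite (bigD1 a) //= eqxx big1 ?addr0 // => c.
  by rewrite eq_sym => /negPf ->; rewrite mul0r.
rewrite derE; case: (a =P b) => [<-|_]; last by rewrite addr0 subr0 addrA.
(* For a > 0 there is no sign on the diagonal, so that the leading term [y * u g] cancels. *)
rewrite (negPf a0) andbF expr0 scale1r mulrDl -polyCM.
by rewrite !addrA [LHS](ACl (1*3*4*(2*5))) /= subrr addr0.
Qed.

Let kmx_coef_len m (p : {poly A}) (Z : glpoly K N) ab r :
  (forall r, len m p`_r) -> len m (p * kmx A Z ab)`_r.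
Proof.
move=> hp; rewrite coefM; apply: len_sum => i _.
by rewrite kmxE coef_map /= mulr_algr; apply: lenZ.
Qed.

Let der_len w a b r : ~~ bar a -> len_pred (size w) (der a b (word w))`_r.
Proof.
move=> a0; elim/last_ind: w b r => [|w g IH] b r.
  by rewrite /word big_nil /der rmorph1 tmx1 /=; case: eqP; rewrite subrr coef0.
rewrite size_rcons /word -cats1 big_cat big_seq1 /= -/(word w) der_mulu //.
rewrite !coefD coef_sum coefMC; apply: lenD; first apply: lenD.
- by apply: len_predM => //; apply/lenZ/len_u.
- by apply: len_sum => c _; apply: kmx_coef_len => s; apply/len_pred_len/IH.
by apply: kmx_coef_len => s; rewrite coefC; case: ifP => _; [apply: len_word|apply: len0].
Qed.

(** The coefficient of z^r in entry (a, b) belongs to the basis element F_ab^(r), which is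
    multiplied back on the right. *)
Definition euler x : A := \sum_(a | ~~ bar a) \sum_b hlin (F a b) (der a b x).

Let eulerD x y : euler (x + y) = euler x + euler y.
Proof.
rewrite /euler -big_split; apply: eq_bigr => a _; rewrite -big_split.
by apply: eq_bigr => b _; rewrite derD hlinD.
Qed.

Let eulerZ (c : K) x : euler (c *: x) = c *: euler x.
Proof.
rewrite /euler scaler_sumr; apply: eq_bigr => a _; rewrite scaler_sumr.
by apply: eq_bigr => b _; rewrite derZ hlinZ.
Qed.

Let hlin_len m a b (p : {poly A}) : (forall r, len_pred m p`_r) -> len m (hlin (F a b) p).
Proof. by move=> hp; apply: len_sum => r _; apply: len_predM. Qed.

(** Modulo shorter elements [euler] is a derivation fixing the letters. [S3] returns [y * u g] by
    [uX]; [S1] differs from [euler y * u g] by commutators of length 1, each multiplied by a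
    derivative of [y]; in [E2] the letter [u g] is lost and one [F a b r] makes up for it. *)
Let euler_mulu w g :
  len (size w) (euler (word w * u g) - (euler (word w) * u g + word w * u g)).
Proof.
set y := word w.
pose s b : K := (-1) ^+ (par g && bar b).
pose E1 := \sum_(a | ~~ bar a) \sum_b
  \sum_(r < size (der a b y)) (der a b y)`_r * (s b *: (u g * F a b r) - F a b r * u g).
pose E2 := \sum_(a | ~~ bar a) \sum_b
  hlin (F a b) (\sum_c der a c y * kmx A (val (X g)) (c, b)).
pose S1 := \sum_(a | ~~ bar a) \sum_b hlin (F a b) (der a b y * (s b *: u g)%:P).
pose S3 := \sum_(a | ~~ bar a) \sum_b
  hlin (F a b) (y%:P * kmx A (val (X g)) (a, b)).
have eE : euler (y * u g) = S1 + E2 + S3.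
  rewrite /euler /S1 /E2 /S3 -!big_split; apply: eq_bigr => a a0 /=.
  by rewrite -!big_split; apply: eq_bigr => b _ /=; rewrite der_mulu // !hlinD.
have S3E : S3 = y * u g.
  rewrite [in RHS]uX mulr_sumr; apply: eq_bigr => a _; rewrite mulr_sumr.
  by apply: eq_bigr => b _; rewrite kmxE hlin_plin.
have S1E : S1 - euler y * u g = E1.
  rewrite mulr_suml -sumrB; apply: eq_bigr => a _; rewrite mulr_suml -sumrB.
  apply: eq_bigr => b _; rewrite hlin_mulC mulr_suml -sumrB.
  by apply: eq_bigr => r _; rewrite -scalerAl mulrBr !mulrA.
have -> : euler (y * u g) - (euler y * u g + y * u g) = E1 + E2.
  by rewrite eE S3E -S1E opprD !addrA [LHS](ACl ((1*4*2)*(3*5))) /= subrr addr0.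
apply: lenD; apply: len_sum => a a0; apply: len_sum => b _.
  apply: len_sum => r _; apply: len_predM; first exact: der_len.
  exact: comm_uF.
apply: hlin_len => r; rewrite coef_sum.
case: (size w) (fun c r => @der_len w a c r a0) => [|m] /= hder.
  apply: big1 => c _; rewrite coefM big1 // => i _.
  by rewrite hder mul0r.
by apply: len_sum => c _; apply: kmx_coef_len => r'; apply: hder.
Qed.

Let euler_word w : len_pred (size w) (euler (word w) - (size w)%:R *: word w).
Proof.
elim/last_ind: w => [|w g IH].
  rewrite scale0r subr0 /euler big1 // => a a0; rewrite big1 // => b _.
  by apply: hlin_eq0 => r; apply: (@der_len [::] a b r a0).
have -> : word (rcons w g) = word w * u g by rewrite /word -cats1 big_cat big_seq1.
rewrite size_rcons /=.
have -> : euler (word w * u g) - (size w).+1%:R *: (word w * u g) =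
    (euler (word w * u g) - (euler (word w) * u g + word w * u g)) +
    (euler (word w) - (size w)%:R *: word w) * u g.
  rewrite mulrBl -scalerAl -[(size w).+1]addn1 natrD scalerDl scale1r.
  by rewrite !opprD !addrA [RHS](ACl ((1*5*3)*(2*4))) /= addNr addr0.
by apply: lenD; [apply: euler_mulu|apply: len_predM].
Qed.

Let euler_len m x : len m x -> len_pred m (euler x - m%:R *: x).
Proof.
have step y1 y2 : len_pred m (euler y1 - m%:R *: y1) ->
    len_pred m (euler y2 - m%:R *: y2) ->
    len_pred m (euler (y1 + y2) - m%:R *: (y1 + y2)).
  have -> : euler (y1 + y2) - m%:R *: (y1 + y2) =
    (euler y1 - m%:R *: y1) + (euler y2 - m%:R *: y2).
    by rewrite eulerD scalerDr opprD addrACA.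
  case: m => [|m] /=; last exact: lenD.
  by move=> -> ->; rewrite addr0.
have stepZ (c : K) y : len_pred m (euler y - m%:R *: y) ->
    len_pred m (euler (c *: y) - m%:R *: (c *: y)).
  have -> : euler (c *: y) - m%:R *: (c *: y) = c *: (euler y - m%:R *: y).
    by rewrite eulerZ scalerBr !scalerA mulrC.
  case: m {step} => [|m] /=; last exact: lenZ.
  by move=> ->; rewrite scaler0.
move=> [s [hs ->]]; elim: s hs => [|t s IH] hs.
  rewrite big_nil -(scale0r (0 : A)); apply: stepZ.
  rewrite (_ : euler 0 = 0); last by rewrite -(scale0r (0 : A)) eulerZ !scale0r.
  by rewrite scaler0 subrr; apply: len_pred0.
rewrite big_cons; apply: step; last first.
  by apply: IH => t' t's; apply: hs; rewrite inE t's orbT.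
apply: stepZ; have [w wm ->] := hs t (mem_head _ _).
have := euler_word w; case: (ltngtP (size w) m) wm => // [wm _|-> //].
(* A word shorter than [m] has the eigenvalue [size w] instead of [m], but the difference is a
   multiple of the word itself, hence negligible. *)
have -> : euler (word w) - m%:R *: word w =
    (euler (word w) - (size w)%:R *: word w) - (m - size w)%:R *: word w.
  by rewrite natrB ?(ltnW wm) // scalerBl opprB addrA addrNK.
move=> hw; apply: (len_len_pred wm).
apply: lenD; first exact: len_pred_len.
by apply/lenN/lenZ/len_word.
Qed.

Variables (B : algType K) (phi : {lrmorphism A -> B}).
Hypothesis char0 : forall m, m.+1%:R != 0 :> K.
Hypothesis phi_ker : forall x a b r, phi x = 0 -> phi (coact x (a, b))`_r = 0.

(* Applied to an element of length at most m in the kernel of phi, the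
   derivations give elements of smaller length in the kernel, hence 0, so that
   the Euler operator kills it; but it acts as m modulo smaller length. *)
Lemma euler_injective m x : len m x -> phi x = 0 -> x = 0.
Proof.
elim: m x => [|m IH] x xm x0.
  (* Elements of length 0 are scalars, on which [phi] is injective because 1 is nonzero in [B]. *)
  have [s [hs xs]] := xm.
  have [c xc] : exists c : K, x = c *: 1.
    rewrite xs; elim: s {xs} hs => [|t s IHs] hs.
      by exists 0; rewrite big_nil scale0r.
    have [|c hc] := IHs; first by move=> t' t's; apply: hs; rewrite inE t's orbT.
    have [[|//] _ tw] := hs t (mem_head _ _).
    by exists (t.1 + c); rewrite big_cons hc tw /word big_nil scalerDl.
  move: x0; rewrite xc linearZ /= rmorph1 => /eqP.
  by rewrite scaler_eq0 oner_eq0 orbF => /eqP ->; rewrite scale0r.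
apply: (IH) => //.
have ex : euler x = 0.
  rewrite /euler big1 // => a a0; rewrite big1 // => b _; apply: hlin_eq0 => r.
  apply: (IH).
    have [s [hs ->]] := xm; elim: s hs => [|t s IHs] hs.
      by rewrite big_nil der0 coef0; apply: len0.
    rewrite big_cons derD derZ coefD coefZ mulr_algl; apply: lenD; last first.
      by apply: IHs => t' t's; apply: hs; rewrite inE t's orbT.
    apply: lenZ; have [w wm ->] := hs t (mem_head _ _).
    have := der_len w b r a0; case: (size w) wm => [_ ->|k km]; first exact: len0.
    exact: len_le.
  have pB y z : phi (y - z) = phi y - phi z by exact: rmorphB.
  rewrite /der coefB pB phi_ker // sub0r.
  by case: eqP => _; rewrite ?coef0 ?rmorph0 ?oppr0 // coefC; case: ifP => _;
    rewrite ?x0 ?rmorph0 oppr0.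
have := euler_len xm; rewrite ex sub0r /= => h.
(* Characteristic 0 is used here: dividing by the Euler eigenvalue shows that [x] is shorter. *)
have -> : x = m.+1%:R^-1 *: - - (m.+1%:R *: x).
  by rewrite opprK scalerA mulVf ?scale1r.
exact/lenZ/lenN.
Qed.

End Euler.

(** * Parity and surjectivity *)

Section SignTwist.
Variables (K : fieldType) (N : nat) (S : algType K) (t : sidx N -> sidx N -> int -> S).
Hypothesis t_rtt : rtt t.
Implicit Types (i j k l : sidx N).

Definition sign_fam i j m : S := (-1) ^+ (bar i (+) bar j) *: t i j m.

(** Every product in one instance of the relation has the same total parity, so the instance is
    merely multiplied by a sign. *)
Lemma sign_fam_rtt : rtt sign_fam.
Proof.
move=> i j k l m n; pose s : K := (-1) ^+ (bar i (+) bar j (+) (bar k (+) bar l)).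
have row_opZ X l' i' k' : row_op (fun i k m n => s *: X i k m n : S) l' i' k' m n =
    s *: row_op X l' i' k' m n.
  rewrite /row_op !(scalerDr, scalerN, scalerA, opprD).
  by rewrite !(mulrC s).
have tt i1 j1 k1 l1 m1 n1 :
    bar i1 (+) bar j1 (+) (bar k1 (+) bar l1) = bar i (+) bar j (+) (bar k (+) bar l) ->
    sign_fam i1 j1 m1 * sign_fam k1 l1 n1 = s *: (t i1 j1 m1 * t k1 l1 n1).
  by move=> e; rewrite /sign_fam -scalerAl -scalerAr scalerA -signr_addb e.
have e1 : bar k (+) bar j (+) (bar i (+) bar l) = bar i (+) bar j (+) (bar k (+) bar l).
  by case: (bar i) (bar j) (bar k) (bar l) => [] [] [] [].
have e2 : bar (neg k) (+) bar j (+) (bar (neg i) (+) bar l) =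
    bar i (+) bar j (+) (bar k (+) bar l).
  by rewrite !bar_neg; case: (bar i) (bar j) (bar k) (bar l) => [] [] [] [].
have e3 : bar k (+) bar l (+) (bar i (+) bar j) = bar i (+) bar j (+) (bar k (+) bar l).
  exact: addbC.
have e4 : bar k (+) bar (neg j) (+) (bar i (+) bar (neg l)) =
    bar i (+) bar j (+) (bar k (+) bar l).
  by rewrite !bar_neg; case: (bar i) (bar j) (bar k) (bar l) => [] [] [] [].
have := congr1 (fun x => s *: x) (t_rtt i j k l m n); rewrite -!row_opZ /row_op.
by rewrite !(tt i j k l) // !(tt k j i l) // !(tt _ _ _ _ _ _ e2) !(tt _ _ _ _ _ _ e3)
  !(tt _ _ _ _ _ _ e4).
Qed.

Lemma sign_fam_neg i j m : (forall i j m, m < 0 -> t i j m = 0) ->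
  m < 0 -> sign_fam i j m = 0.
Proof. by move=> t0 m0; rewrite /sign_fam t0 // scaler0. Qed.

Lemma sign_fam0 i j : (forall i j, t i j 0 = (i == j)%:R) ->
  sign_fam i j 0 = (i == j)%:R.
Proof.
move=> t1; rewrite /sign_fam t1; case: eqP => [->|_]; last by rewrite scaler0.
by rewrite addbb scale1r.
Qed.

Lemma sign_fam_sym i j m :
  (forall i j m, (-1) ^+ `|m|%N *: t i j m = t (neg i) (neg j) m) ->
  (-1) ^+ `|m|%N *: sign_fam i j m = sign_fam (neg i) (neg j) m.
Proof.
move=> h; rewrite /sign_fam -h !scalerA mulrC.
by rewrite !bar_neg addbN addNb negbK.
Qed.

End SignTwist.

Section GradedParity.
Variables (K : fieldType) (N : nat).
Local Notation Y := (yangian K N).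
Local Notation F := (yfiltration K N).
Implicit Types (i j k l : sidx N) (p q : bool).

Lemma yparity0 p : @yparity K N p 0. Proof. exact: lin_span0. Qed.

Lemma yparityM p q x y : @yparity K N p x -> @yparity K N q y ->
  @yparity K N (p (+) q) (x * y).
Proof.
apply: lin_span_mul => _ _ [v <- ->] [w <- ->]; exists (v ++ w).
  by rewrite big_cat.
by rewrite /yword big_cat.
Qed.

Lemma yparity1 : @yparity K N false 1.
Proof.
apply: lin_span_gen; exists [::]; first by rewrite big_nil.
by rewrite /yword big_nil.
Qed.

Lemma yparityT i j s : @yparity K N (bar i (+) bar j) (yT K i j s.+1).
Proof.
apply: lin_span_gen; exists [:: (i, j, s)]; first by rewrite big_seq1.
by rewrite /yword big_seq1.
Qed.

Let apif : {lrmorphism fsum F -> gr_yangian K N} := api (@fsum_ideal K Y F).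

Lemma gr_parity0 p : @gr_yparity K N p 0.
Proof.
exists 0; split=> [d|]; last exact/esym/(rmorph0 apif).
by rewrite coef0; apply: yparity0.
Qed.

Lemma gr_parityD p x y : @gr_yparity K N p x -> @gr_yparity K N p y ->
  @gr_yparity K N p (x + y).
Proof.
move=> [r [hr ->]] [s [hs ->]]; exists (r + s); split=> [d|]; last exact/esym/(rmorphD apif).
by rewrite coefD; apply: lin_spanD; [apply: hr|apply: hs].
Qed.

Lemma gr_parityZ p (c : K) x : @gr_yparity K N p x -> @gr_yparity K N p (c *: x).
Proof.
have aZ (e : K) r : apif (e *: r) = e *: apif r by exact: linearZ.
move=> [r [hr ->]]; exists (c *: r); split=> [d|]; last exact/esym/aZ.
by rewrite /= coefZ mulr_algl; apply: lin_spanZ; apply: hr.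
Qed.

Lemma gr_parityN p x : @gr_yparity K N p x -> @gr_yparity K N p (- x).
Proof. by rewrite -scaleN1r; apply: gr_parityZ. Qed.

Lemma gr_parity_sum p (J : finType) (P : pred J) (f : J -> gr_yangian K N) :
  (forall z, P z -> @gr_yparity K N p (f z)) -> @gr_yparity K N p (\sum_(z | P z) f z).
Proof.
by move=> h; elim/big_rec: _ => [|z x /h hz]; [apply: gr_parity0|apply: gr_parityD].
Qed.

Lemma gr_parityM p q x y : @gr_yparity K N p x -> @gr_yparity K N q y ->
  @gr_yparity K N (p (+) q) (x * y).
Proof.
move=> [r [hr ->]] [s [hs ->]]; exists (r * s); split=> [d|]; last exact/esym/(rmorphM apif).
rewrite coefM; elim/big_rec: _ => [|i z _]; first exact: yparity0.
by apply: lin_spanD; apply: yparityM.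
Qed.

Lemma gr_parity1 : @gr_yparity K N false 1.
Proof.
exists 1; split=> [d|]; last exact/esym/(rmorph1 apif).
by rewrite coef1; case: d => [|d]; [apply: yparity1|apply: yparity0].
Qed.

Lemma gr_parityG i j s : @gr_yparity K N (bar i (+) bar j) (yG K i j s).
Proof.
exists (FSum (gr_symbol_subproof (yfil_T K i j s : F s _))); split=> [d|] //.
rewrite /= coefZ coefXn; case: eqP => [_|_]; last by rewrite mulr0; apply: yparity0.
by rewrite mulr1; apply: yparityT.
Qed.

Lemma gr_parity_inj p X : tw_homog p X -> @gr_yparity K N p (phi K N (Utw_inj X)).
Proof.
move=> hX; rewrite phi_inj /phi0 /twlin; apply: gr_parity_sum => a _.
apply: gr_parity_sum => b _; have [->|/hX <-] := eqVneq (val X (a, b)) 0.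
  by rewrite plin0; apply: gr_parity0.
apply: gr_parity_sum => r _; apply: gr_parityZ; apply: gr_parityN; apply: gr_parityZ.
by rewrite addbC; apply: gr_parityG.
Qed.

Lemma phi_parity p x : @Utw_parity K N p x -> @gr_yparity K N p (phi K N x).
Proof.
move=> [s [hs ->]].
have -> : phi K N (\sum_(t <- s) t.1 *: t.2) = \sum_(t <- s) t.1 *: phi K N t.2.
  have phiZ (c : K) y : phi K N (c *: y) = c *: phi K N y by exact: linearZ.
  transitivity (\sum_(t <- s) phi K N (t.1 *: t.2)); first exact: rmorph_sum.
  by apply: eq_bigr => t _; rewrite phiZ.
elim: s hs => [|t s IH] hs; first by rewrite big_nil; apply: gr_parity0.
rewrite big_cons; apply: gr_parityD; last first.
  by apply: IH => t' t's; apply: hs; rewrite inE t's orbT.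
apply: gr_parityZ; have [w [hw <- ->]] := hs t (mem_head _ _).
elim: w hw {hs} => [|a w IHw] hw.
  rewrite !big_nil (_ : phi K N 1 = 1); last exact: rmorph1.
  exact: gr_parity1.
rewrite !big_cons (_ : phi K N (_ * _) = phi K N (Utw_inj a.1) *
  phi K N (\prod_(z <- w) uinj (@tw_homog K N) (@tw_bracket K N) z.1)); last exact: rmorphM.
apply: gr_parityM; first by apply: gr_parity_inj; apply: hw; apply: mem_head.
by apply: IHw => a' a'w; apply: hw; rewrite inE a'w orbT.
Qed.

(** The parity automorphism of Y: it acts as 1 on the even and as -1 on the odd component, and so
    tells apart two subspaces defined only as spans. *)
Definition yinvol : {lrmorphism Y -> Y} :=
  ylift (fun i j m => @sign_fam_neg K N Y (@yTz K N) i j m (@yTz_neg K N))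
    (fun i j => @sign_fam0 K N Y (@yTz K N) i j (@yTz0 K N))
    (sign_fam_rtt (@yTz_rtt K N))
    (fun i j m => @sign_fam_sym K N Y (@yTz K N) i j m (@yTz_sym K N)).

Lemma yinvolT i j s : yinvol (yT K i j s) = (-1) ^+ (bar i (+) bar j) *: yT K i j s.
Proof. exact: ylift_T. Qed.

Lemma yinvol_word w : yinvol (yword K w) =
  (-1) ^+ (\big[addb/false]_(g <- w) (bar g.1.1 (+) bar g.1.2)) *: yword K w.
Proof.
have piM x y : yinvol (x * y) = yinvol x * yinvol y by exact: rmorphM.
elim: w => [|g w IH].
  rewrite /yword !big_nil scale1r; exact: rmorph1.
rewrite yword_cons big_cons piM IH yinvolT -scalerAl -scalerAr scalerA.
by rewrite -signr_addb.
Qed.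

Let yinvolZ (c : K) x : yinvol (c *: x) = c *: yinvol x.
Proof. exact: linearZ. Qed.

Let yinvol_lin (s : seq (K * Y)) :
  yinvol (\sum_(t <- s) t.1 *: t.2) = \sum_(t <- s) t.1 *: yinvol t.2.
Proof.
transitivity (\sum_(t <- s) yinvol (t.1 *: t.2)); first exact: rmorph_sum.
by apply: eq_bigr => t _; apply: yinvolZ.
Qed.

Lemma yinvol_parity p x : @yparity K N p x -> yinvol x = (-1) ^+ p *: x.
Proof.
move=> [s [hs ->]]; apply: etrans (yinvol_lin s) _.
elim: s hs => [|t s IH] hs; first by rewrite !big_nil scaler0.
rewrite !big_cons scalerDr IH; last by move=> t' t's; apply: hs; rewrite inE t's orbT.
congr (_ + _); rewrite scalerA mulrC -scalerA; congr (_ *: _).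
by have [w <- ->] := hs t (mem_head _ _); apply: yinvol_word.
Qed.

Lemma yinvol_fil d x : @yfil K N d x -> @yfil K N d (yinvol x).
Proof.
move=> [s [hs ->]]; suff : @yfil K N d (\sum_(t <- s) t.1 *: yinvol t.2).
  by rewrite -yinvol_lin.
elim: s hs => [|t s IH] hs; first by rewrite big_nil; apply: (fil0 F).
rewrite big_cons; apply: lin_spanD; last first.
  by apply: IH => t' t's; apply: hs; rewrite inE t's orbT.
apply: lin_spanZ; have [w wd ->] := hs t (mem_head _ _).
by rewrite yinvol_word; apply/lin_spanZ/lin_span_gen; exists w.
Qed.

Hypothesis two_neq0 : 2%:R != 0 :> K.

(** Representatives y and y' of opposite parity differ by an element of lower degree. The
    automorphism preserves the filtration and turns y - y' into y + y' up to sign, so y itself, half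
    the sum of the two, is of lower degree. *)
Lemma gr_parity_disjoint p x : @gr_yparity K N p x -> @gr_yparity K N (~~ p) x -> x = 0.
Proof.
move=> [r [hr ->]] [r' [hr' e]]; apply/eqP; rewrite -(rmorph0 apif); apply/eqP/apiP.
rewrite subr0; apply/asboolP => d.
have /apiP/asboolP/(_ d) := e; rewrite coefB.
move: (val r)`_d (val r')`_d (hr d) (hr' d) => y y' hy hy' hd.
have hd' : fil_pred F d (y + y').
  have <- : (-1) ^+ p *: yinvol (y - y') = y + y'.
    have -> : yinvol (y - y') = yinvol y - yinvol y' by exact: rmorphB.
    rewrite (yinvol_parity hy) (yinvol_parity hy') signrN scaleNr opprK.
    by rewrite scalerDr !scalerA -signr_addb addbb !scale1r.
  case: d hd => [hd|d hd]; last exact/lin_spanZ/yinvol_fil.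
  have {}hd : y - y' = 0 := hd.
  rewrite hd; have -> : yinvol 0 = 0 := rmorph0 yinvol.
  rewrite scaler0; exact: (fil_pred0 F).
have -> : y = 2%:R^-1 *: ((y - y') + (y + y')).
  by rewrite addrACA addNr addr0 -mulr2n -scaler_nat scalerA mulVf ?scale1r.
case: d hd hd' => [|d] hd hd'; last exact/lin_spanZ/lin_spanD.
have {}hd : y - y' = 0 := hd; have {}hd' : y + y' = 0 := hd'.
rewrite hd hd' addr0 scaler0; exact: (fil_pred0 F).
Qed.

End GradedParity.

Section Surjectivity.
Variables (K : fieldType) (N : nat).
Local Notation Y := (yangian K N).
Local Notation F := (yfiltration K N).

Lemma sym_rel_phi d (y : Y) h : @sym_rel K Y F d y h -> exists x, phi K N x = h.
Proof.
move=> yh; have [s [hs ys]] := sym_rel_fil yh.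
have phiD x z : phi K N (x + z) = phi K N x + phi K N z by exact: rmorphD.
have phiZ (c : K) x : phi K N (c *: x) = c *: phi K N x by exact: linearZ.
have phi0' : phi K N 0 = 0 by exact: rmorph0.
suff [x hx] : exists x, @sym_rel K Y F d y (phi K N x).
  by exists x; apply: sym_rel_uniq hx yh.
rewrite ys; elim: s hs {ys} => [|t s IH] hs.
  by exists 0; rewrite big_nil phi0'; apply: sym_rel0.
have [|x hx] := IH; first by move=> t' t's; apply: hs; rewrite inE t's orbT.
have [w wd tw] := hs t (mem_head _ _).
have [e|ne] := eqVneq (\sum_(g <- w) g.2)%N d.
  exists (t.1 *: uword K w + x); rewrite big_cons phiD phiZ tw.
  by apply: sym_relD => //; apply: sym_relZ; rewrite -e; apply: sym_rel_word.
(* A word of degree less than [d] has symbol 0 in degree [d]. *)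
exists (0 + x); rewrite big_cons phiD phi0' tw; apply: sym_relD => //.
rewrite -(scaler0 _ t.1); apply: sym_relZ; apply: sym_rel_lower.
have wd' : (\sum_(g <- w) g.2 < d)%N by rewrite ltn_neqAle ne.
by case: (d) wd' => // d' wd'; apply: lin_span_gen; exists w.
Qed.

Lemma phi_surj h : exists x, phi K N x = h.
Proof.
have -> : h = api (@fsum_ideal K Y F) (repr h) by rewrite api_repr.
have [f [hf ->]] := gr_sum (repr h).
have phiD x z : phi K N (x + z) = phi K N x + phi K N z by exact: rmorphD.
elim/big_rec: _ => [|d g _ [x <-]]; first by exists 0; apply: rmorph0.
by have [z <-] := sym_rel_phi (hf d); exists (z + x).
Qed.

End Surjectivity.

(** * Injectivity and the isomorphism *)

Section Isomorphism.
Variables (K : fieldType) (n : nat).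
Local Notation N := n.+1.
Hypothesis char0 : forall m, m.+1%:R != 0 :> K.

Lemma phi_injective x : phi K N x = 0 -> x = 0.
Proof.
have h1 g : ucoact K n (uletter K g) =
    dmx n (bar g.1.1 (+) bar g.1.2) (uletter K g) + kmx (Utw K N) (val (cur_letter K g)).
  exact: ucoact_letter.
pose F a b r : Utw K N := Utw_inj (twF K a b r).
have h2 g : uletter K g = twlin F (cur_letter K g).
  by rewrite uletterE; apply: Utw_inj_twlin.
have h3 a b r : ulen 1 (F a b r) by exact: ulen_inj.
have h4 g a b r : ~~ bar a -> ulen 1 ((-1) ^+ ((bar g.1.1 (+) bar g.1.2) && bar b) *:
    (uletter K g * F a b r) - F a b r * uletter K g).
  move=> a0; rewrite uletterE /F.
  (* Up to sign this is the supercommutator of two elements of g, again an element of g and so of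
     length 1. *)
  have := uinj_bracket (@tw_bracket K N) (@twF_homog K N a b r) (@cur_letter_homog K N g).
  rewrite (negPf a0) andbC /= => h.
  rewrite -opprB.
  apply: ulenN; exact: (eq_ind_r (ulen 1) (ulen_inj _) h).
have [m xm] := Utw_span x.
have E := @euler_injective K n (Utw K N) (ucoact K n) (ygen N) (@uletter K N)
  (fun g => bar g.1.1 (+) bar g.1.2) (@cur_letter K N) F h1 h2 h3 h4.
exact: (E (gr_yangian K N) (phi K N) char0 (@phi_coact_ker K n) m x xm).
Qed.

End Isomorphism.

Lemma Utw_parity_letter (K : fieldType) (N : nat) w :
  Utw_parity (\big[addb/false]_(g <- w) (bar g.1.1 (+) bar g.1.2)) (@uword K N w).
Proof.
apply: lin_span_gen.
exists [seq (cur_letter K g, bar g.1.1 (+) bar g.1.2) | g <- w]; split.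
- by move=> _ /mapP[g _ ->]; apply: cur_letter_homog.
- by rewrite big_map.
- by rewrite big_map; apply: eq_bigr => g _; apply: uletterE.
Qed.

(** Split x as y + z with z of the wrong parity. Then phi z = phi x - phi y has both parities, hence
    is 0, and z = 0 by injectivity. *)
Lemma phi_parity_refl (K : fieldType) (n : nat) (char0 : forall m, m.+1%:R != 0 :> K) p x :
  @gr_yparity K n.+1 p (phi K n.+1 x) -> Utw_parity p x.
Proof.
move=> hx; have [m [s [hs xs]]] := Utw_span x.
have phiD y z : phi K n.+1 (y + z) = phi K n.+1 y + phi K n.+1 z by exact: rmorphD.
have [y [z [yp zp xyz]]] : exists y, exists z,
    [/\ @Utw_parity K n.+1 p y, @Utw_parity K n.+1 (~~ p) z & x = y + z].
  rewrite xs; elim: s hs {xs} => [|t s IH] hs.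
    by exists 0, 0; rewrite big_nil addr0; split=> //; apply: lin_span0.
  have [|y [z [yp zp xyz]]] := IH; first by move=> t' t's; apply: hs; rewrite inE t's orbT.
  have [w _ tw] := hs t (mem_head _ _); have := Utw_parity_letter K w; rewrite -tw.
  set q := \big[_/_]_(_ <- w) _ => tp; rewrite big_cons xyz.
  case: (q =P p) tp => [->|/eqP ne] tp.
    by exists (t.1 *: t.2 + y), z; rewrite addrA; split=> //; apply/lin_spanD/yp/lin_spanZ.
  exists y, (t.1 *: t.2 + z); rewrite addrCA; split=> //; apply/lin_spanD/zp/lin_spanZ.
  by have -> : ~~ p = q by case: p q ne {xyz yp zp tp hx IH} => [] [].
have z0 : phi K n.+1 z = 0.
  apply: (gr_parity_disjoint (char0 1%N) (p := p)); last exact: phi_parity.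
  have -> : phi K n.+1 z = phi K n.+1 x - phi K n.+1 y.
    by rewrite xyz phiD addrC addKr.
  by apply: gr_parityD => //; apply/gr_parityN/phi_parity.
by rewrite xyz (phi_injective char0 z0) addr0.
Qed.

Theorem theorem2p3 (R : realType) (N : nat) (hN : (1 <= N)%N) :
  exists phi : {lrmorphism Utw R[i] N -> gr_yangian R[i] N},
    [/\ forall (i j : sidx N) (s : nat),
          phi (Utw_inj (twF R[i] j i s)) = - ((-1) ^+ bar j *: yG R[i] i j s),
        bijective phi,
        forall (p : bool) (x : Utw R[i] N),
          Utw_parity p x <-> gr_yparity p (phi x)
      & forall psi : {lrmorphism Utw R[i] N -> gr_yangian R[i] N},
          (forall (i j : sidx N) (s : nat),
             psi (Utw_inj (twF R[i] j i s)) = - ((-1) ^+ bar j *: yG R[i] i j s)) ->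
          psi =1 phi].
Proof.
case: N hN => // n _; exists (phi R[i] n.+1).
have char0 m : m.+1%:R != 0 :> R[i] by rewrite Num.Theory.pnatr_eq0.
have phi_inj x y : phi R[i] n.+1 x = phi R[i] n.+1 y -> x = y.
  move=> xy; apply/eqP; rewrite -subr_eq0; apply/eqP/(phi_injective char0).
  have -> : phi R[i] n.+1 (x - y) = phi R[i] n.+1 x - phi R[i] n.+1 y by exact: rmorphB.
  by rewrite xy subrr.
split.
- exact: phi_F.
- have [f hf] := choice (@phi_surj R[i] n.+1).
  by exists f => // x; apply: phi_inj; apply: hf.
- by move=> p x; split; [apply: phi_parity|apply: phi_parity_refl].
- have lrmorph_words (f : {lrmorphism Utw R[i] n.+1 -> gr_yangian R[i] n.+1})
      (s : seq (R[i] * Utw R[i] n.+1)) :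
      f (\sum_(t <- s) t.1 *: t.2) = \sum_(t <- s) t.1 *: f t.2.
    transitivity (\sum_(t <- s) f (t.1 *: t.2)); first exact: rmorph_sum.
    by apply: eq_bigr => t _; apply: linearZ.
  have lrmorph_letter (f : {lrmorphism Utw R[i] n.+1 -> gr_yangian R[i] n.+1}) g :
      f (uletter R[i] g) =
      - ((-1) ^+ bar g.1.2 *: f (Utw_inj (twF R[i] g.1.2 g.1.1 g.2))).
    have fN y : f (- y) = - f y by exact: rmorphN.
    by rewrite /uletter fN; congr (- _); apply: linearZ.
  have lrmorph_word (f : {lrmorphism Utw R[i] n.+1 -> gr_yangian R[i] n.+1}) w :
      f (uword R[i] w) = \prod_(g <- w) f (uletter R[i] g) by exact: rmorph_prod.
  (* Uniqueness: both morphisms agree on the letters, whose words span U(g). *)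
  move=> psi hpsi x; have [m [s [hs ->]]] := Utw_span x.
  apply: etrans (lrmorph_words psi s) (etrans _ (esym (lrmorph_words (phi R[i] n.+1) s))).
  rewrite big_seq [RHS]big_seq; apply: eq_bigr => t /hs [w _ ->]; congr (_ *: _).
  apply: etrans (lrmorph_word psi w) (etrans _ (esym (lrmorph_word (phi R[i] n.+1) w))).
  apply: eq_bigr => g _.
  apply: etrans (lrmorph_letter psi g) (etrans _ (esym (lrmorph_letter (phi R[i] n.+1) g))).
  by congr (- (_ *: _)); apply: etrans (hpsi _ _ _) (esym (phi_F _ _ _ _)).
Qed.
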